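(* Projectivity does not pass to full hereditary sub-$C^*$-algebras; that is, there exist a projective $C^*$-algebra $P$ and a full hereditary sub-$C^*$-algebra $Q\subseteq P$ such that $Q$ is not projective.
   Context: A morphism between $C^*$-algebras is a $*$-homomorphism (not assumed unital); ideals are closed and two-sided. A $C^*$-algebra $A$ is projective if for every $C^*$-algebra $C$, ideal $J\lhd C$ and morphism $\sigma\colon A\to C/J$ there is a morphism $\psi\colon A\to C$ with $\pi\circ\psi=\sigma$, where $\pi\colon C\to C/J$ is the quotient morphism. A sub-$C^*$-algebra $Q\subseteq P$ is hereditary if $0\le a\le b$ with $a\in P$, $b\in Q$ implies $a\in Q$, and full if the closed two-sided ideal of $P$ generated by $Q$ is $P$. *)

(* Defs.v *)
From HB Require Import structures.
From mathcomp Require Import all_boot all_order all_algebra.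
From mathcomp Require Import generic_quotient ring_quotient.
From mathcomp Require Import complex.
From mathcomp Require Import boolp classical_sets reals topology normedtype.

Set Implicit Arguments.
Unset Strict Implicit.
Unset Printing Implicit Defensive.

Import Order.TTheory GRing.Theory Num.Theory.
Import numFieldNormedType.Exports.

Local Open Scope classical_set_scope.
Local Open Scope quotient_scope.
Local Open Scope ring_scope.
Local Open Scope complex_scope.

(* The scalars are R[i], for an arbitrary model R of the real numbers. No unit
   is required, so the ring structures of MathComp do not apply. The operations
   are separated from the axioms because being a *-homomorphism only involves
   the former. *)
HB.mixin Record hasMulStar (R : realType) V of GRing.Lmodule R[i] V := {
  amul : V -> V -> V;
  star : V -> V
}.

#[short(type="preStarAlgType")]
HB.structure Definition PreStarAlg (R : realType) :=
  {V of GRing.Lmodule R[i] V & hasMulStar R V}.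

Declare Scope cstar_scope.
Delimit Scope cstar_scope with cstar.
Local Open Scope cstar_scope.
Notation "x ** y" := (amul x y) (at level 40, left associativity) : cstar_scope.

HB.mixin Record isCstar (R : realType) V
    of CompleteNormedModule R[i] V & PreStarAlg R V := {
  amulA : associative (@amul R V);
  amul_linearl : forall (a : R[i]) (x y z : V),
    (a *: x + y) ** z = a *: (x ** z) + y ** z;
  amul_linearr : forall (a : R[i]) (x y z : V),
    z ** (a *: x + y) = a *: (z ** x) + z ** y;
  starK : involutive (@star R V);
  star_antilinear : forall (a : R[i]) (x y : V),
    star (a *: x + y) = conjc a *: star x + star y;
  starM : forall x y : V, star (x ** y) = star y ** star x;
  normM_le : forall x y : V, `|x ** y| <= `|x| * `|y|;
  norm_cstar : forall x : V, `|star x ** x| = `|x| ^+ 2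
}.

#[short(type="cstarType")]
HB.structure Definition Cstar (R : realType) :=
  {V of CompleteNormedModule R[i] V & PreStarAlg R V & isCstar R V}.

Definition star_hom (R : realType) (A B : preStarAlgType R)
    (f : {linear A -> B}) : Prop :=
  {morph f : x y / x ** y} /\ {morph f : x / star x}.

Section Ideals.
Context {R : realType} (C : cstarType R).

Definition is_ideal (J : set C) : Prop :=
  [/\ closed J, J 0,
      forall (a : R[i]) x y, J x -> J y -> J (a *: x + y)
    & forall x y, J x -> J (x ** y) /\ J (y ** x)].

Record ideal := Ideal { ideal_set :> set C; ideal_axiom : is_ideal ideal_set }.

Definition ideal_generated (S : set C) : set C := smallest is_ideal S.

End Ideals.

Section Quotient.
Context {R : realType} {C : cstarType R} (J : ideal C).

Definition ideal_pred : {pred C} := fun x => x \in (J : set C).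

Let ideal_pred_submod : submod_closed ideal_pred.
Proof.
have [_ J0 JD _] := ideal_axiom J.
split; first exact/mem_set.
by move=> a x y /set_mem Jx /set_mem Jy; apply/mem_set/JD.
Qed.

HB.instance Definition _ :=
  GRing.isSubmodClosed.Build R[i] C ideal_pred ideal_pred_submod.

Definition quotient : Type := Quotient.quot ideal_pred.

HB.instance Definition _ := GRing.Zmodule.on quotient.
HB.instance Definition _ := EqQuotient.on quotient.
HB.instance Definition _ := ZmodQuotient.on quotient.

Lemma quotient_eqP (x y : C) :
  reflect (ideal_set J (x - y)) (x == y %[mod quotient]).
Proof.
rewrite -[_ == _](Quotient.idealrBE ideal_pred).
by apply/(iffP idP); [move/set_mem|move/mem_set].
Qed.

Definition quotient_scale (a : R[i]) (u : quotient) : quotient :=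
  \pi_quotient (a *: repr u).

Lemma pi_scale (a : R[i]) (x : C) :
  quotient_scale a (\pi_quotient x) = \pi_quotient (a *: x).
Proof.
apply/eqP/quotient_eqP; rewrite -scalerBr.
have [_ J0 JD _] := ideal_axiom J; rewrite -[_ *: _]addr0; apply: JD => //.
by apply/quotient_eqP; rewrite reprK.
Qed.

Let scalerA_subproof a b u :
  quotient_scale a (quotient_scale b u) = quotient_scale (a * b) u.
Proof. by rewrite -[u]reprK (pi_scale b) !pi_scale scalerA. Qed.

Let scale1r_subproof : left_id 1 quotient_scale.
Proof. by move=> u; rewrite -[u]reprK !pi_scale scale1r. Qed.

Let scalerDr_subproof : right_distributive quotient_scale +%R.
Proof.
move=> a u v; rewrite -[u]reprK -[v]reprK -raddfD !pi_scale -raddfD.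
by rewrite scalerDr.
Qed.

Let scalerDl_subproof u : {morph quotient_scale^~ u : a b / a + b}.
Proof.
by move=> a b; rewrite -[u]reprK !pi_scale -raddfD scalerDl.
Qed.

HB.instance Definition _ := GRing.Zmodule_isLmodule.Build R[i] quotient
  scalerA_subproof scale1r_subproof scalerDr_subproof scalerDl_subproof.

(* A closed two-sided ideal of a C*-algebra is automatically self-adjoint, so
   the involution below is independent of the choice of representatives, and
   C/J is a C*-algebra for the quotient norm. The norm is not recorded here:
   it plays no role in what a *-homomorphism into C/J is, and continuity is not
   part of the definition of a morphism. *)
HB.instance Definition _ := hasMulStar.Build R quotient
  (fun u v => \pi_quotient (repr u ** repr v))
  (fun u => \pi_quotient (star (repr u))).

Lemma pi_mul : {morph \pi_quotient : x y / x ** y}.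
Proof.
move=> x y; apply/eqP/quotient_eqP.
have [_ J0 JD JM] := ideal_axiom J.
pose x' := repr (\pi_quotient x); pose y' := repr (\pi_quotient y).
have Jx : ideal_set J (x - x') by apply/quotient_eqP; rewrite reprK.
have Jy : ideal_set J (y - y') by apply/quotient_eqP; rewrite reprK.
suff -> : x ** y - x' ** y' = 1 *: ((x - x') ** y) + x' ** (y - y').
  by apply: JD; [case: (JM _ y Jx)|case: (JM _ x' Jy)].
have subl (a b c : C) : (a - b) ** c = a ** c - b ** c.
  by rewrite -[a - b]addrC -scaleN1r amul_linearl scaleN1r addrC.
have subr (a b c : C) : c ** (a - b) = c ** a - c ** b.
  by rewrite -[a - b]addrC -scaleN1r amul_linearr scaleN1r addrC.
by rewrite scale1r subl subr addrA subrK.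
Qed.

End Quotient.

Definition projective (R : realType) (A : cstarType R) : Prop :=
  forall (C : cstarType R) (J : ideal C) (sigma : {linear A -> quotient J}),
    star_hom sigma ->
  exists2 psi : {linear A -> C},
    star_hom psi & forall a, \pi_(quotient J) (psi a) = sigma a.

Section Subalgebras.
Context {R : realType} (P : cstarType R).

Definition is_subcstar (Q : set P) : Prop :=
  [/\ closed Q, Q 0,
      forall (a : R[i]) x y, Q x -> Q y -> Q (a *: x + y),
      forall x y, Q x -> Q y -> Q (x ** y)
    & forall x, Q x -> Q (star x)].

Record subcstar := SubCstar {
  subcstar_set :> set P;
  subcstar_axiom : is_subcstar subcstar_set
}.

Definition cstar_pos (a : P) : Prop := exists x : P, a = star x ** x.

Definition cstar_le (a b : P) : Prop := cstar_pos (b - a).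

Definition hereditary (Q : set P) : Prop :=
  forall a b : P, cstar_le 0 a -> cstar_le a b -> Q b -> Q a.

Definition full (Q : set P) : Prop := ideal_generated Q = [set: P].

End Subalgebras.

Section SubalgebraType.
Context {R : realType} {P : cstarType R} (Q : subcstar P).

Definition subcstar_pred : {pred P} := fun x => x \in (Q : set P).

Let subcstar_pred_submod : submod_closed subcstar_pred.
Proof.
have [_ Q0 QD _ _] := subcstar_axiom Q.
split; first exact/mem_set.
by move=> a x y /set_mem Qx /set_mem Qy; apply/mem_set/QD.
Qed.

HB.instance Definition _ :=
  GRing.isSubmodClosed.Build R[i] P subcstar_pred subcstar_pred_submod.

Definition subcstar_type : Type := {x : P | subcstar_pred x}.

HB.instance Definition _ := Choice.on subcstar_type.
HB.instance Definition _ := SubType.on subcstar_type.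
HB.instance Definition _ :=
  [SubChoice_isSubLmodule of subcstar_type by <:].

Let ler_normD_subproof (x y : subcstar_type) :
  `|val (x + y)| <= `|val x| + `|val y|.
Proof. by rewrite raddfD ler_normD. Qed.

Let normrZ_subproof (l : R[i]) (x : subcstar_type) :
  `|val (l *: x)| = `|l| * `|val x|.
Proof. by rewrite linearZ normrZ. Qed.

Let normr0_eq0_subproof (x : subcstar_type) : `|val x| = 0 -> x = 0.
Proof. by move/normr0_eq0 => x0; apply/val_inj; rewrite x0 raddf0. Qed.

HB.instance Definition _ := Lmodule_isNormed.Build R[i] subcstar_type
  ler_normD_subproof normrZ_subproof normr0_eq0_subproof.

Lemma subcstar_normE (x : subcstar_type) : `|x| = `|val x|.
Proof. by []. Qed.

Let subcstar_complete (F : set_system subcstar_type) :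
  ProperFilter F -> cauchy F -> cvg F.
Proof.
move=> FF Fc; have [Qcl _ _ _ _] := subcstar_axiom Q.
have valB (x y : subcstar_type) : `|x - y| = `|val x - val y|.
  by rewrite subcstar_normE raddfB.
have Gc : cauchy (val @ F).
  apply/(@cauchy_ballP R[i] P) => e e0.
  move/(@cauchy_ballP R[i] subcstar_type) : Fc => /(_ e e0) Fe.
  rewrite near_map2; apply: filterS Fe => -[x y].
  by rewrite -!ball_normE /= -valB.
have /cvg_ex[l Gl] : cvg (val @ F) by exact: cauchy_cvg Gc.
have Ql : subcstar_pred l.
  apply/mem_set; apply: (closed_cvg _ Qcl _ _ Gl).
  by apply: nearW => x; exact/set_mem/valP.
apply/cvg_ex; exists (Sub l Ql : subcstar_type).
apply/cvgrPdist_lt => e e0.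
move/cvgrPdist_lt : Gl => /(_ e e0).
by apply: filterS => x; rewrite valB SubK.
Qed.

HB.instance Definition _ :=
  Uniform_isComplete.Build subcstar_type subcstar_complete.

Let subcstar_mul_subproof (x y : subcstar_type) :
  subcstar_pred (val x ** val y).
Proof.
have [_ _ _ QM _] := subcstar_axiom Q.
by apply/mem_set/QM; apply/set_mem/valP.
Qed.

Let subcstar_star_subproof (x : subcstar_type) : subcstar_pred (star (val x)).
Proof.
by have [_ _ _ _ QS] := subcstar_axiom Q; apply/mem_set/QS/set_mem/valP.
Qed.

HB.instance Definition _ := hasMulStar.Build R subcstar_type
  (fun x y => Sub (val x ** val y) (subcstar_mul_subproof x y))
  (fun x => Sub (star (val x)) (subcstar_star_subproof x)).

Lemma val_amul : {morph (val : subcstar_type -> P) : x y / x ** y}.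
Proof. by move=> x y; rewrite SubK. Qed.

Lemma val_star : {morph (val : subcstar_type -> P) : x / star x}.
Proof. by move=> x; rewrite SubK. Qed.

Let subcstar_amulA : associative (@amul R subcstar_type).
Proof. by move=> x y z; apply/val_inj; rewrite !val_amul amulA. Qed.

Let subcstar_amul_linearl (a : R[i]) (x y z : subcstar_type) :
  (a *: x + y) ** z = a *: (x ** z) + y ** z.
Proof.
by apply/val_inj; rewrite !(val_amul, raddfD, linearZ) /= amul_linearl.
Qed.

Let subcstar_amul_linearr (a : R[i]) (x y z : subcstar_type) :
  z ** (a *: x + y) = a *: (z ** x) + z ** y.
Proof.
by apply/val_inj; rewrite !(val_amul, raddfD, linearZ) /= amul_linearr.
Qed.

Let subcstar_starK : involutive (@star R subcstar_type).
Proof. by move=> x; apply/val_inj; rewrite !val_star starK. Qed.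

Let subcstar_star_antilinear (a : R[i]) (x y : subcstar_type) :
  star (a *: x + y) = conjc a *: star x + star y.
Proof.
by apply/val_inj; rewrite !(val_star, raddfD, linearZ) /= star_antilinear.
Qed.

Let subcstar_starM (x y : subcstar_type) : star (x ** y) = star y ** star x.
Proof. by apply/val_inj; rewrite !(val_star, val_amul) starM. Qed.

Let subcstar_normM_le (x y : subcstar_type) : `|x ** y| <= `|x| * `|y|.
Proof. by rewrite !subcstar_normE val_amul normM_le. Qed.

Let subcstar_norm_cstar (x : subcstar_type) : `|star x ** x| = `|x| ^+ 2.
Proof. by rewrite !subcstar_normE val_amul val_star norm_cstar. Qed.

HB.instance Definition _ := isCstar.Build R subcstar_type
  subcstar_amulA subcstar_amul_linearl subcstar_amul_linearr subcstar_starK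
  subcstar_star_antilinear subcstar_starM subcstar_normM_le
  subcstar_norm_cstar.

End SubalgebraType.

(* Main.v *)
(* [P] is the cone [C_0((0, 1], M_2)] and [Q] consists of the [F] in [P] with
   [F(1)] in [C e_00] (indices start at 0).

   [Q] is not projective: its character [F |-> F(1)_00], viewed as a morphism into
   [C_0((0, 1]) / {f : f(1) = 0}], does not lift, because the only other character
   of [Q] is [0] and a path of characters cannot jump.

   [P] is projective because it is generated by [x = t e_10], with [x^2 = 0], and
   every nilpotent [X] of norm at most one in a C*-algebra is the image of [x]
   under a morphism [P -> C]. To lift such an [x] from [C/J], lift a self-adjoint
   [d] with [d_+] and [d_-] under [e_00] and [e_11] to [D], and sandwich a lift of
   an off-diagonal element between functions of [D_-] and [D_+].

   The continuous functional calculus needed for this rests on the bound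
   [|p(a)| <= sup |p|] over [[-1, 1]] for polynomials [p] in a self-adjoint [a]
   with [|a| < 1]. There [a] is the real part of the unitary
   [a + i sqrt (1 - a^2)], so [|p(a)|] is at most the sum of the moduli of the
   Fourier coefficients of [p(cos)]; applying this to the powers of [p] removes
   the linear factor in the degree. No norm on [C/J] is available; instead
   morphisms into it have closed graph, since [f(E)] lies in [J] whenever [E] lifts
   the image of some [e] and [f] vanishes on [(-r, r)] with [r > |e|]. *)

Require Import Defs.
From HB Require Import structures.
From mathcomp Require Import all_boot all_order all_algebra reals.
From mathcomp Require Import cyclic separable cyclotomic.
From mathcomp Require Import generic_quotient.
From mathcomp Require Import complex.
From mathcomp Require Import boolp classical_sets functions reals topology.
From mathcomp Require Import normedtype sequences.
From mathcomp Require Import ring lra zify.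

Set Implicit Arguments.
Unset Strict Implicit.
Unset Printing Implicit Defensive.

Import Order.TTheory GRing.Theory Num.Theory.
Import numFieldNormedType.Exports.
Import ComplexField.Normc.

Local Open Scope classical_set_scope.
Local Open Scope quotient_scope.
Local Open Scope ring_scope.
Local Open Scope complex_scope.
Local Open Scope cstar_scope.

(** * Real-valued norms and limits *)

(** The obstacle throughout is the absence of units. A polynomial with constant term cannot be
    evaluated inside the algebra, so the calculus computes [f(a) c] for each [c], with [star c ** d]
    as an algebra-valued inner product; multiplication on the right is reached through [star]. The
    strict bound [nrm a < 1] makes [1 - sqrt (1 - a^2)] the fixed point of a contraction, and costs
    only a rescaling.

    For [X] of square zero, [Z = X + star X] exchanges the two corners and only [Z^2] commutes with
    [X]; hence the restriction to even functions, that is to functions of [|Z|]. Matrix units would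
    require dividing by [|Z|], which may fail to be invertible. The elements [t^2 e_ij] do exist,
    and the excess factor is divided out by [1 / (t^2 + e^2)], with small error against functions
    vanishing at 0.

    The image of [F] and [F] itself are limits of one expression, formed from [X] and from [x];
    corresponding terms match under the given morphism, and the closed graph carries this to the
    limit.

    A character of [Q] vanishes on the ideal of functions with [F(1) = 0], since 2x2 matrices have
    no characters; what remains is [F(1)_00]. *)

Section Modulus.
Context {R : realType}.
Implicit Types z w : R[i].

Lemma ltr0c (k : R) : (0 < k%:C) = (0 < k).
Proof. by rewrite ltcE /= eqxx. Qed.

Lemma normcEC z : `|z| = (normc z)%:C.
Proof. by rewrite normc_def; case: z. Qed.

Lemma normc_ge0 z : 0 <= normc z.
Proof. by rewrite -ler0c -normcEC. Qed.

Lemma normcD z w : normc (z + w) <= normc z + normc w.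
Proof. by rewrite -lecR rmorphD /= -!normcEC ler_normD. Qed.

Lemma normcN z : normc (- z) = normc z.
Proof. by apply: complexI; rewrite -!normcEC normrN. Qed.

Lemma normcR (x : R) : normc x%:C = `|x|.
Proof. by rewrite /normc /= expr0n addr0 sqrtr_sqr. Qed.

Lemma normcB z w : normc (z - w) = normc (w - z).
Proof. by rewrite -opprB normcN. Qed.

Lemma conjc_1 : conjc 1 = 1 :> R[i].
Proof. exact: rmorph1. Qed.

Lemma conjcN z : conjc (- z) = - conjc z.
Proof. exact: rmorphN. Qed.

Lemma conjcD z w : conjc (z + w) = conjc z + conjc w.
Proof. exact: rmorphD. Qed.

Lemma conjcM z w : conjc (z * w) = conjc z * conjc w.
Proof. exact: rmorphM. Qed.

Lemma normc_conj z : normc (conjc z) = normc z.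
Proof. by case: z => x y; rewrite /normc /= sqrrN. Qed.

Lemma normc_nat n : normc (n%:R : R[i]) = n%:R.
Proof. by have := normcR (n%:R : R); rewrite rmorph_nat normr_nat. Qed.

Lemma normc_i : normc ('i : R[i]) = 1.
Proof. by rewrite /normc expr0n expr1n add0r sqrtr1. Qed.

Lemma normcX z n : normc (z ^+ n) = normc z ^+ n.
Proof.
elim: n => [|n IH]; first by rewrite !expr0 normc1.
by rewrite !exprS normcM IH.
Qed.

Lemma normc_sum (I : Type) (r : seq I) (Q : pred I) (F : I -> R[i]) :
  normc (\sum_(i <- r | Q i) F i) <= \sum_(i <- r | Q i) normc (F i).
Proof.
elim/big_rec2: _ => [|i y x _ IH]; first by rewrite normc0.
by apply: (le_trans (normcD _ _)); rewrite lerD2l.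
Qed.

Lemma conjc_mul_normc z : conjc z * z = (normc z ^+ 2)%:C.
Proof. by rewrite mulrC -sqr_normc normcEC rmorphXn. Qed.

Lemma exprn_small (q e : R) : 0 <= q < 1 -> 0 < e ->
  exists N : nat, forall n : nat, (N <= n)%N -> q ^+ n <= e.
Proof.
move=> /andP[q0 q1] e0.
have /cvgrPdist_le /(_ e e0) [N _ HN] : q ^+ n @[n --> \oo] --> (0 : R).
  by apply: cvg_expr; rewrite ger0_norm.
exists N => n Nn; have := HN n Nn.
by rewrite /= sub0r normrN ger0_norm // exprn_ge0.
Qed.

Lemma inv_small (e : R) : 0 < e ->
  exists N : nat, forall n : nat, (N <= n)%N -> n.+1%:R^-1 <= e.
Proof.
move=> e0; exists (Num.truncn e^-1) => n Hn.
rewrite invf_ple ?posrE ?ltr0n //.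
apply: ltW; apply: (lt_le_trans (truncnS_gt _)).
by rewrite ler_nat ltnS.
Qed.

Lemma eqc_normc z w : (forall e : R, 0 < e -> normc (z - w) <= e) -> z = w.
Proof.
move=> H; apply/subr0_eq/eq0_normc/eqP.
rewrite eq_le normc_ge0 andbT; apply/ler_addgt0Pl => e e0.
by rewrite addr0; exact: H.
Qed.

End Modulus.

Section StarAlgebra.
Context {R : realType} {C : cstarType R}.
Implicit Types (x y z c d : C) (a : R[i]).

Lemma amulDl x y z : (x + y) ** z = x ** z + y ** z.
Proof. by have := amul_linearl 1 x y z; rewrite !scale1r. Qed.
Lemma amulDr x y z : z ** (x + y) = z ** x + z ** y.
Proof. by have := amul_linearr 1 x y z; rewrite !scale1r. Qed.
Lemma amul0l x : 0 ** x = 0.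
Proof. by apply: (@addrI _ (0 ** x)); rewrite -amulDl !addr0. Qed.
Lemma amul0r x : x ** 0 = 0.
Proof. by apply: (@addrI _ (x ** 0)); rewrite -amulDr !addr0. Qed.
Lemma amulZl a x y : (a *: x) ** y = a *: (x ** y).
Proof. by have := amul_linearl a x 0 y; rewrite amul0l !addr0. Qed.
Lemma amulZr a x y : x ** (a *: y) = a *: (x ** y).
Proof. by have := amul_linearr a y 0 x; rewrite amul0r !addr0. Qed.
Lemma amulNl x y : (- x) ** y = - (x ** y).
Proof. by rewrite -scaleN1r amulZl scaleN1r. Qed.
Lemma amulNr x y : x ** (- y) = - (x ** y).
Proof. by rewrite -scaleN1r amulZr scaleN1r. Qed.
Lemma amulBl x y z : (x - y) ** z = x ** z - y ** z.
Proof. by rewrite amulDl amulNl. Qed.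
Lemma amulBr x y z : z ** (x - y) = z ** x - z ** y.
Proof. by rewrite amulDr amulNr. Qed.

Lemma starD x y : star (x + y) = star x + star y.
Proof. by have := star_antilinear 1 x y; rewrite conjc_1 !scale1r. Qed.
Lemma star0 : star (0 : C) = 0.
Proof. by apply: (@addrI _ (star 0)); rewrite -starD !addr0. Qed.
Lemma starZ a x : star (a *: x) = conjc a *: star x.
Proof. by have := star_antilinear a x 0; rewrite star0 !addr0. Qed.
Lemma starN x : star (- x) = - star x.
Proof. by rewrite -scaleN1r starZ conjcN conjc_1 scaleN1r. Qed.
Lemma starB x y : star (x - y) = star x - star y.
Proof. by rewrite starD starN. Qed.

Definition nrm x : R := complex.Re `|x|.

Lemma nrmE x : `|x| = (nrm x)%:C.
Proof. by rewrite /nrm RRe_real // ger0_real. Qed.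

Lemma nrm_ge0 x : 0 <= nrm x.
Proof. by rewrite -ler0c -nrmE. Qed.
Lemma nrm0 : nrm 0 = 0.
Proof. by rewrite /nrm normr0. Qed.
Lemma nrm0_eq0 x : nrm x = 0 -> x = 0.
Proof. by move=> H; apply/normr0_eq0; rewrite nrmE H. Qed.
Lemma nrmD x y : nrm (x + y) <= nrm x + nrm y.
Proof. by rewrite -lecR rmorphD /= -!nrmE ler_normD. Qed.
Lemma nrmN x : nrm (- x) = nrm x.
Proof. by rewrite /nrm normrN. Qed.
Lemma nrmB x y : nrm (x - y) <= nrm x + nrm y.
Proof. by rewrite -(nrmN y) nrmD. Qed.
Lemma nrmBC x y : nrm (x - y) = nrm (y - x).
Proof. by rewrite -opprB nrmN. Qed.
Lemma nrm_tri y x z : nrm (x - z) <= nrm (x - y) + nrm (y - z).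
Proof. by apply: le_trans (nrmD _ _); rewrite addrA subrK. Qed.
Lemma nrmZ a x : nrm (a *: x) = normc a * nrm x.
Proof. by apply: complexI; rewrite rmorphM /= -!nrmE normrZ normcEC. Qed.
Lemma nrmM x y : nrm (x ** y) <= nrm x * nrm y.
Proof. by rewrite -lecR rmorphM /= -!nrmE normM_le. Qed.
Lemma nrm_starM x : nrm (star x ** x) = nrm x ^+ 2.
Proof. by apply: complexI; rewrite rmorphXn /= -!nrmE norm_cstar. Qed.

Lemma nrm_star x : nrm (star x) = nrm x.
Proof.
suff H y : nrm y <= nrm (star y).
  have := H (star x); rewrite starK => Hx.
  by apply/eqP; rewrite eq_le Hx H.
have [->|n0] := eqVneq (nrm y) 0; first exact: nrm_ge0.
have n0' : 0 < nrm y by rewrite lt_neqAle eq_sym n0 nrm_ge0.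
by rewrite -(ler_pM2r n0') -expr2 -nrm_starM nrmM.
Qed.

Lemma nrmM_star x : nrm (x ** star x) = nrm x ^+ 2.
Proof. by rewrite -{1}(starK x) nrm_starM nrm_star. Qed.

Lemma nrm_sum (I : Type) (r : seq I) (Q : pred I) (F : I -> C) :
  nrm (\sum_(i <- r | Q i) F i) <= \sum_(i <- r | Q i) nrm (F i).
Proof.
elim/big_rec2: _ => [|i y x _ IH]; first by rewrite nrm0.
by apply: (le_trans (nrmD _ _)); rewrite lerD2l.
Qed.

Lemma nrm_small_eq x y : (forall e : R, 0 < e -> nrm (x - y) <= e) -> x = y.
Proof.
move=> H; apply/subr0_eq/nrm0_eq0/eqP.
rewrite eq_le nrm_ge0 andbT; apply/ler_addgt0Pl => e e0.
by rewrite addr0; exact: H.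
Qed.

(** The choice [d = star (x - y)] and the C*-identity give norm [nrm (x - y) ^ 2]. This replaces
    setting [d] equal to a unit. *)
Lemma amul_cancel x y : (forall d, x ** d = y ** d) -> x = y.
Proof.
move=> H; apply/subr0_eq/nrm0_eq0/eqP.
by rewrite -sqrf_eq0 -nrmM_star amulBl H subrr nrm0.
Qed.

Definition tends (u : nat -> C) (l : C) : Prop :=
  forall e : R, 0 < e ->
  exists N : nat, forall n : nat, (N <= n)%N -> nrm (u n - l) <= e.

Lemma cauchy_tends (u : nat -> C) :
  (forall e : R, 0 < e -> exists N : nat, forall m n : nat,
     (N <= m)%N -> (N <= n)%N -> nrm (u m - u n) <= e) ->
  exists l, tends u l.
Proof.
move=> H.
have /cauchy_cvg : cauchy (u @ \oo).
  apply/(@cauchy_ballP R[i] C) => e e0.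
  have er : e = (complex.Re e)%:C by rewrite RRe_real // gtr0_real.
  have e0' : 0 < complex.Re e by rewrite -ltr0c -er.
  have [N HN] := H _ (divr_gt0 e0' (ltr0n _ 2)).
  rewrite near_map2 -ball_normE; exists ([set n | (N <= n)%N], [set n | (N <= n)%N]).
    by split; exists N.
  move=> [m n] /= [Nm Nn]; rewrite nrmE er ltcR.
  by apply: le_lt_trans (HN _ _ Nm Nn) _; rewrite ltr_pdivrMr // ltr_pMr // ltr1n.
move=> /cvg_ex[l /cvgrPdist_le ul]; exists l => e e0.
have e0' : 0 < e%:C :> R[i] by rewrite ltr0c.
have [N _ HN] := ul _ e0'.
by exists N => n Nn; have := HN n Nn; rewrite /= nrmE lecR nrmBC.
Qed.

Lemma closed_approx (J : set C) l : closed J ->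
  (forall e : R, 0 < e -> exists2 x, J x & nrm (x - l) <= e) -> J l.
Proof.
move=> Jc H; apply: Jc => B.
rewrite -nbhs_ballE => -[e /= e0]; rewrite -ball_normE => eB.
have er : e = (complex.Re e)%:C by rewrite RRe_real // gtr0_real.
have e0' : 0 < complex.Re e by rewrite -ltr0c -er.
have [x Jx xl] := H _ (divr_gt0 e0' (ltr0n _ 2)).
exists x; split=> //; apply: eB; rewrite /= nrmE er ltcR nrmBC.
by apply: le_lt_trans xl _; rewrite ltr_pdivrMr // ltr_pMr // ltr1n.
Qed.

Lemma tends_unique (u : nat -> C) l l' : tends u l -> tends u l' -> l = l'.
Proof.
move=> ul ul'; apply: nrm_small_eq => e e0.
have e20 : 0 < e / 2 by rewrite divr_gt0.
have [N HN] := ul _ e20; have [N' HN'] := ul' _ e20.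
apply: (le_trans (nrm_tri (u (maxn N N')) _ _)).
rewrite nrmBC (splitr e) lerD //; [apply: HN|apply: HN'].
  exact: leq_maxl.
exact: leq_maxr.
Qed.

Lemma tends_add (u v : nat -> C) l l' :
  tends u l -> tends v l' -> tends (fun n => u n + v n) (l + l').
Proof.
move=> ul vl e e0.
have e20 : 0 < e / 2 by rewrite divr_gt0.
have [N HN] := ul _ e20; have [N' HN'] := vl _ e20.
exists (maxn N N') => n; rewrite geq_max => /andP[Nn N'n].
rewrite opprD addrACA; apply: (le_trans (nrmD _ _)).
by rewrite (splitr e) lerD // ?HN ?HN'.
Qed.

End StarAlgebra.

Section Limits.
Context {R : realType} {C : cstarType R}.

Lemma tends_lip (D : cstarType R) (f : C -> D) (k : R) (u : nat -> C) l :
  tends u l -> (forall n, nrm (f (u n) - f l) <= k * nrm (u n - l)) ->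
  forall e : R, 0 < e ->
  exists N : nat, forall n : nat, (N <= n)%N -> nrm (f (u n) - f l) <= e.
Proof.
move=> ul H e e0.
have k1 : 0 < `|k| + 1 by rewrite ltr_wpDl.
have [N HN] := ul (e / (`|k| + 1)) (divr_gt0 e0 k1).
exists N => n Nn; apply: (le_trans (H n)).
have Hk : k * nrm (u n - l) <= (`|k| + 1) * nrm (u n - l).
  by apply: ler_wpM2r; [exact: nrm_ge0 | rewrite (le_trans (ler_norm k)) // lerDl].
by apply: (le_trans Hk); rewrite mulrC -ler_pdivlMr // HN.
Qed.

Lemma tends_shift (u : nat -> C) l : tends u l -> tends (fun n => u n.+1) l.
Proof.
by move=> ul e /ul[N HN]; exists N => n Nn; apply: HN; exact: leqW.
Qed.

(** Banach's fixed point theorem, iterating from 0. The invariant set [U] lets the limit inherit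
    properties of the iterates, such as commutation, and confines the contraction estimate to a
    ball. *)
Lemma contract_fix (U : C -> Prop) (f : C -> C) (q : R) : 0 <= q < 1 -> U 0 ->
  (forall x, U x -> U (f x)) ->
  (forall u l, (forall n, U (u n)) -> tends u l -> U l) ->
  (forall x y, U x -> U y -> nrm (f x - f y) <= q * nrm (x - y)) ->
  exists2 y, U y & f y = y.
Proof.
move=> q01 U0 Uf Ucl fq; have /andP[q0 q1] := q01.
pose u n := iter n f 0.
have Uu n : U (u n) by elim: n => //= n IH; exact: Uf.
have step n : nrm (u n.+1 - u n) <= q ^+ n * nrm (f 0).
  elim: n => [|n IH]; first by rewrite /= subr0 expr0 mul1r.
  apply: (le_trans (fq _ _ (Uu n.+1) (Uu n))).
  by rewrite exprS -mulrA ler_wpM2l.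
have dist n k : nrm (u (n + k)%N - u n) <= q ^+ n * (nrm (f 0) / (1 - q)).
  have q1' : 0 < 1 - q by rewrite subr_gt0.
  (* The factor [1 - q ^+ k] is the exact partial geometric sum, with which the induction on [k]
     closes by an equality. *)
  suff : nrm (u (n + k)%N - u n) <= q ^+ n * (nrm (f 0) / (1 - q)) * (1 - q ^+ k).
    move=> /le_trans; apply; rewrite ler_piMr //.
      by rewrite mulr_ge0 ?exprn_ge0 // divr_ge0 ?nrm_ge0 // ltW.
    by rewrite gerBl exprn_ge0.
  elim: k => [|k IH]; first by rewrite addn0 !subrr nrm0 mulr0.
  rewrite addnS; apply: (le_trans (nrm_tri (u (n + k)%N) _ _)).
  apply: (le_trans (lerD (step _) IH)).
  rewrite exprD exprS le_eqVlt; apply/orP; left; apply/eqP.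
  by field; rewrite gt_eqF.
have [l ul] : exists l, tends u l.
  apply: cauchy_tends => e e0.
  pose K := nrm (f 0) / (1 - q) + 1.
  have K0 : 0 < K.
    by rewrite ltr_wpDl // divr_ge0 ?nrm_ge0 // subr_ge0 ltW.
  have [N HN] := exprn_small q01 (divr_gt0 e0 K0).
  have main m n : (N <= m)%N -> (m <= n)%N -> nrm (u n - u m) <= e.
    move=> Nm mn; rewrite -(subnKC mn); apply: (le_trans (dist _ _)).
    have H1 : q ^+ m * (nrm (f 0) / (1 - q)) <= q ^+ m * K.
      by rewrite ler_wpM2l ?exprn_ge0 // lerDl.
    by apply: (le_trans H1); rewrite -ler_pdivlMr // HN.
  exists N => m n Nm Nn; have [mn|/ltnW nm] := leqP m n.
    by rewrite nrmBC main.
  exact: main.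
have Ul : U l by exact: Ucl Uu ul.
exists l => //; apply: (tends_unique (u := fun n => u n.+1)); last exact: tends_shift.
by apply: (tends_lip (k := q) ul) => n; exact: fq.
Qed.

Lemma tends_closed_eq (D : cstarType R) (f g : C -> D) (k : R) (u : nat -> C) l :
  tends u l -> (forall n, f (u n) = g (u n)) ->
  (forall x y, nrm (f x - f y) <= k * nrm (x - y)) ->
  (forall x y, nrm (g x - g y) <= k * nrm (x - y)) -> f l = g l.
Proof.
move=> ul fg fk gk; apply: nrm_small_eq => e e0.
have e20 : 0 < e / 2 by rewrite divr_gt0.
have [N HN] := tends_lip (k := k) ul (fun n => fk _ _) e20.
have [N' HN'] := tends_lip (k := k) ul (fun n => gk _ _) e20.
pose n := maxn N N'.
have -> : f l - g l = (g (u n) - g l) - (f (u n) - f l).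
  by rewrite fg opprB [RHS]addrC addrA subrK.
apply: (le_trans (nrmB _ _)); rewrite (splitr e) lerD //; [apply: HN'|apply: HN].
  exact: leq_maxr.
exact: leq_maxl.
Qed.

End Limits.

(** * Polynomials in a self-adjoint element *)

Section PolynomialCalculus.
Context {K : comNzRingType} {V : lmodType K}.
Implicit Types (T : V -> V) (p q : {poly K}) (c d : V) (a : K).

(** The vector [p(T) c]. For [T = amul a] it gives a meaning to [p(a) c] when [p] has a constant
    term; [T] is also taken to be the unitary [umul] and the square of an operator. *)
Definition ev T p c : V := \sum_(i < size p) p`_i *: iter i T c.

Lemma ev_widen n T p c :
  (size p <= n)%N -> ev T p c = \sum_(i < n) p`_i *: iter i T c.
Proof.
move=> pn; rewrite /ev (big_ord_widen n (fun i => p`_i *: iter i T c)) //.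
rewrite big_mkcond; apply: eq_bigr => i _; case: ltnP => // H.
by rewrite nth_default // scale0r.
Qed.

Lemma evD T p q c : ev T (p + q) c = ev T p c + ev T q c.
Proof.
rewrite !(@ev_widen (maxn (size p) (size q))) ?leq_maxl ?leq_maxr //.
  by rewrite -big_split; apply: eq_bigr => i _; rewrite coefD scalerDl.
exact: size_polyD.
Qed.

Lemma evZ T a p c : ev T (a *: p) c = a *: ev T p c.
Proof.
rewrite !(@ev_widen (size p)) ?size_scale_leq //.
by rewrite scaler_sumr; apply: eq_bigr => i _; rewrite coefZ scalerA.
Qed.

Lemma evN T p c : ev T (- p) c = - ev T p c.
Proof. by rewrite -[- p]scaleN1r evZ scaleN1r. Qed.

Lemma evB T p q c : ev T (p - q) c = ev T p c - ev T q c.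
Proof. by rewrite evD evN. Qed.

Lemma ev0 T c : ev T 0 c = 0.
Proof. by rewrite /ev size_poly0 big_ord0. Qed.

Lemma evC T a c : ev T a%:P c = a *: c.
Proof.
by rewrite (@ev_widen 1) ?size_polyC_leq1 // big_ord1 coefC eqxx.
Qed.

Lemma ev_cons T p a c : ev T (p * 'X + a%:P) c = ev T p (T c) + a *: c.
Proof.
rewrite evD evC; congr (_ + _).
rewrite (@ev_widen (size p).+1); last first.
  by apply: leq_trans (size_polyMleq _ _) _; rewrite size_polyX addn2.
rewrite big_ord_recl coefMX eqxx scale0r add0r.
by apply: eq_bigr => i _; rewrite coefMX /= -iterSr.
Qed.

Lemma ev_sum T (I : Type) (r : seq I) (Q : pred I) (F : I -> {poly K}) c :
  ev T (\sum_(i <- r | Q i) F i) c = \sum_(i <- r | Q i) ev T (F i) c.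
Proof.
by elim/big_rec2: _ => [|i x y _ <-]; rewrite ?ev0 ?evD.
Qed.

Section Linear.
Variable T : V -> V.
Hypothesis Tlin : linear T.

Let TD x y : T (x + y) = T x + T y.
Proof. by rewrite -[x in LHS]scale1r Tlin scale1r. Qed.

Let T0 : T 0 = 0.
Proof. by apply: (@addrI _ (T 0)); rewrite -TD !addr0. Qed.

Let TZ a x : T (a *: x) = a *: T x.
Proof. by rewrite -[a *: x]addr0 Tlin T0 addr0. Qed.

Lemma iter_linear n : linear (iter n T).
Proof. by elim: n => // n IH a x y /=; rewrite IH Tlin. Qed.

Lemma ev_linear p : linear (ev T p).
Proof.
move=> a x y; rewrite /ev scaler_sumr -big_split; apply: eq_bigr => i _ /=.
by rewrite iter_linear scalerDr !scalerA mulrC.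
Qed.

Lemma ev_0r p : ev T p 0 = 0.
Proof. by have := ev_linear p (-1) 0 0; rewrite scaler0 addr0 scaleN1r addNr. Qed.

Lemma ev_Dr p c d : ev T p (c + d) = ev T p c + ev T p d.
Proof. by have := ev_linear p 1 c d; rewrite !scale1r. Qed.

Lemma ev_Zr p a c : ev T p (a *: c) = a *: ev T p c.
Proof. by have := ev_linear p a c 0; rewrite ev_0r !addr0. Qed.

Lemma ev_Br p c d : ev T p (c - d) = ev T p c - ev T p d.
Proof. by rewrite ev_Dr -[- d]scaleN1r ev_Zr scaleN1r. Qed.

Lemma ev_T p c : ev T p (T c) = T (ev T p c).
Proof.
rewrite /ev -[RHS]/(T _).
rewrite (big_morph T TD T0); apply: eq_bigr => i _.
by rewrite TZ -iterSr.
Qed.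

Lemma evXM p c : ev T (p * 'X) c = T (ev T p c).
Proof. by rewrite -[p * 'X]addr0 -polyC0 ev_cons scale0r addr0 ev_T. Qed.

Lemma evX c : ev T 'X c = T c.
Proof. by rewrite -['X]mul1r evXM -polyC1 evC scale1r. Qed.

Lemma evM p q c : ev T (p * q) c = ev T p (ev T q c).
Proof.
elim/poly_ind: p q c => [|p a IH] q c; first by rewrite mul0r !ev0.
rewrite mulrDl evD ev_cons -mulrA ['X * q]mulrC IH evXM.
by rewrite mul_polyC evZ.
Qed.

Lemma ev_comp_sqr p c : ev T (p \Po 'X^2) c = ev (fun x => T (T x)) p c.
Proof.
elim/poly_ind: p c => [|p k IH] c; first by rewrite comp_poly0 !ev0.
rewrite comp_polyD comp_polyM comp_polyX comp_polyC ev_cons evD evM evC IH.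
by rewrite expr2 evXM evX.
Qed.

Lemma evXn n c : ev T 'X^n c = iter n T c.
Proof.
elim: n => [|n IH]; first by rewrite expr0 -polyC1 evC scale1r.
by rewrite exprSr evXM IH.
Qed.

End Linear.
End PolynomialCalculus.

(** * Coefficients of a polynomial bounded on the unit circle *)

Section FourierCoefficients.
Context {R : realType}.

Lemma prim_root_exists n : (0 < n)%N -> exists z : R[i], n.-primitive_root z.
Proof.
move=> n0; pose p : {poly R[i]} := 'X^n - 1.
have [rs Drs] : {r : seq R[i] | p = \prod_(z <- r) ('X - z%:P)}.
  have [r Dr] := closed_field_poly_normal p.
  by exists r; rewrite Dr (monicP _) ?scale1r ?monicXnsubC.
have rn1 : all n.-unity_root rs.
  by apply/allP => z; rewrite -root_prod_XsubC -Drs.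
have sz : (n <= size rs)%N.
  by rewrite -ltnS -(size_prod_XsubC rs id) -Drs size_XnsubC.
have [|z zrs zprim] := hasP (has_prim_root n0 rn1 _ sz); last by exists z.
by rewrite -separable_prod_XsubC -Drs separable_Xn_sub_1 // pnatr_eq0 -lt0n.
Qed.

(* The [k]-th coefficient is the average of [r z * z ^- k] over roots of unity
   of order larger than the degree. *)
Lemma coef_le_circle (r : {poly R[i]}) (S : R) k :
  (forall z : R[i], normc z = 1 -> normc r.[z] <= S) -> normc r`_k <= S.
Proof.
(* With this order, [i = k] is the only index below [size r] congruent to [k] modulo [N], so no
   other coefficient survives the averaging. *)
move=> HS; pose N := (size r + k).+1.
have [w pw] := prim_root_exists (ltn0Sn (size r + k)).
have wN : w ^+ N = 1 by exact: prim_expr_order.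
have nw : normc w = 1.
  have : normc w ^+ N = 1 by rewrite -normcX wN normc1.
  by move/eqP; rewrite pexpr_eq1 ?normc_ge0 // => /eqP.
have geom m : \sum_(j < N) w ^+ (m * j) = if (N %| m)%N then N%:R else 0.
  case: ifPn => [/dvdnP[q ->]|ndv].
    rewrite (eq_bigr (fun _ => 1)) ?sumr_const ?card_ord // => j _.
    by rewrite mulnAC mulnC !exprM wN !expr1n.
  have w1 : w ^+ m != 1 by rewrite -(prim_order_dvd pw).
  have := subrX1 (w ^+ m) N; rewrite -exprM mulnC exprM wN expr1n subrr.
  move/esym/eqP; rewrite mulf_eq0 subr_eq0 (negPf w1) /= => /eqP; apply: etrans.
  by apply: eq_bigr => j _; rewrite exprM.
have kN : (k <= N)%N by rewrite /N leqW // leq_addl.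
(* The exponent [(N - k) * j] is a natural number standing for [- k * j], as [w ^+ N = 1]. *)
have eN : N%:R * r`_k = \sum_(j < N) w ^+ ((N - k) * j) * r.[w ^+ j].
  under eq_bigr => j _ do rewrite horner_coef mulr_sumr.
  rewrite exchange_big /=.
  transitivity (\sum_(i < size r) r`_i * (if (i == k :> nat) then N%:R else 0)).
    have [kr|rk] := ltnP k (size r).
      rewrite (bigD1 (Ordinal kr)) //= eqxx big1 ?addr0 1?mulrC // => i.
      by rewrite -val_eqE /= => /negPf ->; rewrite mulr0.
    rewrite nth_default // mulr0 big1 // => i _.
    by rewrite ifN ?mulr0 // neq_ltn (leq_trans (ltn_ord i) rk).
  apply: eq_bigr => i _; have ir := ltn_ord i.
  transitivity (r`_i * \sum_(j < N) w ^+ (((N - k) + i) * j)); last first.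
    rewrite mulr_sumr; apply: eq_bigr => j _.
    by rewrite mulrCA; congr (_ * _); rewrite -exprM mulnDl exprD [(j * i)%N]mulnC.
  congr (_ * _); rewrite geom; congr (if _ then _ else _).
  apply/eqP/idP => [->|]; first by rewrite subnK.
  (* [N - k + i] lies strictly between 0 and [2 * N], so the quotient can only be 1. *)
  case/dvdnP => -[|[|q]] E.
  - by move: E; rewrite /N; lia.
  - by apply/eqP; move: E; rewrite /N; lia.
  - by move: E; rewrite /N; nia.
have : normc (N%:R * r`_k) <= N%:R * S.
  rewrite eN; apply: (le_trans (normc_sum _ _ _)).
  have -> : N%:R * S = \sum_(j < N) S by rewrite sumr_const card_ord mulr_natl.
  apply: ler_sum => j _; rewrite normcM normcX nw expr1n mul1r.
  by apply: HS; rewrite normcX nw expr1n.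
by rewrite normcM normc_nat ler_pM2l // ltr0n.
Qed.

End FourierCoefficients.

Section PowerTrick.
Context {R : realType}.

Lemma bernoulli_ineq (d : R) m : 0 <= d -> 1 + m%:R * d <= (1 + d) ^+ m.
Proof.
move=> d0; elim: m => [|m IH]; first by rewrite mul0r addr0 expr0.
rewrite exprS; apply: le_trans (ler_wpM2l _ IH); last by rewrite addr_ge0.
have : 0 <= m%:R * d * d by rewrite !mulr_ge0.
rewrite -natr1 mulrDl mul1r mulrDl mul1r mulrDr mulr1 [d * _]mulrC; lra.
Qed.

(** If [Y < X], then [(X / Y) ^ (2 ^ k)] outgrows every affine function of [2 ^ k]. Squaring
    Bernoulli's inequality at half the exponent gives quadratic growth, which is enough. *)
Lemma power_trick (X Y A B : R) : 0 <= X -> 0 <= Y -> 0 <= A -> 0 <= B ->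
  (forall k, X ^+ (2 ^ k) <= (A * (2 ^ k)%:R + B) * Y ^+ (2 ^ k)) -> X <= Y.
Proof.
move=> X0 Y0 A0 B0 H; rewrite leNgt; apply/negP => YX.
have [Y00|Yn0] := eqVneq Y 0.
  have := H 0%N; rewrite expn0 !expr1 Y00 mulr0 => X0'.
  by move: YX; rewrite Y00 ltNge X0'.
have Yp : 0 < Y by rewrite lt_neqAle eq_sym Yn0.
pose d := X / Y - 1.
have d0 : 0 < d by rewrite subr_gt0 ltr_pdivlMr // mul1r.
have Hd k : (1 + d) ^+ (2 ^ k) <= A * (2 ^ k)%:R + B.
  rewrite /d addrC subrK expr_div_n ler_pdivrMr ?exprn_gt0 //; exact: H.
(* Since [M = 2 ^ m] exceeds [(2 A + B) / d^2], the exponent [2 M] would give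
   [(M d)^2 <= 2 A M + B <= M (2 A + B)], contrary to this choice. *)
pose m := Num.truncn ((2 * A + B) / d ^+ 2).
have Hm : (2 * A + B) / d ^+ 2 < m.+1%:R by exact: truncnS_gt.
pose M := (2 ^ m)%N.
have mM : (m.+1 <= M)%N by exact: ltn_expl.
have M1 : 1 <= M%:R :> R by rewrite ler1n (leq_trans _ mM).
have H1 : 2 * A + B < M%:R * d ^+ 2.
  rewrite -ltr_pdivrMr ?exprn_gt0 //; apply: (lt_le_trans Hm).
  by rewrite ler_nat.
have H2 : (M%:R * d) ^+ 2 <= (1 + d) ^+ (2 ^ m.+1).
  have Hb : M%:R * d <= (1 + d) ^+ M.
    by apply: le_trans (bernoulli_ineq M (ltW d0)); rewrite lerDr.
  rewrite expnSr exprM; apply: lerXn2r Hb; rewrite nnegrE.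
    by rewrite mulr_ge0 // ltW.
  by rewrite exprn_ge0 // addr_ge0 // ltW.
have H3 := le_trans H2 (Hd m.+1).
have H4 : (2 ^ m.+1)%:R = 2 * M%:R :> R by rewrite expnS natrM.
move: H3; rewrite H4 exprMn => H3.
have H5 : M%:R * (2 * A + B) < M%:R * (M%:R * d ^+ 2).
  by rewrite ltr_pM2l // (lt_le_trans ltr01).
have H6 : B <= M%:R * B by rewrite ler_peMl.
lra.
Qed.

End PowerTrick.

(** * Norm of a polynomial in a self-adjoint element *)

Section SelfAdjointBound.
Context {R : realType} {C : cstarType R}.
Variable a : C.
Hypothesis a_star : star a = a.
Implicit Types (c d y : C) (p q : {poly R[i]}) (s : R[i]).

Lemma amul_linear (b : C) : linear (amul b).
Proof. by move=> k x y; rewrite amul_linearr. Qed.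

Lemma nrm_ev_le T p c :
  (forall d, nrm (T d) = nrm d) ->
  nrm (ev T p c) <= (\sum_(i < size p) normc p`_i) * nrm c.
Proof.
move=> HT; apply: (le_trans (nrm_sum _ _ _)); rewrite mulr_suml.
apply: ler_sum => i _; rewrite nrmZ.
suff -> : nrm (iter i T c) = nrm c by [].
by elim: (nat_of_ord i) => //= n <-.
Qed.

Lemma iter_adj n c d : star (iter n (amul a) c) ** d = star c ** iter n (amul a) d.
Proof.
by elim: n c d => // n IH c d; rewrite iterS starM a_star -amulA IH -iterSr.
Qed.

(** Left multiplication by the self-adjoint [a] is symmetric for the inner product [star c ** d], so
    the adjoint of [p(a)] is obtained by conjugating coefficients. *)
Lemma ev_adj p c d :
  star (ev (amul a) p c) ** d = star c ** ev (amul a) (map_poly conjc p) d.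
Proof.
rewrite [in RHS](@ev_widen _ _ (size p)) ?size_poly // /ev.
rewrite (big_morph (fun x => star x) starD star0).
rewrite (big_morph (fun x => x ** d) (fun x y => amulDl x y d) (amul0l d)).
rewrite (big_morph (amul (star c)) (fun x y => amulDr x y (star c)) (amul0r (star c))).
apply: eq_bigr => i _.
by rewrite starZ amulZl iter_adj amulZr coef_map_id0 // conjc0.
Qed.

Lemma horner_conj p (t : R) : (map_poly conjc p).[t%:C] = conjc p.[t%:C].
Proof.
rewrite (@horner_coef_wide _ (size p)) ?size_poly // horner_coef.
rewrite (big_morph conjc conjcD (conjc0 R)).
apply: eq_bigr => i _; rewrite coef_map_id0 ?conjc0 // conjcM.
by congr (_ * _); rewrite -rmorphXn conjc_real.
Qed.

Hypothesis a_lt1 : nrm a < 1.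

(* [y = 1 - sqrt (1 - a^2)], obtained as a fixed point so that no unit is needed. *)
Lemma one_sub_sqrt_exists :
  exists y, [/\ star y = y, y ** a = a ** y & 2%:R *: y = a ** a + y ** y].
Proof.
(* The ball of radius [rho] is mapped into itself because [(rho + rho^2) / 2 <= rho], and on it
   [rho] is also the contraction ratio. *)
pose rho := nrm a ^+ 2.
have rho0 : 0 <= rho by rewrite exprn_ge0 // nrm_ge0.
have rho1 : rho < 1 by rewrite expr_lt1 ?nrm_ge0.
pose f y := (2%:R^-1 : R[i]) *: (a ** a + y ** y).
pose U y := [/\ star y = y, y ** a = a ** y & nrm y <= rho].
have n2 : normc (2%:R^-1 : R[i]) = 2^-1 by rewrite normcV normc_nat.
have aa : nrm (a ** a) = rho by rewrite -{1}a_star nrm_starM.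
have [| | | | |y [sy ya _] fy] := @contract_fix _ _ U f rho.
- by rewrite rho0.
- by split; rewrite ?star0 ?amul0l ?amul0r ?nrm0.
- move=> y [sy ya ny]; split; rewrite /f.
  + rewrite starZ starD !starM a_star sy; congr (_ *: _).
    by rewrite conjc_inv conjc_nat.
  + by rewrite amulZl amulZr amulDl amulDr -!amulA ya !amulA ya.
  + rewrite nrmZ n2 ler_pdivrMl //; apply: (le_trans (nrmD _ _)); rewrite aa.
    have : nrm (y ** y) <= rho * rho.
      by apply: (le_trans (nrmM _ _)); rewrite ler_pM ?nrm_ge0.
    have : rho * rho <= rho by rewrite ler_piMr // ltW.
    by lra.
- move=> u l Uu ul; split.
  + apply: (@tends_closed_eq _ _ _ (fun x => star x) id 1 _ _ ul).
    * by move=> n; have [] := Uu n.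
    * by move=> x y; rewrite -starB nrm_star mul1r.
    * by move=> x y; rewrite mul1r.
  + apply: (@tends_closed_eq _ _ _ (fun x => x ** a) (amul a) (nrm a) _ _ ul).
    * by move=> n; have [] := Uu n.
    * by move=> x y; rewrite -amulBl mulrC nrmM.
    * by move=> x y; rewrite -amulBr nrmM.
  + apply/ler_addgt0Pl => e e0; have [N HN] := ul e e0.
    have := HN N (leqnn N); have [_ _ HU] := Uu N => H.
    rewrite -[l](subrK (u N)); apply: (le_trans (nrmD _ _)).
    by rewrite lerD // nrmBC.
- move=> x y [_ _ nx] [_ _ ny]; rewrite /f -scalerBr nrmZ n2 ler_pdivrMl //.
  (* This splitting of [x^2 - y^2] is valid for noncommuting [x] and [y]. *)
  have -> : a ** a + x ** x - (a ** a + y ** y) = x ** (x - y) + (x - y) ** y.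
    by rewrite amulBr amulBl addrA subrK opprD addrACA subrr add0r.
  apply: (le_trans (nrmD _ _)).
  have H1 : nrm (x ** (x - y)) <= rho * nrm (x - y).
    by apply: (le_trans (nrmM _ _)); rewrite ler_wpM2r ?nrm_ge0.
  have H2 : nrm ((x - y) ** y) <= rho * nrm (x - y).
    by apply: (le_trans (nrmM _ _)); rewrite mulrC ler_wpM2r ?nrm_ge0.
  lra.
exists y; split=> //.
suff -> : a ** a + y ** y = 2%:R *: f y by rewrite fy.
by rewrite /f scalerA divff ?scale1r // pnatr_eq0.
Qed.

Section Unitary.
Variable y : C.
Hypothesis y_star : star y = y.
Hypothesis y_comm : y ** a = a ** y.
Hypothesis y_eq : 2%:R *: y = a ** a + y ** y.

(* Left multiplication by [a + s (1 - y)]; it is unitary for [s = 'i] and [s = - 'i]. *)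
Definition umul s c : C := a ** c + s *: (c - y ** c).

Lemma umul_linear s : linear (umul s).
Proof.
move=> k c d; rewrite /umul !amul_linearr.
have -> : k *: c + d - (k *: (y ** c) + y ** d) = k *: (c - y ** c) + (d - y ** d).
  by rewrite scalerBr opprD addrACA.
rewrite [s *: (_ + _)]scalerDr [s *: (k *: _)]scalerA [s * k]mulrC -scalerA.
by rewrite [k *: (_ + _)]scalerDr addrACA.
Qed.

(** As [y] commutes with [a], the product of [a + s (1 - y)] and [a - s (1 - y)] is
    [a^2 + (1 - y)^2], and [y_eq] says that [(1 - y)^2 = 1 - a^2]. *)
Lemma umulK s c : s * s = -1 -> umul s (umul (- s) c) = c.
Proof.
move=> ss; set v := c - y ** c.
have yac : a ** c - y ** (a ** c) = a ** v by rewrite /v amulBr !amulA y_comm.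
have vyv : v - y ** v = c - a ** (a ** c).
  rewrite /v amulBr !amulA.
  have -> : a ** a = 2%:R *: y - y ** y by rewrite y_eq addrK.
  rewrite amulBl amulZl scaler_nat mulr2n -[LHS]addrA -opprD.
  by rewrite [in LHS]addrA.
rewrite /umul -/v !amulDr [a ** (- s *: v)]amulZr.
have -> : a ** c + - s *: v - (y ** (a ** c) + y ** (- s *: v)) =
   a ** v - s *: (v - y ** v).
  by rewrite opprD addrACA yac amulZr -scalerBr scaleNr.
rewrite [s *: (_ - _)]scalerBr scalerA ss scaleN1r opprK vyv scaleNr.
by rewrite addrA subrK addrC subrK.
Qed.

Lemma umul_adj s c d : star (umul s c) ** d = star c ** umul (conjc s) d.
Proof.
rewrite /umul starD starM a_star starZ starB starM y_star.
by rewrite amulDl amulZl amulBl amulDr amulZr amulBr -!amulA.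
Qed.

(** The adjoint of [umul s] is [umul (conjc s)], here the inverse [umul (- s)]; hence [star c ** c]
    is preserved. *)
Lemma nrm_umul s c : s * s = -1 -> conjc s = - s -> nrm (umul s c) = nrm c.
Proof.
move=> ss sc; apply/eqP; rewrite -(@eqrXn2 _ 2) ?nrm_ge0 //; apply/eqP.
rewrite -!nrm_starM umul_adj sc -{2}[s]opprK umulK // mulrNN //.
Qed.

(** With [u = umul 'i] this reads [a = (u + u^-1) / 2], as for the cosine. *)
Lemma amul_umul c : a ** c = 2%:R^-1 *: (umul 'i c + umul (- 'i) c).
Proof.
rewrite /umul scaleNr addrACA subrr addr0 -mulr2n -[_ ** _ *+ 2]scaler_nat scalerA.
by rewrite mulVf ?scale1r // pnatr_eq0.
Qed.

End Unitary.

Lemma ii_N1 : 'i * 'i = -1 :> R[i].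
Proof. by rewrite -expr2 sqr_i. Qed.

(** Clearing denominators gives the polynomial [r(z) = z^n p((z + z^-1) / 2)], whose coefficients
    are at most [S] by [coef_le_circle]. Then [p(a) c = r(u) u^-n c] with [u] isometric, and [r] has
    at most [2 n + 1] coefficients. *)
Lemma ev_bound_deg p c (S : R) :
  (forall t : R, `|t| <= 1 -> normc p.[t%:C] <= S) ->
  nrm (ev (amul a) p c) <= ((2 * size p + 1)%N)%:R * S * nrm c.
Proof.
move=> HS; have [y [sy ya Hy]] := one_sub_sqrt_exists.
pose u := umul y 'i; pose u' := umul y (- 'i).
have uu' d : u (u' d) = d by rewrite /u /u' umulK // ii_N1.
have u'u d : u' (u d) = d.
  have ss : - 'i * - 'i = -1 :> R[i] by rewrite mulrNN ii_N1.
  by have := umulK ya Hy d ss; rewrite opprK.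
have nu d : nrm (u d) = nrm d.
  by apply: nrm_umul => //; [exact: ii_N1 | rewrite /conjc /= -[RHS]/(Complex _ _) oppr0].
have nu' d : nrm (u' d) = nrm d by rewrite -(nu (u' d)) uu'.
have ulin : linear u by exact: umul_linear.
set n := size p.
(* At a point [z] of the circle [sp] takes the value [z Re z]; at the operator [u] it is [u a]. *)
pose sp : {poly R[i]} := 2%:R^-1 *: ('X^2 + 1).
pose r : {poly R[i]} := \sum_(i < n) p`_i *: (sp ^+ i * 'X^(n - i)).
pose d := iter n u' c.
have nd : nrm d = nrm c by rewrite /d; elim: (n) => //= k IH; rewrite nu'.
have uXn k x : ev u 'X^k (iter k u' x) = x.
  by rewrite evXn //; elim: k x => // k IH x; rewrite iterSr iterS uu' IH.
have key i : (i <= n)%N -> ev u (sp ^+ i * 'X^(n - i)) d = iter i (amul a) c.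
  elim: i => [|i IH] lin; first by rewrite expr0 mul1r subn0 uXn.
  pose w := ev u (sp ^+ i * 'X^(n - i.+1)) d.
  have uw : u w = iter i (amul a) c.
    rewrite -IH 1?ltnW // /w -evXM // -mulrA -exprSr.
    by rewrite subnSK.
  rewrite exprS -mulrA evM // -/w /sp evZ evD expr2 evXM // evX // uw.
  rewrite -polyC1 evC scale1r -[w]u'u uw iterS /=.
  by rewrite (amul_umul y) -/u -/u'.
have evr : ev u r d = ev (amul a) p c.
  rewrite /r ev_sum; apply: eq_bigr => i _.
  by rewrite evZ key // ltnW.
have S0 : 0 <= S.
  by apply: (le_trans (normc_ge0 _) (HS 0 _)); rewrite normr0.
rewrite -evr -nd; apply: (le_trans (nrm_ev_le _ _ nu)).
rewrite ler_wpM2r ?nrm_ge0 //.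
have szsp : (size sp <= 3)%N.
  apply: (leq_trans (size_scale_leq _ _)).
  by rewrite (leq_trans (size_polyD _ _)) // size_polyXn size_poly1.
have szr : (size r <= 2 * n + 1)%N.
  apply: (leq_trans (size_sum _ _ _)); apply/bigmax_leqP => i _.
  apply: (leq_trans (size_scale_leq _ _)).
  apply: (leq_trans (size_polyMleq _ _)); rewrite size_polyXn.
  have := size_poly_exp_leq sp i.
  have := ltn_ord i.
  have sp2 : ((size sp).-1 <= 2)%N by lia.
  have : ((size sp).-1 * i <= 2 * i)%N by rewrite leq_mul2r sp2 orbT.
  lia.
apply: (@le_trans _ _ (\sum_(i < size r) S)); last first.
  by rewrite sumr_const card_ord -[S *+ _]mulr_natl ler_wpM2r // ler_nat.
apply: ler_sum => i _; apply: coef_le_circle => z nz.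
have [t tz t1] : exists2 t : R, 2%:R^-1 * (z ^+ 2 + 1) = z * t%:C & `|t| <= 1.
  exists (complex.Re z).
    have z1 : conjc z * z = 1 by rewrite conjc_mul_normc nz expr1n.
    have -> : (complex.Re z)%:C = (z + conjc z) / 2%:R by exact: ReJ_add.
    rewrite mulrA [RHS]mulrC; congr (_ * _).
    by rewrite mulrDr -expr2 [z * conjc z]mulrC z1.
  by rewrite -nz -lecR -normcEC normc_ge_Re.
have -> : r.[z] = z ^+ n * p.[t%:C].
  rewrite /r horner_sum horner_coef mulr_sumr; apply: eq_bigr => j _.
  rewrite hornerZ hornerM horner_exp hornerZ hornerD !hornerXn hornerC tz.
  rewrite exprMn [RHS]mulrCA; congr (_ * _).
  by rewrite mulrAC -exprD subnKC // ltnW.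
by rewrite normcM normcX nz expr1n mul1r HS.
Qed.

(** For [q = conj(p) p] and [N = 2 ^ k] the C*-identity gives [|q(a) c|^N |c| <= |c|^N |q^N(a) c|].
    The right-hand side is bounded by [ev_bound_deg] with a factor affine in [N], which
    [power_trick] discards; [p] is recovered from [|p(a) c|^2 <= |c| |q(a) c|]. *)
Lemma ev_bound p c (S : R) :
  (forall t : R, `|t| <= 1 -> normc p.[t%:C] <= S) ->
  nrm (ev (amul a) p c) <= S * nrm c.
Proof.
move=> HS.
have S0 : 0 <= S.
  by apply: (le_trans (normc_ge0 _) (HS 0 _)); rewrite normr0.
have [n0|n0] := eqVneq (nrm c) 0.
  by rewrite (nrm0_eq0 n0) ev_0r ?nrm0 ?mulr0 //; exact: amul_linear.
have np : 0 < nrm c by rewrite lt_neqAle eq_sym n0 nrm_ge0.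
pose q := map_poly conjc p * p.
have qconj : map_poly conjc q = q.
  rewrite /q rmorphM mulrC; congr (_ * _); apply/polyP => i.
  by rewrite /= !coef_map_id0 ?conjc0 // conjcK.
(* Cauchy-Schwarz for [star c ** x(a)^2 c], which is how [x(a) c] squares under the inner
   product. *)
have sq x : map_poly conjc x = x ->
    nrm (ev (amul a) x c) ^+ 2 <= nrm c * nrm (ev (amul a) (x * x) c).
  move=> xc; rewrite -nrm_starM ev_adj xc -evM; last exact: amul_linear.
  by apply: (le_trans (nrmM _ _)); rewrite nrm_star.
have X k : nrm (ev (amul a) q c) ^+ (2 ^ k) * nrm c <=
    nrm c ^+ (2 ^ k) * nrm (ev (amul a) (q ^+ (2 ^ k)) c).
  elim: k => [|k IH]; first by rewrite expn0 !expr1 mulrC.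
  have qk : map_poly conjc (q ^+ (2 ^ k)) = q ^+ (2 ^ k) by rewrite rmorphXn /= qconj.
  rewrite -(ler_pM2r np) expnSr !exprM; have := sq _ qk; rewrite -expr2.
  move: IH; set A := _ ^+ (2 ^ k); set N := nrm c ^+ _; set E := nrm (ev _ _ _).
  set E' := nrm (ev _ _ _) => IH HE.
  have A0 : 0 <= A by rewrite exprn_ge0 ?nrm_ge0.
  have N0 : 0 <= N by rewrite exprn_ge0 ?nrm_ge0.
  have E0 : 0 <= E by exact: nrm_ge0.
  have H1 : (A * nrm c) ^+ 2 <= (N * E) ^+ 2.
    by apply: lerXn2r IH; rewrite nnegrE mulr_ge0 ?nrm_ge0.
  have H2 : N ^+ 2 * E ^+ 2 <= N ^+ 2 * (nrm c * E').
    by rewrite ler_wpM2l // exprn_ge0.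
  move: H1; rewrite !exprMn => H1; lra.
have qS t : `|t| <= 1 -> normc q.[t%:C] <= S ^+ 2.
  move=> t1; rewrite /q hornerM horner_conj normcM normc_conj -expr2.
  by apply: lerXn2r; rewrite ?nnegrE ?normc_ge0 // HS.
have Hq : nrm (ev (amul a) q c) <= nrm c * S ^+ 2.
  (* The constants come from [size (q ^ N) <= (size q - 1) N + 1]. *)
  apply: (@power_trick _ _ _ (2 * (size q)%:R) 3);
    rewrite ?nrm_ge0 ?mulr_ge0 ?exprn_ge0 ?nrm_ge0 // => k.
  rewrite -(ler_pM2r np); apply: (le_trans (X k)).
  rewrite [(_ * S ^+ 2) ^+ _]exprMn; set N := nrm c ^+ _; set T := (S ^+ 2) ^+ _.
  have N0 : 0 <= N by rewrite exprn_ge0 ?nrm_ge0.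
  have T0 : 0 <= T by rewrite !exprn_ge0.
  have H : nrm (ev (amul a) (q ^+ (2 ^ k)) c)
      <= ((2 * size (q ^+ (2 ^ k)) + 1)%N)%:R * T * nrm c.
    apply: ev_bound_deg => t t1; rewrite horner_exp normcX.
    by apply: lerXn2r; rewrite ?nnegrE ?normc_ge0 ?exprn_ge0 // qS.
  have -> : (2 * (size q)%:R * (2 ^ k)%:R + 3) * (N * T) * nrm c =
      N * ((2 * (size q)%:R * (2 ^ k)%:R + 3) * T * nrm c) by ring.
  rewrite ler_wpM2l //; apply: (le_trans H).
  rewrite !ler_wpM2r ?nrm_ge0 // -[2]/(2%:R) -[3]/(3%:R) -!natrM -natrD ler_nat.
  have := size_poly_exp_leq q (2 ^ k).
  have : ((size q).-1 * 2 ^ k <= size q * 2 ^ k)%N by rewrite leq_mul2r leq_pred orbT.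
  lia.
rewrite -(@ler_pXn2r _ 2) ?nnegrE ?mulr_ge0 ?nrm_ge0 //.
rewrite -nrm_starM ev_adj -evM; last exact: amul_linear.
apply: (le_trans (nrmM _ _)); rewrite nrm_star exprMn mulrC.
by apply: (le_trans (ler_wpM2r (nrm_ge0 _) Hq)); rewrite mulrAC mulrC -expr2.
Qed.

End SelfAdjointBound.

(** * Continuous functional calculus *)

Section Bernstein.
Context {R : realType}.
Implicit Types (x t : R) (n : nat).

(** The Bernstein polynomial with data [g 0, ..., g n], obtained by conditioning on the first of [n]
    trials; the recursion replaces binomial coefficients. *)
Fixpoint bern n (g : nat -> R[i]) : {poly R[i]} :=
  if n is m.+1 then 'X * bern m (fun k => g k.+1) + (1 - 'X) * bern m g
  else (g 0%N)%:P.

(* Expectation of [g] under the binomial law of parameters [n] and [x]. *)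
Fixpoint binom_mean n (g : nat -> R) x : R :=
  if n is m.+1 then
    x * binom_mean m (fun k => g k.+1) x + (1 - x) * binom_mean m g x
  else g 0%N.

Lemma normc_bern n g x : 0 <= x <= 1 ->
  normc (bern n g).[x%:C] <= binom_mean n (fun k => normc (g k)) x.
Proof.
move=> /andP[x0 x1]; elim: n g => [|n IH] g; first by rewrite /= hornerC.
rewrite /= hornerD !hornerM hornerD hornerN hornerX hornerC.
apply: (le_trans (normcD _ _)); rewrite !normcM normcR ger0_norm //.
have -> : 1 - x%:C = (1 - x)%:C by rewrite rmorphB rmorph1.
have x1' : 0 <= 1 - x by rewrite subr_ge0.
by rewrite normcR ger0_norm // lerD // ler_wpM2l.
Qed.

(** The Bernstein weights sum to 1, so constants are reproduced. *)
Lemma bern_sub n (z x : R[i]) g :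
  z - (bern n g).[x] = (bern n (fun k => z - g k)).[x].
Proof.
elim: n g => [|n IH] g; first by rewrite /= !hornerC.
rewrite /= !hornerD !hornerM !hornerD !hornerN !hornerX !hornerC -!IH.
ring.
Qed.

Lemma binom_mean_le n g h x : 0 <= x <= 1 ->
  (forall k, (k <= n)%N -> g k <= h k) -> binom_mean n g x <= binom_mean n h x.
Proof.
move=> /andP[x0 x1]; have x1' : 0 <= 1 - x by rewrite subr_ge0.
elim: n g h => [|n IH] g h H /=; first exact: H.
by rewrite lerD // ler_wpM2l // IH // => k kn; rewrite H // leqW.
Qed.

(** Squared bias plus the variance [n x (1 - x)]. The centre [c] is arbitrary because the induction
    shifts it to [c - 1] after a success. *)
Lemma binom_mean_sqr n (A B c x : R) :
  binom_mean n (fun k => A + B * (k%:R - c) ^+ 2) x =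
  A + B * ((n%:R * x - c) ^+ 2 + n%:R * x * (1 - x)).
Proof.
elim: n c => [|n IH] c; first by rewrite /= !mul0r addr0.
rewrite [LHS]/= IH.
have -> : (fun k => A + B * (k.+1%:R - c) ^+ 2) =
  (fun k => A + B * (k%:R - (c - 1)) ^+ 2).
  by apply/funext => k; rewrite -natr1 opprB addrA addrAC.
rewrite IH -natr1; ring.
Qed.

(* Uniform continuity and boundedness on [[-1, 1]]; values elsewhere are irrelevant. *)
Definition ucont (f : R -> R[i]) : Prop :=
  (exists M, forall t, `|t| <= 1 -> normc (f t) <= M) /\
  forall e, 0 < e -> exists2 d, 0 < d &
    forall s t, `|s| <= 1 -> `|t| <= 1 -> `|s - t| <= d -> normc (f s - f t) <= e.

Definition approx (f : R -> R[i]) (p : {poly R[i]}) (e : R) : Prop :=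
  forall t, `|t| <= 1 -> normc (f t - p.[t%:C]) <= e.

(** Chebyshev's argument: nodes within [d] of [t] contribute at most [e / 2]; at the others
    [2 M <= B (node - t)^2], and the mean of that square is of order [1 / n]. *)
Lemma weierstrass f e : ucont f -> 0 < e -> exists p, approx f p e.
Proof.
move=> [[M fM] fu] e0.
have e20 : 0 < e / 2 by rewrite divr_gt0.
have [d d0 fd] := fu _ e20.
have M0 : 0 <= M.
  by apply: (le_trans (normc_ge0 _) (fM 0 _)); rewrite normr0.
pose B := 2 * M / d ^+ 2.
have B0 : 0 <= B by rewrite divr_ge0 ?mulr_ge0 ?exprn_ge0 // ltW.
have [n0 Hn0] := inv_small (divr_gt0 e20 (ltr_wpDl B0 ltr01)).
pose n := n0.+1; have nn0 : n%:R != 0 :> R by rewrite pnatr_eq0.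
have np : 0 < n%:R :> R by rewrite ltr0n.
pose node k : R := 2 * k%:R / n%:R - 1.
(* The substitution [x = (1 + t) / 2] carries [[-1, 1]] to [[0, 1]] and [node k] to [k / n]. *)
pose p := bern n (fun k => f (node k)) \Po (2%:R^-1 *: ('X + 1)).
exists p => t t1.
pose x := (1 + t) / 2; have x01 : 0 <= x <= 1.
  by move: t1; rewrite ler_norml => /andP[? ?]; rewrite /x; apply/andP; split; lra.
have -> : p.[t%:C] = (bern n (fun k => f (node k))).[x%:C].
  rewrite horner_comp; congr (_.[_]); rewrite hornerZ hornerD hornerX hornerC.
  rewrite /x rmorphM rmorphD rmorph1 /= fmorphV /= rmorph_nat.
  by rewrite mulrC addrC.
rewrite bern_sub; apply: (le_trans (normc_bern _ _ x01)).
pose g k : R := e / 2 + B * (2 / n%:R) ^+ 2 * (k%:R - n%:R * x) ^+ 2.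
apply: (@le_trans _ _ (binom_mean n g x)).
  apply: binom_mean_le => // k kn.
  have nodeE : node k - t = 2 / n%:R * (k%:R - n%:R * x).
    by rewrite /node /x; field.
  have node1 : `|node k| <= 1.
    have kn' : k%:R <= n%:R :> R by rewrite ler_nat.
    have k0 : 0 <= k%:R :> R by [].
    have kr : k%:R / n%:R <= 1 :> R by rewrite ler_pdivrMr // mul1r.
    have kr0 : 0 <= k%:R / n%:R :> R by rewrite divr_ge0.
    by rewrite /node -mulrA ler_norml; apply/andP; split; lra.
  have [nt|nt] := leP `|node k - t| d.
    rewrite normcB; apply: (le_trans (fd _ _ node1 t1 nt)).
    by rewrite lerDl mulr_ge0 ?sqr_ge0 // mulr_ge0 ?sqr_ge0.
  have : normc (f t - f (node k)) <= 2 * M.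
    apply: (le_trans (normcD _ _)); rewrite normcN.
    by have := lerD (fM _ t1) (fM _ node1); rewrite -mulr2n mulr_natl.
  move=> /le_trans; apply.
  rewrite /g -mulrA -exprMn -nodeE.
  have H : 2 * M <= B * (node k - t) ^+ 2.
    rewrite /B mulrAC ler_pdivlMr ?exprn_gt0 // ler_wpM2l ?mulr_ge0 //.
    rewrite -[X in _ <= X]real_normK ?num_real //.
    by apply: lerXn2r; rewrite ?nnegrE ?normr_ge0 // ltW.
  by apply: (le_trans H); rewrite lerDr ltW.
rewrite binom_mean_sqr subrr expr0n add0r.
have Hx : x * (1 - x) <= 4^-1.
  have : 0 <= (x - 2^-1) ^+ 2 by exact: sqr_ge0.
  by rewrite expr2; nra.
have -> : B * (2 / n%:R) ^+ 2 * (n%:R * x * (1 - x)) =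
    4 * (x * (1 - x)) * (B * n%:R^-1) by field.
have H1 : B * n%:R^-1 <= e / 2.
  have : n%:R^-1 * (B + 1) <= e / 2.
    by rewrite -ler_pdivlMr ?ltr_wpDl //; exact: Hn0.
  have : 0 <= n%:R^-1 :> R by rewrite invr_ge0.
  by rewrite mulrDr mulr1 [B * _]mulrC; lra.
have H2 : 4 * (x * (1 - x)) * (B * n%:R^-1) <= 1 * (B * n%:R^-1).
  apply: ler_wpM2r; first by rewrite mulr_ge0 ?invr_ge0.
  by rewrite mulrC -ler_pdivlMr // div1r.
lra.
Qed.

(** Averaging the errors at [t] and [- t] cancels the odd part of an approximating polynomial. The
    result is a calculus in [a^2] alone, for use with elements that commute with [a^2] but not with
    [a]. *)
Lemma weierstrass_even f e : ucont f ->
  (forall t, `|t| <= 1 -> f (- t) = f t) -> 0 < e ->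
  exists p, approx f (p \Po 'X^2) e.
Proof.
move=> fu fe e0; have [p Hp] := weierstrass fu e0.
exists (even_poly p) => t t1.
have pE (s : R[i]) : p.[s] = (even_poly p).[s ^+ 2] + (odd_poly p).[s ^+ 2] * s.
  by rewrite -{1}[p]poly_even_odd hornerD hornerM !horner_comp !hornerXn hornerX.
have := Hp t t1; have := Hp (- t); rewrite normrN => /(_ t1).
rewrite fe // !pE horner_comp hornerXn rmorphN sqrrN /= mulrN.
set u := (even_poly p).[_]; set v := _ * t%:C => H1 H2.
have -> : f t - u = 2%:R^-1 * ((f t - (u - v)) + (f t - (u + v))) by field.
rewrite normcM normcV normc_nat ler_pdivrMl //.
by apply: (le_trans (normcD _ _)); lra.
Qed.

End Bernstein.

Section UniformlyContinuous.
Context {R : realType}.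
Implicit Types (f g : R -> R[i]).

(** The common shape of the approximation arguments below, with error [e] times a constant; [e <= 1]
    allows [e^2] to be bounded by [e]. *)
Lemma ler_eps (x y K : R) :
  (forall e : R, 0 < e -> e <= 1 -> x <= y + e * K) -> x <= y.
Proof.
move=> H; apply/ler_addgt0Pl => e e0.
have K1 : 0 < `|K| + 1 by rewrite ltr_wpDl.
pose d := Num.min 1 (e / (`|K| + 1)).
have d0 : 0 < d by rewrite lt_min ltr01 divr_gt0.
have d1 : d <= 1 by rewrite ge_min lexx.
have de : d * (`|K| + 1) <= e by rewrite -ler_pdivlMr // ge_min lexx orbT.
apply: (le_trans (H d d0 d1)); rewrite addrC lerD2r.
apply: le_trans de; apply: ler_wpM2l; first exact: ltW.
by rewrite (le_trans (ler_norm K)) // lerDl.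
Qed.

Lemma ucont_bound f : ucont f ->
  exists2 M, 0 <= M & forall t, `|t| <= 1 -> normc (f t) <= M.
Proof.
move=> [[M fM] _]; exists M => //.
by apply: (le_trans (normc_ge0 _) (fM 0 _)); rewrite normr0.
Qed.

Lemma ucont_cst (z : R[i]) : ucont (fun _ => z).
Proof.
split; first by exists (normc z).
by move=> e e0; exists 1 => // s t _ _ _; rewrite subrr normc0 ltW.
Qed.

Lemma ucont_add f g : ucont f -> ucont g -> ucont (fun t => f t + g t).
Proof.
move=> [[M fM] fu] [[N gN] gu]; split.
  by exists (M + N) => t t1; apply: (le_trans (normcD _ _)); rewrite lerD ?fM ?gN.
move=> e e0; have e20 : 0 < e / 2 by rewrite divr_gt0.
have [d d0 fd] := fu _ e20; have [k k0 gk] := gu _ e20.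
exists (Num.min d k); first by rewrite lt_min d0.
move=> s t s1 t1; rewrite le_min => /andP[sd sk].
rewrite opprD addrACA (splitr e); apply: (le_trans (normcD _ _)).
by rewrite lerD ?fd ?gk.
Qed.

Lemma ucont_mul f g : ucont f -> ucont g -> ucont (fun t => f t * g t).
Proof.
move=> uf ug; have [M M0 fM] := ucont_bound uf; have [N N0 gN] := ucont_bound ug.
have [_ fu] := uf; have [_ gu] := ug; split.
  by exists (M * N) => t t1; rewrite normcM ler_pM ?normc_ge0 ?fM ?gN.
move=> e e0; have MN : 0 < M + N + 1 by rewrite ltr_wpDl // addr_ge0.
have [d d0 fd] := fu _ (divr_gt0 e0 MN); have [k k0 gk] := gu _ (divr_gt0 e0 MN).
exists (Num.min d k); first by rewrite lt_min d0.
move=> s t s1 t1; rewrite le_min => /andP[sd sk].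
have -> : f s * g s - f t * g t = (f s - f t) * g s + f t * (g s - g t) by ring.
apply: (le_trans (normcD _ _)); rewrite !normcM.
have e1 : 0 <= e / (M + N + 1) by rewrite ltW // divr_gt0.
have H1 : normc (f s - f t) * normc (g s) <= e / (M + N + 1) * N.
  by rewrite ler_pM ?normc_ge0 ?fd ?gN.
have H2 : normc (f t) * normc (g s - g t) <= M * (e / (M + N + 1)).
  by rewrite ler_pM ?normc_ge0 ?gk ?fM.
have HE : e / (M + N + 1) * (M + N + 1) = e by rewrite divfK // gt_eqF.
by move: HE H1 H2 e1; set E := e / _; lra.
Qed.

Lemma ucont_sub f g : ucont f -> ucont g -> ucont (fun t => f t - g t).
Proof.
move=> uf ug; have -> : (fun t => f t - g t) = (fun t => f t + (-1) * g t).
  by apply/funext => t; rewrite mulN1r.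
by apply: ucont_add => //; apply: ucont_mul => //; exact: ucont_cst.
Qed.

Lemma ucont_conj f : ucont f -> ucont (fun t => conjc (f t)).
Proof.
move=> [[M fM] fu]; split; first by exists M => t t1; rewrite normc_conj fM.
move=> e /fu[d d0 fd]; exists d => // s t s1 t1 st.
have -> : conjc (f s) - conjc (f t) = conjc (f s - f t) by rewrite conjcD conjcN.
by rewrite normc_conj fd.
Qed.

Lemma ucont_comp_lip f (h : R -> R) (k : R) : ucont f ->
  (forall t, `|t| <= 1 -> `|h t| <= 1) ->
  (forall s t, `|s| <= 1 -> `|t| <= 1 -> `|h s - h t| <= k * `|s - t|) ->
  ucont (fun t => f (h t)).
Proof.
move=> [[M fM] fu] h1 hk; split; first by exists M => t t1; rewrite fM ?h1.
have k1 : 0 < `|k| + 1 by rewrite ltr_wpDl.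
move=> e /fu[d d0 fd]; exists (d / (`|k| + 1)); first by rewrite divr_gt0.
move=> s t s1 t1; rewrite ler_pdivlMr // => st; apply: fd; rewrite ?h1 //.
apply: (le_trans (hk _ _ s1 t1)); apply: le_trans st; rewrite mulrC.
by rewrite ler_wpM2l // (le_trans (ler_norm k)) // lerDl.
Qed.

Lemma ucont_lip (h : R -> R) (k : R) :
  (forall s t, `|s| <= 1 -> `|t| <= 1 -> `|h s - h t| <= k * `|s - t|) ->
  ucont (fun t => (h t)%:C).
Proof.
move=> hk; have k1 : 0 < `|k| + 1 by rewrite ltr_wpDl.
have hk' s t : `|s| <= 1 -> `|t| <= 1 -> `|h s - h t| <= (`|k| + 1) * `|s - t|.
  move=> s1 t1; apply: (le_trans (hk _ _ s1 t1)).
  by rewrite ler_wpM2r // (le_trans (ler_norm k)) // lerDl.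
split.
  exists (`|h 0| + (`|k| + 1)) => t t1; rewrite normcR -[h t](subrK (h 0)) addrC.
  apply: (le_trans (ler_normD _ _)); rewrite lerD2l.
  apply: (le_trans (hk' _ _ t1 _)); first by rewrite normr0.
  by rewrite subr0 ler_piMr // ltW.
move=> e e0; exists (e / (`|k| + 1)); first by rewrite divr_gt0.
move=> s t s1 t1; rewrite ler_pdivlMr // => st.
have -> : (h s)%:C - (h t)%:C = (h s - h t)%:C by rewrite rmorphB.
rewrite normcR; apply: (le_trans (hk' _ _ s1 t1)).
by rewrite mulrC.
Qed.

Lemma ucont_id : ucont (fun t : R => t%:C).
Proof. by apply: (@ucont_lip id 1) => s t _ _; rewrite mul1r. Qed.

Lemma ucont_exp f n : ucont f -> ucont (fun t => f t ^+ n).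
Proof.
move=> uf; elim: n => [|n IH].
  by have -> : (fun t => f t ^+ 0) = fun=> 1 by []; exact: ucont_cst.
have -> : (fun t => f t ^+ n.+1) = (fun t => f t * f t ^+ n).
  by apply/funext => t; rewrite exprS.
exact: ucont_mul.
Qed.

End UniformlyContinuous.

Section FunctionalCalculus.
Context {R : realType} {C : cstarType R}.
Variable a : C.
Hypothesis a_star : star a = a.
Hypothesis a_lt1 : nrm a < 1.
Implicit Types (f g : R -> R[i]) (c d : C) (p : {poly R[i]}).

Let alin := amul_linear a.

(** Every approximating polynomial, with whatever error, has to approximate [l]. The value therefore
    depends on no chosen sequence, and each law can be checked on convenient polynomials. *)
Definition fc_spec f c l : Prop :=
  forall p e, approx f p e -> nrm (l - ev (amul a) p c) <= e * nrm c.

(* [fc f c] is [f(a) c]; the algebra being non-unital, [f(a)] itself is only a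
   left multiplier. *)
Definition fc f c : C := xget 0 [set l | fc_spec f c l].

Lemma fc_exists f c : ucont f -> exists l, fc_spec f c l.
Proof.
move=> uf.
have inv0 n : 0 < n.+1%:R^-1 :> R by rewrite invr_gt0 ltr0n.
pose p n := sval (cid (weierstrass uf (inv0 n))).
have pP n : approx f (p n) n.+1%:R^-1 by exact: (svalP (cid (weierstrass uf (inv0 n)))).
have pq q r (d e : R) : approx f q d -> approx f r e ->
    nrm (ev (amul a) q c - ev (amul a) r c) <= (d + e) * nrm c.
  move=> fq fr; rewrite -evB; apply: ev_bound => // t t1.
  rewrite hornerD hornerN.
  have -> : q.[t%:C] - r.[t%:C] = (f t - r.[t%:C]) - (f t - q.[t%:C]) by ring.
  by apply: (le_trans (normcD _ _)); rewrite normcN addrC lerD ?fq ?fr.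
have c1 : 0 < 2 * nrm c + 1 by rewrite ltr_wpDl // mulr_ge0 // nrm_ge0.
have [l Hl] : exists l, tends (fun n => ev (amul a) (p n) c) l.
  apply: cauchy_tends => e e0.
  have [N HN] := inv_small (divr_gt0 e0 c1); exists N => m n Nm Nn.
  apply: (le_trans (pq _ _ _ _ (pP m) (pP n))).
  have H : (m.+1%:R^-1 + n.+1%:R^-1) * nrm c <= e / (2 * nrm c + 1) * (2 * nrm c).
    rewrite mulrA ler_wpM2r ?nrm_ge0 // mulr_natr mulr2n.
    by rewrite lerD ?HN.
  apply: (le_trans H); rewrite mulrAC ler_pdivrMr // ler_wpM2l ?ltW //.
  by rewrite ltrDl.
exists l => q e fq; apply: (@ler_eps _ _ _ (1 + nrm c)) => d d0 _.
have [N HN] := Hl d d0; have [N' HN'] := inv_small d0.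
pose n := maxn N N'.
apply: (le_trans (nrm_tri (ev (amul a) (p n) c) _ _)).
have H1 : nrm (l - ev (amul a) (p n) c) <= d by rewrite nrmBC HN // leq_maxl.
have H2 := pq _ _ _ _ (pP n) fq.
have H3 : n.+1%:R^-1 * nrm c <= d * nrm c.
  by rewrite ler_wpM2r ?nrm_ge0 // HN' // leq_maxr.
move: H1 H2 H3; move: (n.+1%:R^-1) => x H1 H2 H3; lra.
Qed.

Lemma fcP f c : ucont f -> fc_spec f c (fc f c).
Proof.
move=> uf; have [l Hl] := fc_exists c uf.
exact: (xgetI 0 (P := [set l | fc_spec f c l]) Hl).
Qed.

Lemma fc_approx f e : ucont f -> 0 < e ->
  exists2 p, approx f p e & forall c, nrm (fc f c - ev (amul a) p c) <= e * nrm c.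
Proof.
by move=> uf e0; have [p fp] := weierstrass uf e0; exists p => // c; apply: fcP.
Qed.

Lemma fc_bound f c m : ucont f ->
  (forall t, `|t| <= 1 -> normc (f t) <= m) -> nrm (fc f c) <= m * nrm c.
Proof.
move=> uf fm; apply: (@ler_eps _ _ _ (2 * nrm c)) => e e0 _.
have [p fp H] := fc_approx uf e0.
have H2 : nrm (ev (amul a) p c) <= (m + e) * nrm c.
  apply: ev_bound => // t t1.
  have -> : p.[t%:C] = f t - (f t - p.[t%:C]) by ring.
  by apply: (le_trans (normcD _ _)); rewrite normcN lerD ?fm ?fp.
rewrite -[fc f c](subrK (ev (amul a) p c)); apply: (le_trans (nrmD _ _)).
have := H c; lra.
Qed.

Lemma fc_poly p c : ucont (fun t => p.[t%:C]) ->
  fc (fun t => p.[t%:C]) c = ev (amul a) p c.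
Proof.
move=> uf; apply: nrm_small_eq => e e0.
have H := fcP c uf (p := p) (e := 0); apply: le_trans (H _) _.
  by move=> t _; rewrite subrr normc0.
by rewrite mul0r ltW.
Qed.

Lemma fc_ext f g c : ucont f -> ucont g ->
  (forall t, `|t| <= 1 -> f t = g t) -> fc f c = fc g c.
Proof.
move=> uf ug fg; apply/subr0_eq/nrm0_eq0/eqP; rewrite eq_le nrm_ge0 andbT.
apply: (@ler_eps _ _ _ (2 * nrm c)) => e e0 _; rewrite add0r.
have [p fp H] := fc_approx uf e0.
apply: (le_trans (nrm_tri (ev (amul a) p c) _ _)).
have H2 : nrm (fc g c - ev (amul a) p c) <= e * nrm c.
  by apply: fcP => // t t1; rewrite -fg // fp.
by rewrite nrmBC in H2; have := H c; lra.
Qed.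

Lemma fc_cst z c : fc (fun=> z) c = z *: c.
Proof.
have H := @fc_poly z%:P c; rewrite evC in H; rewrite -H.
  by congr (fc _ _); apply/funext => t; rewrite hornerC.
have -> : (fun t => z%:P.[t%:C]) = fun=> z by apply/funext => t; rewrite hornerC.
exact: ucont_cst.
Qed.

Lemma fc_id c : fc (fun t => t%:C) c = a ** c.
Proof.
have H := @fc_poly 'X c; rewrite evX // in H; rewrite -H.
  by congr (fc _ _); apply/funext => t; rewrite hornerX.
have -> : (fun t : R => 'X.[t%:C]) = fun t => t%:C by apply/funext => t; rewrite hornerX.
exact: ucont_id.
Qed.

Lemma fc_add f g c : ucont f -> ucont g ->
  fc (fun t => f t + g t) c = fc f c + fc g c.
Proof.
move=> uf ug; apply/subr0_eq/nrm0_eq0/eqP; rewrite eq_le nrm_ge0 andbT.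
apply: (@ler_eps _ _ _ (4 * nrm c)) => e e0 _; rewrite add0r.
have [p fp Hp] := fc_approx uf e0; have [q fq Hq] := fc_approx ug e0.
have H : nrm (fc (fun t => f t + g t) c - ev (amul a) (p + q) c) <= (e + e) * nrm c.
  apply: fcP; first exact: ucont_add.
  move=> t t1; rewrite hornerD opprD addrACA; apply: (le_trans (normcD _ _)).
  by rewrite lerD ?fp ?fq.
have -> : fc (fun t => f t + g t) c - (fc f c + fc g c) =
   (fc (fun t => f t + g t) c - ev (amul a) (p + q) c)
   - ((fc f c - ev (amul a) p c) + (fc g c - ev (amul a) q c)).
  by rewrite evD addrACA -opprD opprB addrA subrK.
apply: (le_trans (nrmB _ _)).
have := nrmD (fc f c - ev (amul a) p c) (fc g c - ev (amul a) q c).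
by have := Hp c; have := Hq c; lra.
Qed.

Lemma fc_mul f g c : ucont f -> ucont g ->
  fc (fun t => f t * g t) c = fc f (fc g c).
Proof.
move=> uf ug; apply/subr0_eq/nrm0_eq0/eqP; rewrite eq_le nrm_ge0 andbT.
have [M M0 fM] := ucont_bound uf; have [N N0 gN] := ucont_bound ug.
have H5 : nrm (fc g c) <= N * nrm c by exact: fc_bound.
apply: (@ler_eps _ _ _ (2 * (M + N + 1) * nrm c)) => e e0 e1; rewrite add0r.
have [p fp Hp] := fc_approx uf e0; have [q fq Hq] := fc_approx ug e0.
have pM t : `|t| <= 1 -> normc p.[t%:C] <= M + e.
  move=> t1; have -> : p.[t%:C] = f t - (f t - p.[t%:C]) by ring.
  by apply: (le_trans (normcD _ _)); rewrite normcN lerD ?fM ?fp.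
have H : nrm (fc (fun t => f t * g t) c - ev (amul a) (p * q) c)
    <= (e * N + (M + e) * e) * nrm c.
  apply: fcP; first exact: ucont_mul.
  move=> t t1; rewrite hornerM.
  have -> : f t * g t - p.[t%:C] * q.[t%:C] =
    (f t - p.[t%:C]) * g t + p.[t%:C] * (g t - q.[t%:C]) by ring.
  apply: (le_trans (normcD _ _)); rewrite !normcM.
  by rewrite lerD // ler_pM ?normc_ge0 ?fp ?gN ?pM ?fq.
have H3 : nrm (ev (amul a) p (fc g c) - fc f (fc g c)) <= e * (N * nrm c).
  by rewrite nrmBC; apply: (le_trans (Hp _)); rewrite ler_wpM2l // ltW.
have H4 : nrm (ev (amul a) (p * q) c - ev (amul a) p (fc g c)) <= (M + e) * (e * nrm c).
  rewrite nrmBC evM // -ev_Br //.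
  apply: (@le_trans _ _ ((M + e) * nrm (fc g c - ev (amul a) q c))).
    exact: ev_bound.
  by rewrite ler_wpM2l // addr_ge0 // ltW.
have := nrm_tri (ev (amul a) (p * q) c) (fc (fun t => f t * g t) c) (fc f (fc g c)).
have := nrm_tri (ev (amul a) p (fc g c)) (ev (amul a) (p * q) c) (fc f (fc g c)).
have He : e * (e * nrm c) <= e * nrm c.
  by rewrite mulrA ler_wpM2r ?nrm_ge0 // ler_piMr // ltW.
lra.
Qed.

Lemma fc_linear f : ucont f -> linear (fc f).
Proof.
move=> uf k c d; apply/subr0_eq/nrm0_eq0/eqP; rewrite eq_le nrm_ge0 andbT.
apply: (@ler_eps _ _ _ (nrm (k *: c + d) + normc k * nrm c + nrm d)) => e e0 _.
have [p fp Hp] := fc_approx uf e0; rewrite add0r.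
have -> : fc f (k *: c + d) - (k *: fc f c + fc f d) =
  (fc f (k *: c + d) - ev (amul a) p (k *: c + d))
  - (k *: (fc f c - ev (amul a) p c) + (fc f d - ev (amul a) p d)).
  by rewrite ev_linear // scalerBr addrACA -opprD opprB addrA subrK.
apply: (le_trans (nrmB _ _)).
have := nrmD (k *: (fc f c - ev (amul a) p c)) (fc f d - ev (amul a) p d).
rewrite nrmZ; have := Hp (k *: c + d); have := Hp d.
have : normc k * nrm (fc f c - ev (amul a) p c) <= normc k * (e * nrm c).
  by rewrite ler_wpM2l ?normc_ge0.
lra.
Qed.

Lemma fc_D f c d : ucont f -> fc f (c + d) = fc f c + fc f d.
Proof. by move=> uf; have := fc_linear uf 1 c d; rewrite !scale1r. Qed.

Lemma fc_0 f : ucont f -> fc f 0 = 0.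
Proof.
by move=> uf; have := fc_linear uf (-1) 0 0; rewrite scaler0 addr0 scaleN1r addNr.
Qed.

Lemma fc_Z f k c : ucont f -> fc f (k *: c) = k *: fc f c.
Proof. by move=> uf; have := fc_linear uf k c 0; rewrite fc_0 // !addr0. Qed.

Lemma fc_B f c d : ucont f -> fc f (c - d) = fc f c - fc f d.
Proof. by move=> uf; rewrite fc_D // -[- d]scaleN1r fc_Z // scaleN1r. Qed.

Lemma fc_scale f k c : ucont f -> fc (fun t => k * f t) c = k *: fc f c.
Proof. by move=> uf; rewrite fc_mul ?fc_cst //; exact: ucont_cst. Qed.

Lemma fc_sub f g c : ucont f -> ucont g ->
  fc (fun t => f t - g t) c = fc f c - fc g c.
Proof.
move=> uf ug; rewrite -[- fc g c]scaleN1r -fc_scale // -fc_add //.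
  by congr (fc _ _); apply/funext => t; rewrite mulN1r.
by apply: ucont_mul => //; exact: ucont_cst.
Qed.

Lemma ev_amulr p c d : ev (amul a) p (c ** d) = ev (amul a) p c ** d.
Proof.
rewrite /ev (big_morph (fun x => x ** d) (fun x y => amulDl x y d) (amul0l d)).
apply: eq_bigr => i _; rewrite amulZl; congr (_ *: _).
by elim: (nat_of_ord i) => //= n ->; rewrite amulA.
Qed.

Lemma fc_amulr f c d : ucont f -> fc f (c ** d) = fc f c ** d.
Proof.
move=> uf; apply/subr0_eq/nrm0_eq0/eqP; rewrite eq_le nrm_ge0 andbT.
apply: (@ler_eps _ _ _ (nrm (c ** d) + nrm c * nrm d)) => e e0 _.
have [p fp Hp] := fc_approx uf e0; rewrite add0r.
have -> : fc f (c ** d) - fc f c ** d =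
  (fc f (c ** d) - ev (amul a) p (c ** d)) - (fc f c - ev (amul a) p c) ** d.
  by rewrite ev_amulr amulBl opprB addrA subrK.
apply: (le_trans (nrmB _ _)).
have := nrmM (fc f c - ev (amul a) p c) d; have := Hp (c ** d).
have : nrm (fc f c - ev (amul a) p c) * nrm d <= e * nrm c * nrm d.
  by rewrite ler_wpM2r ?nrm_ge0.
lra.
Qed.

Lemma fc_adj f c d : ucont f ->
  star (fc f c) ** d = star c ** fc (fun t => conjc (f t)) d.
Proof.
move=> uf; apply/subr0_eq/nrm0_eq0/eqP; rewrite eq_le nrm_ge0 andbT.
apply: (@ler_eps _ _ _ (2 * nrm c * nrm d)) => e e0 _.
have [p fp Hp] := fc_approx uf e0; rewrite add0r.
pose q := map_poly conjc p.
have H : nrm (fc (fun t => conjc (f t)) d - ev (amul a) q d) <= e * nrm d.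
  apply: fcP; first exact: ucont_conj.
  by move=> t t1; rewrite horner_conj -conjcN -conjcD normc_conj fp.
have -> : star (fc f c) ** d - star c ** fc (fun t => conjc (f t)) d =
  star (fc f c - ev (amul a) p c) ** d
  - star c ** (fc (fun t => conjc (f t)) d - ev (amul a) q d).
  by rewrite starB amulBl ev_adj // amulBr opprB addrA subrK.
apply: (le_trans (nrmB _ _)).
have := nrmM (star (fc f c - ev (amul a) p c)) d.
have := nrmM (star c) (fc (fun t => conjc (f t)) d - ev (amul a) q d).
rewrite !nrm_star.
have : nrm (fc f c - ev (amul a) p c) * nrm d <= e * nrm c * nrm d.
  by rewrite ler_wpM2r ?nrm_ge0.
have : nrm c * nrm (fc (fun t => conjc (f t)) d - ev (amul a) q d)
    <= nrm c * (e * nrm d).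
  by rewrite ler_wpM2l ?nrm_ge0.
lra.
Qed.

Lemma fc_ideal (J : set C) f c : is_ideal J -> ucont f -> J c -> J (fc f c).
Proof.
move=> [Jcl J0 JD JM] uf Jc; apply: (closed_approx Jcl) => e e0.
have c1 : 0 < nrm c + 1 by rewrite ltr_wpDl // nrm_ge0.
have [p fp Hp] := fc_approx uf (divr_gt0 e0 c1).
exists (ev (amul a) p c); last first.
  rewrite nrmBC; apply: (le_trans (Hp c)); rewrite mulrAC ler_pdivrMr //.
  by rewrite ler_wpM2l ?lerDl // ltW.
rewrite /ev; elim/big_rec: _ => // i x _ Jx; apply: JD => //.
by elim: (nat_of_ord i) => //= n IH; have [] := JM _ a IH.
Qed.

(** An even [f] is a uniform limit of polynomials in [t^2], so commutation of [b] with [a^2]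
    suffices. *)
Lemma fc_even_comm f b c : ucont f -> (forall t, `|t| <= 1 -> f (- t) = f t) ->
  (forall d, a ** (a ** (b ** d)) = b ** (a ** (a ** d))) ->
  fc f (b ** c) = b ** fc f c.
Proof.
move=> uf fe ab; apply/subr0_eq/nrm0_eq0/eqP; rewrite eq_le nrm_ge0 andbT.
apply: (@ler_eps _ _ _ (nrm (b ** c) + nrm b * nrm c)) => e e0 _.
have [p fp] := weierstrass_even uf fe e0; rewrite add0r.
have pb : ev (amul a) (p \Po 'X^2) (b ** c) = b ** ev (amul a) (p \Po 'X^2) c.
  rewrite !ev_comp_sqr // /ev (big_morph (amul b) (fun x y => amulDr x y b) (amul0r b)).
  apply: eq_bigr => i _; rewrite amulZr; congr (_ *: _).
  by elim: (nat_of_ord i) => //= n ->.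
have -> : fc f (b ** c) - b ** fc f c =
  (fc f (b ** c) - ev (amul a) (p \Po 'X^2) (b ** c))
  - b ** (fc f c - ev (amul a) (p \Po 'X^2) c).
  by rewrite pb amulBr opprB addrA subrK.
apply: (le_trans (nrmB _ _)).
have := fcP (b ** c) uf fp; have := fcP c uf fp => H1 H2.
have := nrmM b (fc f c - ev (amul a) (p \Po 'X^2) c).
have : nrm b * nrm (fc f c - ev (amul a) (p \Po 'X^2) c) <= nrm b * (e * nrm c).
  by rewrite ler_wpM2l ?nrm_ge0.
lra.
Qed.

End FunctionalCalculus.

(** * Regularised inverse squares and cutoffs *)

Section Resolvent.
Context {R : realType}.

(** A bounded substitute for [t^-2]: for nonzero [t], the product [t^2 kap e t] tends to 1 as [e]
    tends to 0. *)
Definition kap (e t : R) : R := (t ^+ 2 + e ^+ 2)^-1.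

Lemma kap_gt0 e t : 0 < e -> 0 < kap e t.
Proof. by move=> e0; rewrite invr_gt0 ltr_wpDl ?sqr_ge0 ?exprn_gt0. Qed.

Lemma kapV e t : 0 < e -> kap e t * (t ^+ 2 + e ^+ 2) = 1.
Proof.
by move=> e0; rewrite mulVf // gt_eqF // ltr_wpDl ?sqr_ge0 ?exprn_gt0.
Qed.

Lemma kap_le1 e t : 0 < e -> 0 <= e ^+ 2 * kap e t <= 1.
Proof.
move=> e0; have k0 := kap_gt0 t e0.
rewrite mulr_ge0 ?sqr_ge0 ?(ltW k0) //= -[X in _ <= X](kapV t e0) mulrDr mulrC lerDr.
by rewrite mulr_ge0 ?sqr_ge0 ?(ltW k0).
Qed.

(* AM-GM: [2 e |t| <= t ^ 2 + e ^ 2]. *)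
Lemma kap_abs_le e t : 0 < e -> 2 * e * `|t| * kap e t <= 1.
Proof.
move=> e0; have k0 := kap_gt0 t e0.
rewrite -[X in _ <= X](kapV t e0) mulrC ler_wpM2l ?(ltW k0) //.
have := sqr_ge0 (`|t| - e); rewrite sqrrB real_normK ?num_real //.
by lra.
Qed.

Lemma ucont_kap (e : R) : 0 < e -> ucont (fun t => (kap e t)%:C).
Proof.
move=> e0; pose K := (e ^+ 2)^-1.
have K0 : 0 <= K by rewrite invr_ge0 exprn_ge0 // ltW.
have kK t : kap e t <= K.
  by rewrite lef_pV2 ?posrE ?exprn_gt0 ?lerDr ?sqr_ge0 // ltr_wpDl ?sqr_ge0 ?exprn_gt0.
apply: (@ucont_lip _ _ (K * K * 2)) => s t s1 t1.
have -> : kap e s - kap e t = kap e s * kap e t * ((t + s) * (t - s)).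
  rewrite /kap; field.
  by rewrite !gt_eqF // ltr_wpDl ?sqr_ge0 ?exprn_gt0.
have k0 u : 0 <= kap e u by exact: ltW (kap_gt0 _ e0).
rewrite normrM [`|kap e s * _|]ger0_norm ?mulr_ge0 // normrM [`|t - s|]distrC mulrA.
rewrite ler_wpM2r // ler_pM ?mulr_ge0 //; first by rewrite ler_pM.
by apply: (le_trans (ler_normD _ _)); lra.
Qed.

Definition ramp (l h t : R) : R := Num.min 1 (Num.max 0 ((t - l) / (h - l))).

Lemma ramp_lo l h t : l < h -> t <= l -> ramp l h t = 0.
Proof.
move=> lh tl; rewrite /ramp max_l ?min_r //.
by rewrite ler_pdivrMr ?subr_gt0 // mul0r subr_le0.
Qed.

Lemma ramp_hi l h t : l < h -> h <= t -> ramp l h t = 1.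
Proof.
move=> lh ht; rewrite /ramp min_l // le_max; apply/orP; right.
by rewrite ler_pdivlMr ?subr_gt0 // mul1r lerD2r.
Qed.

Lemma ramp01 l h t : 0 <= ramp l h t <= 1.
Proof. by rewrite /ramp le_min ler01 le_max lexx ge_min lexx. Qed.

Lemma ramp_lip l h s t : l < h ->
  `|ramp l h s - ramp l h t| <= (h - l)^-1 * `|s - t|.
Proof.
move=> lh; have hl : 0 < (h - l)^-1 by rewrite invr_gt0 subr_gt0.
have mx (x y : R) : `|Num.max 0 x - Num.max 0 y| <= `|x - y|.
  have Hx := ler_norm (x - y); have Hy := ler_norm (y - x).
  rewrite distrC in Hy; rewrite ler_norml.
  by case: (leP 0 x) => ?; case: (leP 0 y) => ?; apply/andP; split; lra.
have mn (x y : R) : `|Num.min 1 x - Num.min 1 y| <= `|x - y|.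
  have Hx := ler_norm (x - y); have Hy := ler_norm (y - x).
  rewrite distrC in Hy; rewrite ler_norml.
  by case: (leP 1 x) => ?; case: (leP 1 y) => ?; apply/andP; split; lra.
apply: (le_trans (mn _ _)); apply: (le_trans (mx _ _)).
rewrite -mulrBl normrM mulrC [`|_^-1|]gtr0_norm //.
by rewrite opprB addrA subrK.
Qed.

End Resolvent.

Section SelfBound.
Context {R : realType} {C : cstarType R}.
Variable a : C.
Hypothesis a_star : star a = a.
Hypothesis a_lt1 : nrm a < 1.

(** For [x = f(a) a], the product [x ** star x] is [(f id)(a)] applied to [star x]. Compared with
    [fc_bound], the function [f] may be large where [t] is small. *)
Lemma fc_self_bound f m : ucont f ->
  (forall t, `|t| <= 1 -> normc (f t) * `|t| <= m) -> nrm (fc a f a) <= m.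
Proof.
move=> uf fm; set x := fc a f a.
have m0 : 0 <= m.
  by apply: le_trans (fm 0 _); rewrite ?normr0 ?mulr0.
have [->//|n0] := eqVneq (nrm x) 0.
have np : 0 < nrm x by rewrite lt_neqAle eq_sym n0 nrm_ge0.
rewrite -(ler_pM2r np) -expr2 -nrmM_star -fc_amulr // -fc_id //.
rewrite -fc_mul //; last exact: ucont_id.
rewrite -[X in _ <= _ * X]nrm_star; apply: fc_bound => //.
  exact: ucont_mul uf ucont_id.
by move=> t t1; rewrite normcM normcR fm.
Qed.

End SelfBound.

(** * Ideals and morphisms into quotients *)

Section IdealStar.
Context {R : realType} {C : cstarType R} (J : set C).
Hypothesis idJ : is_ideal J.

Lemma cideal_0 : J 0. Proof. by case: idJ. Qed.

Lemma cideal_D x y : J x -> J y -> J (x + y).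
Proof. by case: idJ => _ _ JD _ Jx Jy; have := JD 1 _ _ Jx Jy; rewrite scale1r. Qed.

Lemma cideal_Z k x : J x -> J (k *: x).
Proof. by case: idJ => _ J0 JD _ Jx; have := JD k _ _ Jx J0; rewrite addr0. Qed.

Lemma cideal_N x : J x -> J (- x).
Proof. by move=> /(@cideal_Z (-1)); rewrite scaleN1r. Qed.

Lemma cideal_B x y : J x -> J y -> J (x - y).
Proof. by move=> Jx Jy; apply: cideal_D => //; exact: cideal_N. Qed.

Lemma cideal_Ml x y : J y -> J (x ** y).
Proof. by case: idJ => _ _ _ JM Jy; have [] := JM _ x Jy. Qed.

Lemma cideal_Mr x y : J x -> J (x ** y).
Proof. by case: idJ => _ _ _ JM Jx; have [] := JM _ y Jx. Qed.

(* With [a] a multiple of [x x*], the elements [x* a^2 / (a^2 + d^2)] of [J]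
   converge to [x*]. *)
Lemma ideal_star x : J x -> J (star x).
Proof.
move=> Jx; case: (idJ) => Jcl _ _ _; apply: (closed_approx Jcl) => e e0.
pose M := nrm x ^+ 2 + 1.
have M0 : 0 < M by rewrite ltr_wpDl // exprn_ge0 // nrm_ge0.
pose a := (M^-1)%:C *: (x ** star x).
have aE : M%:C *: a = x ** star x.
  rewrite scalerA -rmorphM divff ?scale1r ?gt_eqF //.
have a_star : star a = a by rewrite starZ starM starK conjc_real.
have a_lt1 : nrm a < 1.
  rewrite nrmZ nrmM_star normcR gtr0_norm ?invr_gt0 // mulrC ltr_pdivrMr // mul1r.
  by rewrite ltrDl.
have Ja : J a by apply/cideal_Z/cideal_Mr.
(* The remainder [z = u(a) x] satisfies [|z|^2 <= M sup (u(t) |t|)], and [kap_abs_le] bounds the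
   supremum by [d / 2]; so [M d = e^2] is enough. *)
pose d := e ^+ 2 / M.
have d0 : 0 < d by rewrite divr_gt0 // exprn_gt0.
pose u t : R[i] := (d ^+ 2 * kap d t)%:C.
pose w t : R[i] := t%:C * (kap d t)%:C.
have uk := ucont_kap d0.
have uw : ucont w by exact: ucont_mul ucont_id uk.
have uu : ucont u.
  have -> : u = fun t => (d ^+ 2)%:C * (kap d t)%:C.
    by apply/funext => t; rewrite /u rmorphM.
  exact: ucont_mul (ucont_cst _) uk.
have utw t : u t + t%:C * w t = 1.
  rewrite /u /w mulrA -!rmorphM -rmorphD -expr2 -mulrDl addrC [_ * kap _ _]mulrC.
  by rewrite kapV.
pose z := fc a u x.
have xz : x - z = a ** fc a w x.
  rewrite -fc_id // -fc_mul //; last exact: ucont_id.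
  have {1}<- : fc a (fun t => u t + t%:C * w t) x = x.
    transitivity (fc a (fun=> 1) x); last by rewrite fc_cst // scale1r.
    by congr (fc _ _ _); apply/funext => t; rewrite utw.
  rewrite fc_add //; last exact: ucont_mul ucont_id uw.
  by rewrite /z addrAC subrr add0r.
exists (star (x - z)).
  by rewrite xz starM a_star; apply: cideal_Ml.
rewrite starB addrAC subrr add0r nrmN nrm_star.
rewrite -(@ler_pXn2r _ 2) ?nnegrE ?nrm_ge0 ?(ltW e0) //.
rewrite -nrmM_star /z -fc_amulr //.
have -> : x ** star (fc a u x) = star (M%:C *: fc a u a).
  by rewrite -fc_Z // aE fc_amulr // starM starK.
have u1 t : `|t| <= 1 -> normc (u t) <= 1.
  by move=> _; have /andP[u0 u1] := kap_le1 t d0; rewrite /u normcR ger0_norm.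
apply: (le_trans (fc_bound a_star a_lt1 _ uu u1)); rewrite mul1r nrm_star nrmZ.
rewrite normcR gtr0_norm // -ler_pdivlMl // mulrC -/d.
apply: fc_self_bound => // t t1.
have /andP[u0 _] := kap_le1 t d0; rewrite /u normcR ger0_norm //.
have := kap_abs_le t d0; rewrite -(ler_pM2l d0).
have := normr_ge0 t; have := kap_gt0 t d0 => k0 t0 H.
have : 0 <= d ^+ 2 * kap d t * `|t| by rewrite mulr_ge0.
by rewrite expr2 in u0 *; lra.
Qed.

End IdealStar.

Section Lifts.
Context {R : realType} {B C : cstarType R} (J : ideal C).
Variable sigma : {linear B -> quotient J}.
Hypothesis sigma_hom : star_hom sigma.

Let idJ : is_ideal J := ideal_axiom J.

(** Statements about the image of [sigma] are phrased through representatives in [C], where norms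
    and the functional calculus are available. *)
Definition lifts (b : B) (c : C) : Prop := \pi_(quotient J) c = sigma b.

Lemma pi_eqP (x y : C) :
  \pi_(quotient J) x = \pi_(quotient J) y <-> ideal_set J (x - y).
Proof.
by split=> [/eqP/quotient_eqP //|H]; apply/eqP/quotient_eqP.
Qed.

(** The involution of the quotient uses a chosen representative; another one differs by an element
    of the ideal, whose adjoint is in the ideal by [ideal_star]. *)
Lemma pi_star c : star (\pi_(quotient J) c) = \pi_(quotient J) (star c).
Proof.
apply/pi_eqP; rewrite -starB; apply: ideal_star => //.
by apply/pi_eqP; rewrite reprK.
Qed.

Lemma lifts_exists b : exists c, lifts b c.
Proof. by exists (repr (sigma b)); rewrite /lifts reprK. Qed.

Lemma lifts_D b b' c c' : lifts b c -> lifts b' c' -> lifts (b + b') (c + c').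
Proof. by rewrite /lifts !raddfD /= => -> ->. Qed.

Lemma lifts_Z k b c : lifts b c -> lifts (k *: b) (k *: c).
Proof. by rewrite /lifts linearZ => <-; rewrite -pi_scale. Qed.

Lemma lifts_N b c : lifts b c -> lifts (- b) (- c).
Proof. by move=> H; rewrite -[- b]scaleN1r -[- c]scaleN1r; apply: lifts_Z. Qed.

Lemma lifts_B b b' c c' : lifts b c -> lifts b' c' -> lifts (b - b') (c - c').
Proof. by move=> H H'; apply: lifts_D => //; apply: lifts_N. Qed.

Lemma lifts_0 : lifts 0 0.
Proof. by rewrite /lifts !raddf0. Qed.

Lemma lifts_M b b' c c' : lifts b c -> lifts b' c' -> lifts (b ** b') (c ** c').
Proof.
by case: sigma_hom => sM _; rewrite /lifts sM Defs.pi_mul => -> ->.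
Qed.

Lemma lifts_star b c : lifts b c -> lifts (star b) (star c).
Proof.
by case: sigma_hom => _ sS H; rewrite /lifts sS -H pi_star.
Qed.

Lemma lifts_ideal b c c' : lifts b c -> lifts b c' <-> ideal_set J (c - c').
Proof.
by rewrite /lifts => <-; rewrite -pi_eqP; split=> ->.
Qed.

Lemma lifts_ev a0 a p b c : lifts a0 a -> lifts b c ->
  lifts (ev (amul a0) p b) (ev (amul a) p c).
Proof.
move=> Ha; elim/poly_ind: p b c => [|p k IH] b c H.
  by rewrite !ev0; exact: lifts_0.
rewrite !ev_cons; apply: lifts_D; last exact: lifts_Z.
by apply: IH; exact: lifts_M.
Qed.

(** * Functions supported off the spectrum *)

Section Spectral.
Variables (e0 : B) (E : C).
Hypotheses (E_star : star E = E) (E_lt1 : nrm E < 1) (e0E : lifts e0 E).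

Let ucont_diff (m : R) : ucont (fun t => (m - t ^+ 2)%:C).
Proof.
apply: (@ucont_lip _ _ 2) => s t s1 t1.
have -> : m - s ^+ 2 - (m - t ^+ 2) = (t + s) * (t - s) by ring.
rewrite normrM [`|t - s|]distrC ler_wpM2r //.
by apply: (le_trans (ler_normD _ _)); lra.
Qed.

Let fc_diff m Y : fc E (fun t => (m - t ^+ 2)%:C) Y = m%:C *: Y - E ** (E ** Y).
Proof.
have pE : (fun t => (m - t ^+ 2)%:C) = (fun t : R => (m%:C%:P - 'X^2).[t%:C]).
  apply/funext => t; rewrite hornerD hornerN hornerC hornerXn.
  by rewrite rmorphB rmorphXn.
rewrite pE fc_poly //; last by rewrite -pE; exact: ucont_diff.
by rewrite evB evC evXn //; exact: amul_linear.
Qed.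

(* [m] lies outside the spectrum of [e0 ^ 2], so [m - E ^ 2] has an inverse [G]
   modulo [J]. If [f] lives where [|t ^ 2 - m| <= d] then
   [f(E) = f(E) (m - E ^ 2) ^ n G ^ n] modulo [J], which tends to [0]. *)
Lemma fc_local_ideal (m : R) : nrm e0 ^+ 2 < m ->
  exists2 d, 0 < d & forall f, ucont f ->
    (forall t, `|t| <= 1 -> f t != 0 -> `|m - t ^+ 2| <= d) ->
    forall Y, ideal_set J (fc E f Y).
Proof.
move=> em; have m0 : 0 < m by apply: le_lt_trans em; rewrite sqr_ge0.
pose s0 := e0 ** e0; pose S := E ** E.
have s0S : lifts s0 S by exact: lifts_M.
have s0m : nrm s0 <= nrm e0 ^+ 2 by rewrite expr2 nrmM.
(* The fixed point [r] solves [(m - e0^2) (1 / m + r) = 1], where splitting off [1 / m] avoids the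
   unit; the ratio is below 1 because [|e0|^2 < m]. *)
have [|//|//|//|x y _ _|r _ Hr] := @contract_fix _ B (fun=> True)
    (fun r => (m^-1)%:C *: ((m^-1)%:C *: s0 + s0 ** r)) (nrm s0 / m).
- by rewrite divr_ge0 ?nrm_ge0 ?(ltW m0) //= ltr_pdivrMr // mul1r (le_lt_trans s0m).
- rewrite -scalerBr opprD addrACA subrr add0r -amulBr nrmZ normcR.
  rewrite gtr0_norm ?invr_gt0 // [_ / m]mulrC -mulrA.
  by rewrite ler_wpM2l ?nrmM // invr_ge0 ltW.
have [W rW] := lifts_exists r.
have JW : ideal_set J (W - (m^-1)%:C *: ((m^-1)%:C *: S + S ** W)).
  apply/(lifts_ideal _ rW); rewrite -Hr; apply: lifts_Z; apply: lifts_D.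
    exact: lifts_Z.
  exact: lifts_M.
(* Left multiplication by [1 / m + W], an inverse of [m - E^2] up to [J]. *)
pose G Y := (m^-1)%:C *: Y + W ** Y.
have mm : m%:C * (m^-1)%:C = 1 by rewrite -rmorphM divff ?gt_eqF.
have JG Y : ideal_set J (fc E (fun t => (m - t ^+ 2)%:C) (G Y) - Y).
  have -> : fc E (fun t => (m - t ^+ 2)%:C) (G Y) - Y =
     (m%:C *: (W - (m^-1)%:C *: ((m^-1)%:C *: S + S ** W))) ** Y.
    rewrite scalerBr [m%:C *: (_ *: (_ + _))]scalerA mm scale1r.
    rewrite amulBl amulZl amulDl amulZl fc_diff /G !amulDr !amulZr scalerDr.
    rewrite [m%:C *: (_ *: Y)]scalerA mm scale1r /S !amulA.
    rewrite -[LHS]addrA -opprD [_ + Y]addrC opprD addrA [Y + _]addrC addrK.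
    by [].
  by apply: (cideal_Mr idJ); apply: (cideal_Z idJ).
pose K := m^-1 + nrm W.
have K0 : 0 < K by rewrite ltr_pwDl ?invr_gt0 ?nrm_ge0.
have GK Y : nrm (G Y) <= K * nrm Y.
  rewrite /G mulrDl; apply: (le_trans (nrmD _ _)).
  by rewrite lerD ?nrmM // nrmZ normcR gtr0_norm ?invr_gt0.
(* On the support of [f] the factor [m - t^2] is at most [1 / (2 K)], while [G] has norm at most
   [K]; each round halves the bound. *)
exists (2 * K)^-1; first by rewrite invr_gt0 mulr_gt0.
move=> f uf fd Y; have [M M0 fM] := ucont_bound uf.
case: (idJ) => Jcl _ _ _; apply: (closed_approx Jcl) => e e_gt0.
pose g n t := f t * (m - t ^+ 2)%:C ^+ n.
have ug n : ucont (g n) by apply: ucont_mul => //; apply/ucont_exp/ucont_diff.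
have step n : ideal_set J (fc E f Y - fc E (g n) (iter n G Y)).
  elim: n => [|n IH].
    have -> : fc E (g 0%N) (iter 0 G Y) = fc E f Y.
      by congr (fc _ _ _); apply/funext => t; rewrite /g expr0 mulr1.
    by rewrite subrr; exact: (cideal_0 idJ).
  set Z := iter n G Y in IH *.
  have -> : fc E (g n.+1) (iter n.+1 G Y) =
      fc E (g n) (fc E (fun t => (m - t ^+ 2)%:C) (G Z)).
    rewrite -fc_mul //; congr (fc _ _ _); apply/funext => t.
    by rewrite /g exprSr mulrA.
  have H := fc_ideal E_star E_lt1 idJ (ug n) (JG Z); rewrite fc_B // in H.
  by have := cideal_B idJ IH H; rewrite opprB addrA subrK.
have h01 : 0 <= (2^-1 : R) < 1 by apply/andP; split; lra.
have MY : 0 < M * nrm Y + 1 by rewrite ltr_wpDl // mulr_ge0 ?nrm_ge0.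
have [N HN] := exprn_small h01 (divr_gt0 e_gt0 MY).
exists (fc E f Y - fc E (g N) (iter N G Y)); first exact: step.
rewrite addrAC subrr add0r nrmN.
have gb t : `|t| <= 1 -> normc (g N t) <= M * (2 * K)^-1 ^+ N.
  move=> t1; rewrite /g normcM normcX normcR.
  have [->|ft] := eqVneq (f t) 0.
    by rewrite normc0 mul0r mulr_ge0 // exprn_ge0 // invr_ge0 mulr_ge0 // ltW.
  rewrite ler_pM ?normc_ge0 ?exprn_ge0 ?fM //.
  by apply: lerXn2r; rewrite ?nnegrE ?normr_ge0 ?fd // invr_ge0 mulr_ge0 // ltW.
apply: (le_trans (fc_bound E_star E_lt1 _ (ug N) gb)).
have GN : nrm (iter N G Y) <= K ^+ N * nrm Y.
  elim: (N) => [|k IH]; first by rewrite expr0 mul1r.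
  by rewrite iterS exprS -mulrA; apply: (le_trans (GK _)); rewrite ler_wpM2l // ltW.
have H1 : M * (2 * K)^-1 ^+ N * nrm (iter N G Y)
    <= M * (2 * K)^-1 ^+ N * (K ^+ N * nrm Y).
  rewrite ler_wpM2l // mulr_ge0 // exprn_ge0 // invr_ge0 mulr_ge0 // ltW //.
apply: (le_trans H1).
have -> : M * (2 * K)^-1 ^+ N * (K ^+ N * nrm Y) = 2^-1 ^+ N * (M * nrm Y).
  have KK : K^-1 ^+ N * K ^+ N = 1 by rewrite -exprMn mulVf ?gt_eqF // expr1n.
  rewrite invfM exprMn; move: KK; set u := _ ^+ N; set v := K^-1 ^+ N => KK.
  by rewrite -[RHS]mulr1 -KK; ring.
have H2 : 2^-1 ^+ N * (M * nrm Y) <= 2^-1 ^+ N * (M * nrm Y + 1).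
  by rewrite ler_wpM2l ?lerDl // exprn_ge0 // invr_ge0.
by apply: (le_trans H2); rewrite -ler_pdivlMr // HN.
Qed.

Let ucont_ramp (l h : R) : l < h -> ucont (fun t => (ramp l h (t ^+ 2))%:C).
Proof.
move=> lh; apply: (@ucont_lip _ _ ((h - l)^-1 * 2)) => s t s1 t1.
apply: (le_trans (ramp_lip _ _ lh)); rewrite -mulrA.
rewrite ler_wpM2l ?invr_ge0 ?subr_ge0 ?(ltW lh) //.
have -> : s ^+ 2 - t ^+ 2 = (s + t) * (s - t) by ring.
rewrite normrM ler_wpM2r //.
by apply: (le_trans (ler_normD _ _)); lra.
Qed.

(** [fc_local_ideal] treats supports near a single [m > |e0|^2]. A supremum argument extends this to
    [[eta^2, 1]]: [H s] concerns functions supported where [eta^2 <= t^2 <= s], and a ramp splits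
    off the part near the supremum. *)
Lemma fc_ideal_off_spectrum (eta : R) f : nrm e0 < eta -> ucont f ->
  (forall t, `|t| <= 1 -> `|t| < eta -> f t = 0) ->
  forall Y, ideal_set J (fc E f Y).
Proof.
move=> eeta uf f0 Y.
have eta0 : 0 <= eta by apply: le_trans (ltW eeta); exact: nrm_ge0.
pose m0 := eta ^+ 2.
pose H s := forall f, ucont f ->
  (forall t, `|t| <= 1 -> f t != 0 -> m0 <= t ^+ 2 <= s) ->
  forall Y, ideal_set J (fc E f Y).
have Hle s s' : H s -> s' <= s -> H s'.
  move=> Hs ss' g ug gs Z; apply: Hs => // t t1 gt.
  by have /andP[-> /le_trans->] := gs t t1 gt.
have Hlow s : s < m0 -> H s.
  move=> sm g ug gs Z.
  rewrite (@fc_ext _ _ E _ _ g (fun=> 0)) //; last 2 first.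
  - exact: ucont_cst.
  - move=> t t1; apply/eqP; apply/negPn/negP => gt.
    by have /andP[/le_trans h /h] := gs t t1 gt; rewrite leNgt sm.
  by rewrite fc_cst // scale0r; exact: (cideal_0 idJ).
have step m : m0 <= m ->
    exists2 d, 0 < d & forall s, m - d / 2 <= s -> H s -> H (m + d).
  move=> m0m; have [|d d0 Hd] := @fc_local_ideal m.
    apply: lt_le_trans m0m; rewrite /m0 ltr_pXn2r ?nnegrE ?nrm_ge0 //.
  exists d => // s ms Hs g ug gs Z.
  have lh : m - d < m - d / 2 by lra.
  pose r t := (ramp (m - d) (m - d / 2) (t ^+ 2))%:C : R[i].
  have ur : ucont r by exact: ucont_ramp.
  have ur' : ucont (fun t => 1 - r t).
    have -> : (fun t => 1 - r t) = (fun t => 1 + (-1) * r t).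
      by apply/funext => t; rewrite mulN1r.
    apply: ucont_add; first exact: ucont_cst.
    by apply: ucont_mul => //; exact: ucont_cst.
  have -> : fc E g Z = fc E (fun t => g t * r t + g t * (1 - r t)) Z.
    by congr (fc _ _ _); apply/funext => t; ring.
  rewrite fc_add //; [|exact: ucont_mul|exact: ucont_mul].
  apply: (cideal_D idJ).
    apply: Hd; first exact: ucont_mul.
    move=> t t1; rewrite mulf_eq0 negb_or => /andP[gt rt].
    have /andP[_ ts] := gs t t1 gt.
    have td : m - d < t ^+ 2.
      by rewrite ltNge; apply: contraNN rt => td; rewrite /r ramp_lo.
    by rewrite ler_norml; apply/andP; split; lra.
  apply: Hs; first exact: ucont_mul.
  move=> t t1; rewrite mulf_eq0 negb_or => /andP[gt rt].
  have /andP[-> _] := gs t t1 gt; apply: le_trans ms; apply: ltW.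
  rewrite ltNge; apply: contraNN rt => td.
  by rewrite /r ramp_hi // subrr.
pose A := [set s | s <= 1 /\ H s].
have supA : has_sup A.
  split; last by exists 1 => s [].
  (* For [s < m0] the support condition leaves only functions that vanish on [[-1, 1]]. *)
  exists (Num.min 1 (m0 - 1)); split; first by rewrite ge_min lexx.
  by apply: Hlow; rewrite gt_min; apply/orP; right; lra.
have H1 : H 1.
  have [m1|m1] := ltP 1 m0; first exact: Hlow.
  have Am s : s < m0 -> A s.
    by move=> sm; split; [exact: ltW (lt_le_trans sm m1) | exact: Hlow].
  have supm : m0 <= sup A.
    apply/ler_addgt0Pr => e e_gt0; rewrite -lerBlDr.
    by apply: (ub_le_sup supA.2); apply: Am; lra.
  have [d d0 Hd] := step _ supm.
  have d20 : 0 < d / 2 by rewrite divr_gt0.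
  have [s [s1 Hs] sups] := sup_adherent d20 supA.
  have Hsd := Hd s (ltW sups) Hs.
  have [d1|d1] := leP 1 (sup A + d); first exact: Hle Hsd d1.
  (* Otherwise [sup A + d] is an element of [A] beyond its supremum. *)
  have : sup A + d <= sup A by apply: (ub_le_sup supA.2); split => //; exact: ltW.
  by rewrite gerDl leNgt d0.
apply: H1 => // t t1 ft; rewrite -[t ^+ 2]real_normK ?num_real //.
have te : eta <= `|t|.
  by rewrite leNgt; apply: contraNN ft => te; rewrite f0.
apply/andP; split; last by rewrite exprn_ile1.
by apply: lerXn2r; rewrite ?nnegrE.
Qed.

End Spectral.
End Lifts.

Section ClosedGraph.
Context {R : realType}.

Lemma tends_star (C : cstarType R) (u : nat -> C) l :
  tends u l -> tends (fun n => star (u n)) (star l).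
Proof.
by move=> ul e /ul[N HN]; exists N => n Nn; rewrite -starB nrm_star HN.
Qed.

Lemma tends_Z (C : cstarType R) k (u : nat -> C) l :
  tends u l -> tends (fun n => k *: u n) (k *: l).
Proof.
move=> ul; apply: (tends_lip (k := normc k) ul) => n.
by rewrite -scalerBr nrmZ.
Qed.

Lemma tends_cst (C : cstarType R) (l : C) : tends (fun=> l) l.
Proof. by move=> e e0; exists 0%N => n _; rewrite subrr nrm0 ltW. Qed.

Context {B C : cstarType R} (J : ideal C).
Variable sigma : {linear B -> quotient J}.
Hypothesis sigma_hom : star_hom sigma.

Let idJ : is_ideal J := ideal_axiom J.

(* Cutting [c n] off near zero lands in [J] as soon as [b n] is small. *)
Lemma self_adjoint_limit_ideal (b : nat -> B) (c : nat -> C) l :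
  (forall n, star (c n) = c n) -> (forall n, lifts sigma (b n) (c n)) ->
  tends b 0 -> tends c l -> nrm l < 1 -> ideal_set J l.
Proof.
move=> csa bc b0 cl l1; case: (idJ) => Jcl _ _ _.
apply: (closed_approx Jcl) => e e0.
(* The cutoff is 0 up to [eta], which eventually exceeds [nrm (b n)], and 1 from [2 eta] on, so it
   moves [c n] by at most [2 eta = e / 2]. The other half of [e] pays for the distance from [c n] to
   [l]. *)
pose eta := e / 4; have eta0 : 0 < eta by rewrite divr_gt0.
have eta20 : 0 < eta / 2 by rewrite divr_gt0.
(* The second bound keeps [nrm (c n)] below 1, as the calculus requires. *)
pose d := Num.min (e / 2) ((1 - nrm l) / 2).
have d0 : 0 < d by rewrite lt_min !divr_gt0 // subr_gt0.
have [N HN] := b0 _ eta20; have [N' HN'] := cl _ d0.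
pose n := maxn N N'.
have bn : nrm (b n) < eta.
  have := HN n (leq_maxl _ _); rewrite subr0 => /le_lt_trans; apply.
  by rewrite ltr_pdivrMr // ltr_pMr // ltr1n.
have cn : nrm (c n - l) <= d by apply: HN'; exact: leq_maxr.
have cn1 : nrm (c n) < 1.
  rewrite -[c n](subrK l); apply: (le_lt_trans (nrmD _ _)).
  apply: (@le_lt_trans _ _ ((1 - nrm l) / 2 + nrm l)); last by lra.
  by rewrite lerD2r (le_trans cn) // ge_min lexx orbT.
pose f (t : R) := (ramp eta (2 * eta) `|t|)%:C : R[i].
have lh : eta < 2 * eta by lra.
have uf : ucont f.
  apply: (@ucont_lip _ _ (2 * eta - eta)^-1) => s t _ _.
  apply: (le_trans (ramp_lip _ _ lh)).
  by rewrite ler_wpM2l ?invr_ge0 ?subr_ge0 ?(ltW lh) // ler_dist_dist.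
exists (fc (c n) f (c n)).
  apply: (fc_ideal_off_spectrum sigma_hom (csa n) cn1 (bc n) bn uf) => t _ te.
  by rewrite /f ramp_lo // ltW.
have H : nrm (fc (c n) f (c n) - c n) <= 2 * eta.
  have -> : fc (c n) f (c n) - c n = fc (c n) (fun t => f t + (-1)) (c n).
    by rewrite fc_add // ?fc_cst ?scaleN1r //; exact: ucont_cst.
  apply: fc_self_bound => //.
    by apply: ucont_add => //; exact: ucont_cst.
  move=> t t1; have [te|te] := leP (2 * eta) `|t|.
    by rewrite /f ramp_hi // subrr normc0 mul0r mulr_ge0 // ltW.
  have /andP[r0 r1] := ramp01 eta (2 * eta) `|t|.
  have -> : f t + -1 = (ramp eta (2 * eta) `|t| - 1)%:C by rewrite rmorphB rmorph1.
  rewrite normcR ler0_norm ?subr_le0 // opprB.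
  apply: le_trans (ltW te); rewrite ler_piMl //.
  by rewrite gerBl.
apply: (le_trans (nrm_tri (c n) _ _)).
have : d <= e / 2 by rewrite ge_min lexx.
move: H cn; rewrite /eta; lra.
Qed.

Lemma self_adjoint_limit_ideal_scaled (b : nat -> B) (c : nat -> C) l :
  (forall n, star (c n) = c n) -> (forall n, lifts sigma (b n) (c n)) ->
  tends b 0 -> tends c l -> ideal_set J l.
Proof.
move=> csa bc b0 cl; pose k : R := (nrm l + 1)^-1.
have l1 : 0 < nrm l + 1 by rewrite ltr_wpDl // nrm_ge0.
have k0 : 0 < k by rewrite invr_gt0.
have -> : l = (k^-1)%:C *: (k%:C *: l).
  by rewrite scalerA -rmorphM mulVf ?scale1r // gt_eqF.
apply: (cideal_Z idJ).
apply: (@self_adjoint_limit_ideal (fun n => k%:C *: b n) (fun n => k%:C *: c n)).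
- by move=> n; rewrite starZ conjc_real csa.
- by move=> n; exact: lifts_Z.
- by rewrite -(scaler0 _ k%:C); exact: tends_Z.
- exact: tends_Z.
- by rewrite nrmZ normcR gtr0_norm // mulrC ltr_pdivrMr // mul1r ltrDl.
Qed.

(* A morphism into a quotient has closed graph, although no norm is given on it. *)
Lemma lifts_limit (b : nat -> B) (c : nat -> C) b0 c0 :
  (forall n, lifts sigma (b n) (c n)) ->
  tends b b0 -> tends c c0 -> lifts sigma b0 c0.
Proof.
move=> bc bb0 cc0; have [F Fb] := lifts_exists sigma b0.
apply/(lifts_ideal _ Fb).
pose x n := b n - b0; pose y n := c n - F.
have xy n : lifts sigma (x n) (y n) by exact: lifts_B.
have x0 : tends x 0 by rewrite -(subrr b0); exact: tends_add bb0 (tends_cst _).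
have yl : tends y (c0 - F) by exact: tends_add cc0 (tends_cst _).
set l := c0 - F in yl.
(* The self-adjoint case applies to [l + star l] and to ['i *: (l - star l)], from which [l] is
   recovered. *)
have Jre : ideal_set J (l + star l).
  apply: (@self_adjoint_limit_ideal_scaled
    (fun n => x n + star (x n)) (fun n => y n + star (y n))).
  - by move=> n; rewrite starD starK addrC.
  - by move=> n; apply: lifts_D => //; exact: lifts_star.
  - rewrite -(addr0 (0 : B)) -{2}(@star0 _ B); apply: tends_add => //.
    exact: tends_star.
  - by apply: tends_add => //; exact: tends_star.
have Jim : ideal_set J ('i *: (l - star l)).
  have conj_i : conjc 'i = - 'i :> R[i].
    by rewrite /conjc /= -[RHS]/(Complex _ _) oppr0.
  apply: (@self_adjoint_limit_ideal_scaled
    (fun n => 'i *: (x n + (-1) *: star (x n)))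
    (fun n => 'i *: (y n + (-1) *: star (y n)))).
  - move=> n; rewrite starZ conj_i scaleN1r starB starK scaleNr -scalerN opprB.
    by [].
  - by move=> n; apply/lifts_Z/lifts_D => //; apply/lifts_Z/lifts_star.
  - rewrite -(scaler0 _ 'i); apply: tends_Z.
    rewrite -(addr0 (0 : B)) -{2}(scaler0 _ (-1)) -{2}(@star0 _ B).
    by apply: tends_add => //; apply/tends_Z/tends_star.
  - apply: tends_Z; rewrite -[- star l]scaleN1r.
    by apply: tends_add => //; apply/tends_Z/tends_star.
have E : (2%:R^-1) *: ((l + star l) + (- 'i) *: ('i *: (l - star l))) = l.
  rewrite [(- 'i) *: _]scalerA mulNr ii_N1 opprK scale1r addrACA subrr addr0.
  by rewrite -mulr2n -[l *+ 2]scaler_nat scalerA mulVf ?scale1r // pnatr_eq0.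
rewrite -opprB -/l -E; apply: (cideal_N idJ); apply: (cideal_Z idJ).
apply: (cideal_D idJ) => //.
exact: (cideal_Z idJ).
Qed.

(** The same polynomials approximate [f] in both algebras, and for polynomials the claim is
    algebraic; the closed graph permits the passage to the limit. *)
Lemma lifts_fc (e0 : B) (E : C) f y Y :
  star e0 = e0 -> nrm e0 < 1 -> star E = E -> nrm E < 1 -> lifts sigma e0 E ->
  ucont f -> lifts sigma y Y -> lifts sigma (fc e0 f y) (fc E f Y).
Proof.
move=> e0s e01 Es E1 eE uf yY.
have inv0 n : 0 < n.+1%:R^-1 :> R by rewrite invr_gt0 ltr0n.
pose p n := sval (cid (weierstrass uf (inv0 n))).
have pP n : approx f (p n) n.+1%:R^-1 by exact: (svalP (cid (weierstrass uf (inv0 n)))).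
have conv (D : cstarType R) (a c : D) : star a = a -> nrm a < 1 ->
    tends (fun n => ev (amul a) (p n) c) (fc a f c).
  move=> a_s a1 e e_gt0.
  have c1 : 0 < nrm c + 1 by rewrite ltr_wpDl // nrm_ge0.
  have [N HN] := inv_small (divr_gt0 e_gt0 c1).
  exists N => n Nn; rewrite nrmBC; apply: (le_trans (fcP a_s a1 c uf (pP n))).
  apply: (@le_trans _ _ (n.+1%:R^-1 * (nrm c + 1))).
    by rewrite ler_wpM2l ?lerDl // ltW.
  by rewrite -ler_pdivlMr // HN.
apply: (@lifts_limit (fun n => ev (amul e0) (p n) y) (fun n => ev (amul E) (p n) Y)).
- by move=> n; exact: lifts_ev.
- exact: conv.
- exact: conv.
Qed.

End ClosedGraph.

(** * The cone over the 2x2 matrices *)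

Section EuclideanPlane.
Context {R : realType}.
Implicit Types (v w : 'cV[R[i]]_2) (A B : 'M[R[i]]_2) (k : R[i]).

Definition l2 v : R := Num.sqrt (normc (v 0 0) ^+ 2 + normc (v 1 0) ^+ 2).

Definition dot v w : R[i] := conjc (v 0 0) * w 0 0 + conjc (v 1 0) * w 1 0.

Definition adj A : 'M[R[i]]_2 := (map_mx conjc A)^T.

Lemma ord2P (Q : 'I_2 -> Prop) : Q 0 -> Q 1 -> forall i, Q i.
Proof.
move=> Q0 Q1 i; have [->|i0] := eqVneq i 0; first exact: Q0.
suff -> : i = 1 by [].
by apply/val_inj; move: i0; case: i => -[|[|]].
Qed.

Lemma mulmx2 m p (A : 'M[R[i]]_(m, 2)) (B : 'M_(2, p)) i j :
  (A *m B) i j = A i 0 * B 0 j + A i 1 * B 1 j.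
Proof.
rewrite mxE big_ord_recl big_ord1; congr (_ + A i _ * B _ j); exact/val_inj.
Qed.

Lemma l2_sqr v : l2 v ^+ 2 = normc (v 0 0) ^+ 2 + normc (v 1 0) ^+ 2.
Proof. by rewrite sqr_sqrtr // addr_ge0 ?sqr_ge0. Qed.

Lemma l2_ge0 v : 0 <= l2 v.
Proof. exact: sqrtr_ge0. Qed.

Lemma l2_le v (x : R) : 0 <= x ->
  normc (v 0 0) ^+ 2 + normc (v 1 0) ^+ 2 <= x ^+ 2 -> l2 v <= x.
Proof.
by move=> x0 H; rewrite -(@ler_pXn2r _ 2) ?nnegrE ?l2_ge0 // l2_sqr.
Qed.

Lemma l2_dot v w : normc (dot v w) <= l2 v * l2 w.
Proof.
rewrite -(@ler_pXn2r _ 2) ?nnegrE ?mulr_ge0 ?l2_ge0 ?normc_ge0 //.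
rewrite exprMn !l2_sqr.
have H : normc (dot v w)
    <= normc (v 0 0) * normc (w 0 0) + normc (v 1 0) * normc (w 1 0).
  by apply: (le_trans (normcD _ _)); rewrite !normcM !normc_conj.
apply: (@le_trans _ _
  ((normc (v 0 0) * normc (w 0 0) + normc (v 1 0) * normc (w 1 0)) ^+ 2)).
  by apply: lerXn2r H; rewrite nnegrE ?normc_ge0 // addr_ge0 ?mulr_ge0 ?normc_ge0.
(* Lagrange's identity: the two sides differ by this square. *)
have := sqr_ge0 (normc (v 0 0) * normc (w 1 0) - normc (v 1 0) * normc (w 0 0)).
lra.
Qed.

Lemma dotvv v : dot v v = (l2 v ^+ 2)%:C.
Proof. by rewrite /dot !conjc_mul_normc l2_sqr rmorphD. Qed.

Lemma dot_adj A v w : dot (A *m v) w = dot v (adj A *m w).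
Proof. by rewrite /dot /adj !mulmx2 !mxE !conjcD !conjcM; ring. Qed.

Lemma l2D v w : l2 (v + w) <= l2 v + l2 w.
Proof.
apply: l2_le; first by rewrite addr_ge0 ?l2_ge0.
have H : normc (v 0 0) * normc (w 0 0) + normc (v 1 0) * normc (w 1 0) <= l2 v * l2 w.
  rewrite -(@ler_pXn2r _ 2) ?nnegrE ?mulr_ge0 ?l2_ge0 //; last first.
    by rewrite addr_ge0 ?mulr_ge0 ?normc_ge0.
  rewrite exprMn !l2_sqr.
  have := sqr_ge0 (normc (v 0 0) * normc (w 1 0) - normc (v 1 0) * normc (w 0 0)).
  lra.
have sq i : normc ((v + w) i 0) ^+ 2 <= (normc (v i 0) + normc (w i 0)) ^+ 2.
  by rewrite mxE; apply: lerXn2r (normcD _ _); rewrite nnegrE ?addr_ge0 ?normc_ge0.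
have := l2_sqr v; have := l2_sqr w; have := sq 0; have := sq 1.
move: (normc_ge0 (v 0 0)); lra.
Qed.

Lemma l2Z k v : l2 (k *: v) = normc k * l2 v.
Proof.
apply/eqP; rewrite -(@eqrXn2 _ 2) ?mulr_ge0 ?l2_ge0 ?normc_ge0 //; apply/eqP.
by rewrite exprMn !l2_sqr !mxE !normcM; ring.
Qed.

Lemma l2_0 : l2 0 = 0.
Proof. by rewrite -(scale0r 0) l2Z normc0 mul0r. Qed.

Lemma l2_coord v i : normc (v i 0) <= l2 v.
Proof.
rewrite -(@ler_pXn2r _ 2) ?nnegrE ?l2_ge0 ?normc_ge0 // l2_sqr.
by move: i; apply: ord2P; rewrite ?lerDl ?lerDr sqr_ge0.
Qed.

Lemma l2_coord_sum v : l2 v <= normc (v 0 0) + normc (v 1 0).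
Proof.
apply: l2_le; first by rewrite addr_ge0 ?normc_ge0.
have : 0 <= normc (v 0 0) * normc (v 1 0) by rewrite mulr_ge0 ?normc_ge0.
lra.
Qed.

Lemma l2_mulmx_le A v (M : R) : (forall i j, normc (A i j) <= M) ->
  l2 (A *m v) <= 4 * M * l2 v.
Proof.
move=> AM; apply: (le_trans (l2_coord_sum _)).
have H i : normc ((A *m v) i 0) <= 2 * M * l2 v.
  rewrite mulmx2; apply: (le_trans (normcD _ _)); rewrite !normcM.
  have Hj j : normc (A i j) * normc (v j 0) <= M * l2 v.
    by rewrite ler_pM ?normc_ge0 ?l2_coord.
  by have := Hj 0; have := Hj 1; lra.
by have := H 0; have := H 1; lra.
Qed.

Lemma l2_delta j : l2 (delta_mx j 0) = 1.
Proof.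
by move: j; apply: ord2P;
  rewrite /l2 !mxE /= !(expr0n, expr1n, addr0, add0r, sqrtr0, sqrtr1) /=
    ?(expr0n, expr1n, addr0, add0r, sqrtr0, sqrtr1).
Qed.

Lemma mulmx_delta A i j : (A *m delta_mx j 0 : 'cV_2) i 0 = A i j.
Proof. by rewrite -colE mxE. Qed.

End EuclideanPlane.

Section ConeType.
Context {R : realType}.

Lemma normc_sub_le (z w : R[i]) e : `|complex.Re z - complex.Re w| <= e ->
  `|complex.Im z - complex.Im w| <= e -> normc (z - w) <= 2 * e.
Proof.
case: z w => a b [c d]; rewrite [X in normc X]complexE.
have -> : complex.Re ((a +i* b) - (c +i* d)) = a - c by [].
have -> : complex.Im ((a +i* b) - (c +i* d)) = b - d by [].
rewrite [complex.Re _]/= [complex.Re _]/= [complex.Im _]/= [complex.Im _]/= => H1 H2.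
by apply: (le_trans (normcD _ _)); rewrite normcM !normcR normc_i mul1r; lra.
Qed.

Implicit Types (F G : R -> 'M[R[i]]_2) (t : R) (i j : 'I_2).

(* Functions on [(0, 1]] vanishing at [0], extended by constants to the whole line. *)
Definition cone_prop F : Prop :=
  [/\ exists M, forall t i j, normc (F t i j) <= M,
      forall e, 0 < e -> exists2 d, 0 < d &
        forall s t, `|s - t| <= d -> forall i j, normc (F s i j - F t i j) <= e,
      forall t, t <= 0 -> F t = 0
    & forall t, 1 <= t -> F t = F 1].

Definition cone_pred : {pred (R -> 'M[R[i]]_2)} := fun F => `[< cone_prop F >].

Let cone_submod : submod_closed cone_pred.
Proof.
split.
  apply/asboolP; split => //.
  - by exists 0 => t i j; rewrite mxE normc0.
  - by move=> e e0; exists 1 => // s t _ i j; rewrite !mxE subrr normc0 ltW.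
move=> a F G /asboolP[[M FM] Fu F0 F1] /asboolP[[N GN] Gu G0 G1].
have E t i j : (a *: F + G) t i j = a * F t i j + G t i j by rewrite !mxE.
apply/asboolP; split.
- exists (normc a * M + N) => t i j; rewrite E.
  by apply: (le_trans (normcD _ _)); rewrite normcM lerD // ler_wpM2l ?normc_ge0.
- move=> e e0; have a1 : 0 < normc a + 1 by rewrite ltr_wpDl ?normc_ge0.
  have e20 : 0 < e / 2 by rewrite divr_gt0.
  have [d d0 Fd] := Fu _ (divr_gt0 e20 a1); have [k k0 Gk] := Gu _ e20.
  exists (Num.min d k); first by rewrite lt_min d0.
  move=> s t; rewrite le_min => /andP[sd sk] i j; rewrite !E.
  rewrite opprD addrACA -mulrBr; apply: (le_trans (normcD _ _)).
  rewrite (splitr e) lerD ?Gk // normcM.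
  apply: (@le_trans _ _ ((normc a + 1) * (e / 2 / (normc a + 1)))).
    by rewrite ler_pM ?normc_ge0 ?lerDl ?Fd.
  by rewrite mulrC divfK // gt_eqF.
- by move=> t t0; apply/matrixP => i j; rewrite E F0 // G0 // !mxE mulr0 addr0.
- by move=> t t1; apply/matrixP => i j; rewrite !E (F1 _ t1) (G1 _ t1).
Qed.

HB.instance Definition _ :=
  GRing.isSubmodClosed.Build R[i] (R -> 'M[R[i]]_2) cone_pred cone_submod.

Definition cone : Type := {F : R -> 'M[R[i]]_2 | cone_pred F}.

HB.instance Definition _ := Choice.on cone.
HB.instance Definition _ := SubType.on cone.
HB.instance Definition _ := [SubChoice_isSubLmodule of cone by <:].

Implicit Types x y : cone.

Lemma coneP x : cone_prop (val x).
Proof. exact/asboolP/(valP x). Qed.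

Lemma cone_ext x y : (forall t, 0 <= t <= 1 -> val x t = val y t) -> x = y.
Proof.
move=> H; apply/val_inj/funext => t.
have [_ _ x0 x1] := coneP x; have [_ _ y0 y1] := coneP y.
have [t0|t0] := leP t 0; first by rewrite x0 // y0.
have [t1|t1] := leP t 1; first by rewrite H // (ltW t0).
by rewrite x1 ?(ltW t1) // y1 ?(ltW t1) // H // ler01 lexx.
Qed.

(** Their supremum is the largest operator norm of a value; the largest modulus of an entry would
    violate the C*-identity. *)
Definition cone_vals x : set R :=
  [set r | exists t v, l2 v <= 1 /\ r = l2 (val x t *m v)].

Definition cone_norm x : R := sup (cone_vals x).

Lemma cone_vals_sup x : has_sup (cone_vals x).
Proof.
split; first by exists (l2 (val x 0 *m 0)), 0, 0; rewrite l2_0 ler01.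
have [[M xM] _ _ _] := coneP x; exists (4 * M) => r [t [v [v1 ->]]].
have M0 : 0 <= M by apply: le_trans (xM 0 0 0); rewrite normc_ge0.
apply: (le_trans (l2_mulmx_le _ (xM t))).
by rewrite ler_piMr // mulr_ge0.
Qed.

Lemma cone_norm_ge0 x : 0 <= cone_norm x.
Proof.
apply: le_trans (l2_ge0 (val x 0 *m 0)) _.
by apply: (ub_le_sup (cone_vals_sup x).2); exists 0, 0; rewrite l2_0 ler01.
Qed.

Lemma cone_norm_ub x t v : l2 (val x t *m v) <= cone_norm x * l2 v.
Proof.
have [v0|v0] := eqVneq (l2 v) 0.
  have -> : v = 0.
    apply/matrixP => i j; rewrite (ord1 j) mxE; apply/eq0_normc/eqP.
    by rewrite eq_le normc_ge0 -v0 l2_coord.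
  by rewrite mulmx0 l2_0 mulr0.
have vp : 0 < l2 v by rewrite lt_neqAle eq_sym v0 l2_ge0.
rewrite -ler_pdivrMr //; apply: (ub_le_sup (cone_vals_sup x).2).
exists t, (((l2 v)^-1)%:C *: v).
rewrite -scalemxAr !l2Z normcR gtr0_norm ?invr_gt0 // mulVf // lexx.
by split=> //; rewrite mulrC.
Qed.

Lemma cone_norm_le x (K : R) : 0 <= K ->
  (forall t v, l2 (val x t *m v) <= K * l2 v) -> cone_norm x <= K.
Proof.
move=> K0 H; apply: sup_le_ub; first by case: (cone_vals_sup x).
move=> r [t [v [v1 ->]]]; apply: (le_trans (H t v)).
by rewrite ler_piMr.
Qed.

Lemma cone_entry_le x t i j : normc (val x t i j) <= cone_norm x.
Proof.
rewrite -mulmx_delta; apply: (le_trans (l2_coord _ _)).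
by apply: (le_trans (cone_norm_ub _ _ _)); rewrite l2_delta mulr1.
Qed.

Lemma cone_norm_le_entry x (K : R) :
  (forall t, 0 <= t <= 1 -> forall i j, normc (val x t i j) <= K) ->
  cone_norm x <= 4 * K.
Proof.
move=> H; have K0 : 0 <= K.
  by apply: le_trans (H 0 _ 0 0); rewrite ?normc_ge0 ?lexx ?ler01.
have [_ _ x0 x1] := coneP x.
apply: cone_norm_le => [|t v]; first by rewrite mulr_ge0.
apply: l2_mulmx_le => i j.
have [t0|t0] := leP t 0; first by rewrite x0 // mxE normc0.
have [t1|t1] := leP t 1; first by rewrite H // (ltW t0).
by rewrite x1 ?(ltW t1) // H // ler01 lexx.
Qed.

Let normD_subproof x y : (cone_norm (x + y))%:C <= (cone_norm x)%:C + (cone_norm y)%:C.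
Proof.
rewrite -rmorphD lecR; apply: cone_norm_le => [|t v].
  by rewrite addr_ge0 ?cone_norm_ge0.
rewrite raddfD mulmxDl mulrDl; apply: (le_trans (l2D _ _)).
by rewrite lerD ?cone_norm_ub.
Qed.

Let normZ_le (a : R[i]) x : cone_norm (a *: x) <= normc a * cone_norm x.
Proof.
apply: cone_norm_le => [|t v]; first by rewrite mulr_ge0 ?normc_ge0 ?cone_norm_ge0.
rewrite linearZ -scalemxAl l2Z -mulrA ler_wpM2l ?normc_ge0 //.
exact: cone_norm_ub.
Qed.

Let normZ_subproof (a : R[i]) x : (cone_norm (a *: x))%:C = `|a| * (cone_norm x)%:C.
Proof.
rewrite normcEC -rmorphM; congr (_%:C); apply/eqP; rewrite eq_le normZ_le /=.
have [->|a0] := eqVneq a 0; first by rewrite normc0 mul0r cone_norm_ge0.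
have na : 0 < normc a.
  by rewrite lt_neqAle normc_ge0 andbT eq_sym; apply: contraNN a0 => /eqP/eq0_normc ->.
rewrite -ler_pdivlMl // -normcV -{1}[x]scale1r -(mulVf a0) -scalerA.
exact: normZ_le.
Qed.

Let norm0_subproof x : (cone_norm x)%:C = 0 -> x = 0.
Proof.
case=> x0; apply/val_inj/funext => t; apply/matrixP => i j.
rewrite raddf0 mxE; apply/eq0_normc/eqP.
by rewrite eq_le normc_ge0 andbT -x0 cone_entry_le.
Qed.

HB.instance Definition _ := Lmodule_isNormed.Build R[i] cone
  normD_subproof normZ_subproof norm0_subproof.

Lemma cone_normE x : `|x| = (cone_norm x)%:C.
Proof. by []. Qed.

Lemma cone_valB x y t i j : val (x - y) t i j = val x t i j - val y t i j.
Proof. by rewrite raddfB !mxE. Qed.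

(** The estimate for the limit has the same [e] and the same condition on [x] for every coordinate,
    so that the pointwise limits will be uniform. *)
Let coordinate_limit (phi : cone -> R) (F : set_system cone) :
  ProperFilter F -> cauchy F ->
  (forall x y, `|phi x - phi y| <= cone_norm (x - y)) ->
  exists l, forall e x, F [set y | cone_norm (x - y) <= e] -> `|l - phi x| <= e.
Proof.
move=> FF Fc phiL.
have Gc : cauchy (phi @ F).
  apply/(@cauchy_ballP R R^o) => e e0.
  have e0' : 0 < e%:C :> R[i] by rewrite ltr0c.
  move/(@cauchy_ballP R[i] cone) : Fc => /(_ _ e0') Fe.
  rewrite near_map2; apply: filterS Fe => -[x y].
  rewrite -!ball_normE /= cone_normE ltcR; exact: le_lt_trans (phiL _ _).
have /cvg_ex[l Gl] : cvg (phi @ F) by exact: cauchy_cvg Gc.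
exists l => e x Fx; apply/ler_addgt0Pr => d d0.
move/(@cvgrPdist_lt _ R^o) : Gl => /(_ d d0) Fl.
have [y [/= ly xy]] := filter_ex (filterI Fl Fx).
rewrite -[l](subrK (phi y)) -addrA; apply: (le_trans (ler_normD _ _)).
rewrite [e + d]addrC lerD //; first exact: ltW.
by rewrite distrC (le_trans (phiL _ _)).
Qed.

Let cone_complete (F : set_system cone) : ProperFilter F -> cauchy F -> cvg F.
Proof.
move=> FF Fc.
have reL t i j x y :
    `|complex.Re (val x t i j) - complex.Re (val y t i j)| <= cone_norm (x - y).
  have := normc_ge_Re (val (x - y) t i j); rewrite normcEC lecR cone_valB.
  move=> H; have -> : complex.Re (val x t i j) - complex.Re (val y t i j) =
    complex.Re (val x t i j - val y t i j) by case: (val x t i j); case: (val y t i j).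
  by apply: (le_trans H); rewrite -cone_valB cone_entry_le.
have imL t i j x y :
    `|complex.Im (val x t i j) - complex.Im (val y t i j)| <= cone_norm (x - y).
  (* The imaginary part of [z] is the real part of [- 'i * z]. *)
  have := normc_ge_Re (- 'i * val (x - y) t i j); rewrite normcEC lecR cone_valB.
  move=> H; have -> : complex.Im (val x t i j) - complex.Im (val y t i j) =
    complex.Re (- 'i * (val x t i j - val y t i j)).
    by case: (val x t i j) => a b; case: (val y t i j) => c d /=; ring.
  apply: (le_trans H); rewrite -cone_valB normcM normcN.
  by rewrite normc_i mul1r cone_entry_le.
pose re t i j := sval (cid (coordinate_limit FF Fc (reL t i j))).
pose im t i j := sval (cid (coordinate_limit FF Fc (imL t i j))).
have reP t i j := svalP (cid (coordinate_limit FF Fc (reL t i j))).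
have imP t i j := svalP (cid (coordinate_limit FF Fc (imL t i j))).
pose L t : 'M[R[i]]_2 := \matrix_(i, j) (re t i j +i* im t i j).
have LP e x : F [set y | cone_norm (x - y) <= e] -> forall t i j,
    normc (L t i j - val x t i j) <= 2 * e.
  move=> Fx t i j; rewrite mxE.
  by apply: normc_sub_le; [exact: reP Fx | exact: imP Fx].
have near_x e : 0 < e -> exists x, F [set y | cone_norm (x - y) <= e].
  move=> e0; have e0' : 0 < e%:C :> R[i] by rewrite ltr0c.
  have [x Fx] := (@cauchyP R[i] cone F FF).1 Fc _ e0'.
  exists x; apply: filterS Fx => y.
  by rewrite -ball_normE /= cone_normE ltcR => /ltW.
have LE e : 0 < e -> exists x, F [set y | cone_norm (x - y) <= e] /\
    forall t i j, normc (L t i j - val x t i j) <= 2 * e.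
  by move=> /near_x[x Fx]; exists x; split => //; exact: LP.
have Lprop : cone_prop L.
  split.
  - have [x [_ Lx]] := LE 1 ltr01; have [[M xM] _ _ _] := coneP x.
    exists (2 + M) => t i j; rewrite -[L t i j](subrK (val x t i j)).
    apply: (le_trans (normcD _ _)); rewrite lerD //.
    by apply: (le_trans (Lx t i j)); rewrite mulr1.
  (* The three differences below contribute [2 e / 5], [e / 5] and [2 e / 5]. *)
  - move=> e e0; have e50 : 0 < e / 5 by rewrite divr_gt0.
    have [x [_ Lx]] := LE _ e50; have [_ xu _ _] := coneP x.
    have [d d0 xd] := xu _ e50; exists d => // s t st i j.
    have -> : L s i j - L t i j = (L s i j - val x s i j)
      + (val x s i j - val x t i j) - (L t i j - val x t i j) by ring.
    apply: (le_trans (normcD _ _)); rewrite normcN.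
    have := normcD (L s i j - val x s i j) (val x s i j - val x t i j).
    have := xd s t st i j; have := Lx s i j; have := Lx t i j; lra.
  - move=> t t0; apply/matrixP => i j; rewrite [RHS]mxE; apply: eqc_normc => e e0.
    have e20 : 0 < e / 2 by rewrite divr_gt0.
    have [x [_ Lx]] := LE _ e20; have [_ _ x0 _] := coneP x.
    have xz : val x t i j = 0 by rewrite x0 // mxE.
    by have := Lx t i j; rewrite xz => /le_trans; apply; lra.
  - move=> t t1; apply/matrixP => i j; apply: eqc_normc => e e0.
    have e40 : 0 < e / 4 by rewrite divr_gt0.
    have [x [_ Lx]] := LE _ e40; have [_ _ _ x1] := coneP x.
    have -> : L t i j - L 1 i j =
      (L t i j - val x t i j) - (L 1 i j - val x 1 i j).
      by rewrite (x1 t t1); ring.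
    apply: (le_trans (normcD _ _)); rewrite normcN.
    by have := Lx t i j; have := Lx 1 i j; lra.
apply/cvg_ex; exists (Sub L (asboolT Lprop) : cone).
apply/cvgrPdist_lt => e e0.
have er : e = (complex.Re e)%:C by rewrite RRe_real // gtr0_real.
have e0' : 0 < complex.Re e by rewrite -ltr0c -er.
have e100 : 0 < complex.Re e / 10 by rewrite divr_gt0.
have [x [Fx Lx]] := LE _ e100.
apply: filterS Fx => y /= xy; rewrite cone_normE er ltcR.
set l : cone := Sub L _.
have lx : cone_norm (l - x) <= 4 * (2 * (complex.Re e / 10)).
  by apply: cone_norm_le_entry => t _ i j; rewrite cone_valB SubK.
have := normD_subproof (l - x) (x - y); rewrite addrA subrK -rmorphD lecR.
move=> /le_lt_trans; apply.
by move: (cone_norm (l - x)) (cone_norm (x - y)) (complex.Re e) lx xy e0' => a b c; lra.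
Qed.

HB.instance Definition _ := Uniform_isComplete.Build cone cone_complete.

Let cone_mul_subproof x y : cone_pred (fun t => val x t *m val y t).
Proof.
have [[M xM] xu x0 x1] := coneP x; have [[N yN] yu y0 y1] := coneP y.
have M0 : 0 <= M by apply: le_trans (xM 0 0 0); rewrite normc_ge0.
have N0 : 0 <= N by apply: le_trans (yN 0 0 0); rewrite normc_ge0.
apply/asboolP; split.
- exists (2 * (M * N)) => t i j; rewrite mulmx2; apply: (le_trans (normcD _ _)).
  rewrite !normcM mulr_natl mulr2n.
  by rewrite lerD // ler_pM ?normc_ge0.
- move=> e e0; have K0 : 0 < 2 * (M + N) + 1 by rewrite ltr_wpDl ?mulr_ge0 ?addr_ge0.
  have [d d0 xd] := xu _ (divr_gt0 e0 K0); have [k k0 yk] := yu _ (divr_gt0 e0 K0).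
  exists (Num.min d k); first by rewrite lt_min d0.
  move=> s t; rewrite le_min => /andP[sd sk] i j; rewrite !mulmx2.
  set E := e / _ in xd yk.
  have E0 : 0 <= E by rewrite ltW // divr_gt0.
  have term l :
      normc (val x s i l * val y s l j - val x t i l * val y t l j) <= E * (M + N).
    have -> : val x s i l * val y s l j - val x t i l * val y t l j =
      (val x s i l - val x t i l) * val y s l j
      + val x t i l * (val y s l j - val y t l j) by ring.
    apply: (le_trans (normcD _ _)); rewrite !normcM mulrDr addrC.
    by rewrite lerD // 1?[E * M]mulrC ler_pM ?normc_ge0 ?xd ?yk.
  rewrite opprD addrACA; apply: (le_trans (normcD _ _)).
  have HE : E * (2 * (M + N) + 1) = e by rewrite divfK // gt_eqF.
  by have := term 0; have := term 1; lra.
- by move=> t t0; rewrite x0 // mul0mx.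
- by move=> t t1; rewrite (x1 t t1) (y1 t t1).
Qed.

Let cone_star_subproof x : cone_pred (fun t => adj (val x t)).
Proof.
have [[M xM] xu x0 x1] := coneP x; apply/asboolP; split.
- by exists M => t i j; rewrite !mxE normc_conj.
- move=> e /xu[d d0 xd]; exists d => // s t st i j; rewrite !mxE.
  by rewrite -conjcN -conjcD normc_conj xd.
- by move=> t t0; rewrite x0 //; apply/matrixP => i j; rewrite !mxE conjc0.
- by move=> t t1; rewrite (x1 t t1).
Qed.

HB.instance Definition _ := hasMulStar.Build R cone
  (fun x y => Sub _ (cone_mul_subproof x y)) (fun x => Sub _ (cone_star_subproof x)).

Lemma val_coneM x y t : val (x ** y) t = val x t *m val y t.
Proof. by rewrite SubK. Qed.

Lemma val_cone_star x t : val (star x) t = adj (val x t).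
Proof. by rewrite SubK. Qed.

Lemma val_coneD x y t : val (x + y) t = val x t + val y t.
Proof. by rewrite raddfD. Qed.

Lemma val_coneZ (a : R[i]) x t : val (a *: x) t = a *: val x t.
Proof. by rewrite linearZ. Qed.

Lemma cone_entryD x y t i j : val (x + y) t i j = val x t i j + val y t i j.
Proof. by rewrite val_coneD mxE. Qed.

Lemma cone_entry0 t i j : val (0 : cone) t i j = 0.
Proof. by rewrite raddf0 mxE. Qed.

Lemma cone_entryZ (a : R[i]) x t i j : val (a *: x) t i j = a * val x t i j.
Proof. by rewrite val_coneZ mxE. Qed.

Lemma cone_entry_star x t i j : val (star x) t i j = conjc (val x t j i).
Proof. by rewrite val_cone_star !mxE. Qed.

Lemma cone_entryM x y t i j :
  val (x ** y) t i j = val x t i 0 * val y t 0 j + val x t i 1 * val y t 1 j.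
Proof. by rewrite val_coneM mulmx2. Qed.

Lemma adjK (A : 'M[R[i]]_2) : adj (adj A) = A.
Proof. by apply/matrixP => i j; rewrite !mxE conjcK. Qed.

Let cone_amulA : associative (@amul R cone).
Proof. by move=> x y z; apply: cone_ext => t _; rewrite !val_coneM mulmxA. Qed.

Let cone_amul_linearl (a : R[i]) x y z : (a *: x + y) ** z = a *: (x ** z) + y ** z.
Proof.
by apply: cone_ext => t _; rewrite !(val_coneM, val_coneD, val_coneZ) mulmxDl scalemxAl.
Qed.

Let cone_amul_linearr (a : R[i]) x y z : z ** (a *: x + y) = a *: (z ** x) + z ** y.
Proof.
by apply: cone_ext => t _; rewrite !(val_coneM, val_coneD, val_coneZ) mulmxDr scalemxAr.
Qed.

Let cone_starK : involutive (@star R cone).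
Proof. by move=> x; apply: cone_ext => t _; rewrite !val_cone_star adjK. Qed.

Let cone_star_antilinear (a : R[i]) x y :
  star (a *: x + y) = conjc a *: star x + star y.
Proof.
apply: cone_ext => t _; rewrite !(val_cone_star, val_coneD, val_coneZ).
by apply/matrixP => i j; rewrite !mxE conjcD conjcM.
Qed.

Let cone_starM x y : star (x ** y) = star y ** star x.
Proof.
apply: cone_ext => t _; rewrite !(val_cone_star, val_coneM); apply/matrixP => i j.
by rewrite [in RHS]mulmx2 /adj mxE mxE mulmx2 !mxE conjcD !conjcM mulrC [X in _ + X]mulrC.
Qed.

Lemma cone_normM x y : cone_norm (x ** y) <= cone_norm x * cone_norm y.
Proof.
apply: cone_norm_le => [|t v]; first by rewrite mulr_ge0 ?cone_norm_ge0.
rewrite val_coneM -mulmxA; apply: (le_trans (cone_norm_ub _ _ _)).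
by rewrite -mulrA ler_wpM2l ?cone_norm_ge0 ?cone_norm_ub.
Qed.

(** For [A = val x t], [l2 (A v) ^ 2 = dot v (adj A A v)], followed by Cauchy-Schwarz. This yields
    both the norm bound for [star x] and the harder inequality of the C*-identity. *)
Lemma l2_adj_le x t v :
  l2 (val x t *m v) ^+ 2 <= l2 v * l2 (val (star x ** x) t *m v).
Proof.
have := l2_dot v (adj (val x t) *m (val x t *m v)).
rewrite -dot_adj dotvv normcR ger0_norm ?sqr_ge0 // mulmxA.
by rewrite val_coneM val_cone_star.
Qed.

Lemma cone_norm_star_le x : cone_norm (star x) <= cone_norm x.
Proof.
apply: cone_norm_le => [|t v]; first exact: cone_norm_ge0.
have [z|z] := eqVneq (l2 (val (star x) t *m v)) 0.
  by rewrite z mulr_ge0 ?cone_norm_ge0 ?l2_ge0.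
have zp : 0 < l2 (val (star x) t *m v) by rewrite lt_neqAle eq_sym z l2_ge0.
rewrite -(ler_pM2r zp) -expr2; apply: (le_trans (l2_adj_le _ _ _)).
rewrite cone_starK val_coneM -mulmxA mulrAC [X in _ <= X]mulrC.
by rewrite ler_wpM2l ?l2_ge0 // cone_norm_ub.
Qed.

Let cone_normM_le x y : `|x ** y| <= `|x| * `|y|.
Proof. by rewrite !cone_normE -rmorphM lecR cone_normM. Qed.

Let cone_norm_cstar x : `|star x ** x| = `|x| ^+ 2.
Proof.
rewrite !cone_normE -rmorphXn; congr (_%:C); apply/eqP; rewrite eq_le; apply/andP; split.
  apply: (le_trans (cone_normM _ _)).
  by rewrite expr2 ler_wpM2r ?cone_norm_ge0 ?cone_norm_star_le.
set K := cone_norm (star x ** x); have K0 : 0 <= K by exact: cone_norm_ge0.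
rewrite -(sqr_sqrtr K0); apply: lerXn2r; rewrite ?nnegrE ?cone_norm_ge0 ?sqrtr_ge0 //.
apply: cone_norm_le => [|t v]; first exact: sqrtr_ge0.
rewrite -(@ler_pXn2r _ 2) ?nnegrE ?mulr_ge0 ?l2_ge0 ?sqrtr_ge0 //.
apply: (le_trans (l2_adj_le _ _ _)).
rewrite exprMn sqr_sqrtr // expr2 mulrCA ler_wpM2l ?l2_ge0 //.
exact: cone_norm_ub.
Qed.

HB.instance Definition _ := isCstar.Build R cone
  cone_amulA cone_amul_linearl cone_amul_linearr cone_starK
  cone_star_antilinear cone_starM cone_normM_le cone_norm_cstar.

Lemma nrm_cone x : nrm x = cone_norm x.
Proof. by []. Qed.

End ConeType.

Section ConeElements.
Context {R : realType}.
Implicit Types (x y e : cone (R := R)) (t : R) (i j : 'I_2).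

(** Precomposition with [ramp 0 1], the retraction of the line onto [[0, 1]], provides the constant
    extensions that [cone_prop] asks for. *)
Lemma cone_mk (g : 'I_2 -> 'I_2 -> R -> R[i]) :
  (forall i j, ucont (g i j)) -> (forall i j, g i j 0 = 0) ->
  exists x : cone (R := R), forall t, 0 <= t <= 1 -> forall i j, val x t i j = g i j t.
Proof.
move=> ug g0; pose F t : 'M[R[i]]_2 := \matrix_(i, j) g i j (ramp 0 1 t).
have lt01 : 0 < 1 :> R by exact: ltr01.
have c1 t : `|ramp 0 1 t| <= 1.
  by have /andP[c0 c1] := ramp01 0 1 t; rewrite ger0_norm.
have Fprop : cone_prop F.
  split.
  - have [M00 _ H00] := ucont_bound (ug 0 0); have [M01 _ H01] := ucont_bound (ug 0 1).
    have [M10 _ H10] := ucont_bound (ug 1 0); have [M11 _ H11] := ucont_bound (ug 1 1).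
    exists (Num.max (Num.max M00 M01) (Num.max M10 M11)) => t i j; rewrite mxE !le_max.
    by move: i j; apply: ord2P; apply: ord2P; rewrite ?H00 ?H01 ?H10 ?H11 ?orbT.
  - move=> e e0.
    have [_ /(_ e e0)[d00 p00 H00]] := ug 0 0; have [_ /(_ e e0)[d01 p01 H01]] := ug 0 1.
    have [_ /(_ e e0)[d10 p10 H10]] := ug 1 0; have [_ /(_ e e0)[d11 p11 H11]] := ug 1 1.
    exists (Num.min (Num.min d00 d01) (Num.min d10 d11)).
      by rewrite !lt_min p00 p01 p10 p11.
    move=> s t; rewrite !le_min => /andP[/andP[s00 s01] /andP[s10 s11]].
    have cl : `|ramp 0 1 s - ramp 0 1 t| <= `|s - t|.
      by apply: (le_trans (ramp_lip s t lt01)); rewrite subr0 invr1 mul1r.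
    have cs d : `|s - t| <= d -> `|ramp 0 1 s - ramp 0 1 t| <= d by exact: le_trans.
    by apply: ord2P; apply: ord2P; rewrite !mxE ?H00 ?H01 ?H10 ?H11 ?cs.
  - by move=> t t0; apply/matrixP => i j; rewrite !mxE ramp_lo // g0.
  - by move=> t t1; apply/matrixP => i j; rewrite !mxE !ramp_hi.
exists (Sub F (asboolT Fprop)) => t /andP[t0 t1] i j; rewrite SubK mxE; congr (g i j _).
by rewrite /ramp !subr0 divr1 max_r // min_r.
Qed.

Lemma cone_at0 x : val x 0 = 0.
Proof. by have [_ _ H _] := coneP x; apply: H. Qed.

(** The absolute value makes the entry an even function on [[-1, 1]]. Division by [m] accounts for a
    generator [m t e_10], for which [|Z|] is [m t]. *)
Lemma cone_entry_ucont x i j (m : R) : 0 < m -> ucont (fun t => val x (`|t| / m) i j).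
Proof.
move=> m0; have [[M xM] xu _ _] := coneP x; split; first by exists M.
move=> e /xu[d d0 xd]; exists (d * m); first by rewrite mulr_gt0.
move=> s t _ _ st; apply: xd; rewrite -mulrBl normrM [`|m^-1|]gtr0_norm ?invr_gt0 //.
by rewrite ler_pdivrMr // (le_trans (ler_dist_dist _ _)).
Qed.

Let entry_approx (x w y : cone (R := R)) t i j (fs c : R[i]) (d : R) :
  normc (fs - c) <= d -> nrm (x - w) <= d * nrm y ->
  val w t i j = c * val y t i j ->
  normc (val x t i j - fs * val y t i j) <= 2 * d * nrm y.
Proof.
move=> H1 H2 wE.
have -> : val x t i j - fs * val y t i j =
    val (x - w) t i j - (fs - c) * val y t i j.
  by rewrite cone_valB wE; ring.
apply: (le_trans (normcD _ _)); rewrite normcN normcM.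
have H3 : normc (val (x - w) t i j) <= d * nrm y.
  exact: le_trans (cone_entry_le _ _ _ _) H2.
have H4 : normc (fs - c) * normc (val y t i j) <= d * nrm y.
  by apply: ler_pM H1 (cone_entry_le _ _ _ _); exact: normc_ge0.
by apply: (le_trans (lerD H3 H4)); rewrite -mulrA mulr_natl mulr2n.
Qed.

Let entry_limit (x y : cone (R := R)) t i j (fs : R[i]) :
  (forall d : R, 0 < d -> exists w c, [/\ normc (fs - c) <= d,
     nrm (x - w) <= d * nrm y & val w t i j = c * val y t i j]) ->
  val x t i j = fs * val y t i j.
Proof.
move=> H; apply: eqc_normc => e e0.
have y1 : 0 < 2 * nrm y + 1 by rewrite ltr_wpDl // mulr_ge0 ?nrm_ge0.
have [w [c [H1 H2 H3]]] := H _ (divr_gt0 e0 y1).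
apply: (le_trans (entry_approx H1 H2 H3)).
rewrite mulrAC mulrC mulrAC ler_pdivrMr // ler_wpM2l ?(ltW e0) //.
by rewrite lerDl.
Qed.

Lemma cone_fc_entry e f y t i j (s : R) : star e = e -> nrm e < 1 -> ucont f ->
  `|s| <= 1 -> (forall z, val (e ** z) t i j = s%:C * val z t i j) ->
  val (fc e f y) t i j = f s * val y t i j.
Proof.
move=> es e1 uf s1 He; apply: entry_limit => d d0.
have [p fp Hp] := fc_approx es e1 uf d0.
exists (ev (amul e) p y), p.[s%:C]; split; [exact: fp|exact: Hp|].
elim/poly_ind: p {fp Hp} => [|p k IH]; first by rewrite ev0 horner0 mul0r cone_entry0.
rewrite hornerMXaddC evD evXM; last exact: amul_linear.
by rewrite evC cone_entryD cone_entryZ He IH; ring.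
Qed.

(** Meant for [e = x + star x], which is off-diagonal with scalar square: it mixes entries, and only
    [e^2] acts on one of them as a number. *)
Lemma cone_fc_entry_even e f y t i j (s : R) : star e = e -> nrm e < 1 -> ucont f ->
  (forall t, `|t| <= 1 -> f (- t) = f t) -> `|s| <= 1 ->
  (forall z, val (e ** (e ** z)) t i j = (s ^+ 2)%:C * val z t i j) ->
  val (fc e f y) t i j = f s * val y t i j.
Proof.
move=> es e1 uf fe s1 He; apply: entry_limit => d d0.
have [p fp] := weierstrass_even uf fe d0.
exists (ev (amul e) (p \Po 'X^2) y), (p \Po 'X^2).[s%:C].
split; [exact: fp | exact: (fcP es e1 y uf fp)|].
rewrite ev_comp_sqr; last exact: amul_linear.
rewrite horner_comp hornerXn -rmorphXn /=; set T := fun x => _.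
have Tlin : linear T by move=> k a b; rewrite /T !amul_linearr.
elim/poly_ind: p {fp} => [|p k IH]; first by rewrite ev0 horner0 mul0r cone_entry0.
rewrite hornerMXaddC evD evXM // evC cone_entryD cone_entryZ.
by rewrite /T He IH; ring.
Qed.

End ConeElements.

(** * Morphisms from the cone *)

Section MatrixUnits.
Context {R : realType} {C : cstarType R}.
Variable X : C.
Hypothesis XX0 : X ** X = 0.

Let Z := X + star X.
Hypothesis Z_lt1 : nrm Z < 1.

Implicit Types (f g : R -> R[i]) (c d : C) (i j k l : 'I_2).

Definition even f := forall t : R, `|t| <= 1 -> f (- t) = f t.

Let Z_star : star Z = Z.
Proof. by rewrite /Z starD starK addrC. Qed.

Let SS0 : star X ** star X = 0.
Proof. by rewrite -starM XX0 star0. Qed.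

Let ZZE c : Z ** (Z ** c) = X ** (star X ** c) + star X ** (X ** c).
Proof.
rewrite /Z !amulDl !amulDr !amulA XX0 SS0 !amul0l add0r addr0 addrC.
by rewrite addrC.
Qed.

Let XXc c : X ** (X ** c) = 0. Proof. by rewrite amulA XX0 amul0l. Qed.
Let SSc c : star X ** (star X ** c) = 0. Proof. by rewrite amulA SS0 amul0l. Qed.

(** If [X] is [t e_10], these are [t^2 e_ij] on the diagonal and [t e_ij] off it; [weight] supplies
    the missing factor. *)
Definition preunit i j : C :=
  if i == 0 then if j == 0 then star X ** X else star X
  else if j == 0 then X else X ** star X.

Let commW i j d : Z ** (Z ** (preunit i j ** d)) = preunit i j ** (Z ** (Z ** d)).
Proof.
rewrite !ZZE; move: i j; apply: ord2P; apply: ord2P; rewrite /preunit /=.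
all: by rewrite -?amulA ?amulDr -?amulA ?XXc ?SSc ?amul0r ?addr0 ?add0r
  ?XXc ?SSc ?amul0r ?addr0 ?add0r.
Qed.

Lemma fc_preunit f i j d : ucont f -> even f ->
  fc Z f (preunit i j ** d) = preunit i j ** fc Z f d.
Proof. by move=> uf fe; apply: fc_even_comm. Qed.

Let habs (t : R) : R[i] := `|t|%:C.

Let uabs : ucont habs.
Proof. by apply: (@ucont_lip _ _ 1) => s t _ _; rewrite mul1r ler_dist_dist. Qed.

Let eabs : even habs.
Proof. by move=> t _; rewrite /habs normrN. Qed.

Definition weight i j : R -> R[i] := if i == j then fun=> 1 else fun t => `|t|%:C.

Let uw i j : ucont (weight i j).
Proof. by rewrite /weight; case: ifP => _ //; exact: ucont_cst. Qed.

Let ew i j : even (weight i j).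
Proof. by rewrite /weight; case: ifP => _; [| exact: eabs]. Qed.

(* If [X] is [t e_10] then [munit i j] is [t ^ 2 e_ij]. *)
Definition munit i j : C := fc (X + star X) (weight i j) (preunit i j).

Let sq (t : R) : R[i] := (t ^+ 2)%:C.

Let usq : ucont sq.
Proof.
have -> : sq = (fun t : R => t%:C ^+ 2) by apply/funext => t; rewrite /sq rmorphXn.
exact/ucont_exp/ucont_id.
Qed.

Let fc_sq c : fc Z sq c = Z ** (Z ** c).
Proof.
have -> : sq = (fun t : R => t%:C * t%:C) by apply/funext => t; rewrite /sq rmorphM.
by rewrite fc_mul // ?fc_id //; exact: ucont_id.
Qed.

Let WW i j k l : j != k -> preunit i j ** preunit k l = 0.
Proof.
move: i j k l; do 4! apply: ord2P; rewrite /preunit //= => _;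
  by rewrite -?amulA ?XXc ?SSc ?XX0 ?SS0 ?amul0r.
Qed.

Lemma fc_C f g c : ucont f -> ucont g -> fc Z f (fc Z g c) = fc Z g (fc Z f c).
Proof.
move=> uf ug; rewrite -!fc_mul //; congr (fc _ _ _).
by apply/funext => t; rewrite mulrC.
Qed.

Lemma fc_munit f i j d : ucont f -> even f ->
  fc Z f (munit i j ** d) = munit i j ** fc Z f d.
Proof.
by move=> uf fe; rewrite /munit -!fc_amulr // fc_C // fc_preunit.
Qed.

Lemma munitM_neq i j k l : j != k -> munit i j ** munit k l = 0.
Proof.
move=> jk; rewrite /munit -fc_amulr //.
by rewrite -fc_preunit // WW // !fc_0.
Qed.

Let WWs i j l : preunit i j ** preunit j l =
  fc Z (if (i == j) || (j == l) then sq else fun=> 1) (preunit i l).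
Proof.
move: i j l; do 3! apply: ord2P; rewrite /preunit /= ?fc_sq ?ZZE ?fc_cst ?scale1r //.
all: by rewrite -?amulA ?XX0 ?SS0 ?XXc ?SSc ?amul0r ?addr0 ?add0r
  ?XXc ?SSc ?amul0r ?addr0 ?add0r.
Qed.

(** Products of preunits carry the factor [Z^2] or 1 according to the indices, by [WWs]; the weights
    even this out to a uniform [t^2]. *)
Lemma munitM i j l : munit i j ** munit j l = fc Z sq (munit i l).
Proof.
have us : ucont (if (i == j) || (j == l) then sq else fun=> 1).
  by case: ifP => _ //; exact: ucont_cst.
set s := if _ then _ else _ in us.
have H1 c : fc Z (weight i j) (fc Z (weight j l) (fc Z s c)) =
    fc Z (fun t => weight i j t * (weight j l t * s t)) c.
  by rewrite !fc_mul //; exact: ucont_mul.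
rewrite /munit -fc_amulr // -fc_preunit // WWs H1 -fc_mul // /s.
congr (fc _ _ _); apply/funext => t; rewrite /weight /sq /habs.
have tt : `|t|%:C * `|t|%:C = (t ^+ 2)%:C :> R[i].
  by rewrite -rmorphM -expr2 real_normK ?num_real.
by move: i j l @s {us H1}; do 3! apply: ord2P => /=; rewrite ?mul1r ?mulr1 ?tt // mulrC.
Qed.

(** Tested against [d] on the right, the left-hand side becomes [star c] times [conj(f)(Z) d], and
    evenness allows [conj(f)(Z)] to move across [star c]. *)
Lemma fc_star_even f c : ucont f -> even f ->
  (forall d, Z ** (Z ** (c ** d)) = c ** (Z ** (Z ** d))) ->
  (forall d, Z ** (Z ** (star c ** d)) = star c ** (Z ** (Z ** d))) ->
  star (fc Z f c) = fc Z (fun t => conjc (f t)) (star c).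
Proof.
move=> uf fe Hc Hs; apply: amul_cancel => d.
rewrite fc_adj // -fc_amulr; first last.
- exact: ucont_conj.
- exact: Z_lt1.
- exact: Z_star.
rewrite (fc_even_comm _ _ _ (b := star c)) //; first exact: ucont_conj.
by move=> t t1; rewrite fe.
Qed.

Lemma preunit_star i j : star (preunit i j) = preunit j i.
Proof. by move: i j; do 2! apply: ord2P; rewrite /preunit /= ?starM ?starK. Qed.

Lemma munit_star i j : star (munit i j) = munit j i.
Proof.
rewrite /munit fc_star_even //; last by move=> d; rewrite preunit_star commW.
rewrite preunit_star; congr (fc _ _ _); apply/funext => t.
rewrite /weight eq_sym; case: ifP => _; first by rewrite conjc_1.
by rewrite /habs conjc_real.
Qed.

Let commU i j d : Z ** (Z ** (munit i j ** d)) = munit i j ** (Z ** (Z ** d)).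
Proof. by rewrite -!fc_sq fc_munit // => t _; rewrite /sq sqrrN. Qed.

Lemma fc_munit_star f i j : ucont f -> even f ->
  star (fc Z f (munit i j)) = fc Z (fun t => conjc (f t)) (munit j i).
Proof.
move=> uf fe; by rewrite fc_star_even ?munit_star // => d; rewrite ?munit_star commU.
Qed.

Lemma fc_munitM f g i j k l : ucont f -> ucont g -> even g ->
  fc Z f (munit i j) ** fc Z g (munit k l) =
  if j == k then fc Z (fun t => f t * g t * sq t) (munit i l) else 0.
Proof.
move=> uf ug ge; rewrite -fc_amulr // -fc_munit //.
case: eqVneq => [<-|jk]; last by rewrite munitM_neq // !fc_0.
have ufg : ucont (fun t => f t * g t) by exact: ucont_mul.
by rewrite munitM (fc_mul _ _ _ ufg) // fc_mul.
Qed.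

Let munit_sum c : munit 0 0 ** c + munit 1 1 ** c = fc Z sq c.
Proof.
rewrite fc_sq /munit /weight /= !fc_cst // !scale1r ZZE /preunit /= -!amulA.
by rewrite addrC.
Qed.

(** [munit 0 0 + munit 1 1] acts as [Z^2], and only its [i]-th summand sees [star x]. Hence
    [x ** star x] is [(g t^2)(Z)] applied to [star x], and [|x|^2 <= B |x|]. The factor [t^2] in the
    bound is what lets [g] grow like [t^-2]. *)
Lemma nrm_fc_munit_diag g i (B : R) : ucont g -> even g ->
  (forall t : R, `|t| <= 1 -> normc (g t) * t ^+ 2 <= B) ->
  nrm (fc Z g (munit i i)) <= B.
Proof.
move=> ug ge gB; set x := fc Z g _.
have B0 : 0 <= B by apply: le_trans (gB 0 _); rewrite ?normr0 ?expr0n ?mulr0.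
have [->//|n0] := eqVneq (nrm x) 0.
have np : 0 < nrm x by rewrite lt_neqAle eq_sym n0 nrm_ge0.
have xs : star x = fc Z (fun t => conjc (g t)) (munit i i) by rewrite fc_munit_star.
have ug' : ucont (fun t => conjc (g t)) by exact: ucont_conj.
have ge' : even (fun t => conjc (g t)) by move=> t t1; rewrite ge.
have Hk k : k != i -> munit k k ** star x = 0.
  by move=> ki; rewrite xs -fc_munit // munitM_neq // fc_0.
have Hs : munit 0 0 ** star x + munit 1 1 ** star x = munit i i ** star x.
  have [Ei|Ei] : i = 0 \/ i = 1 by move: (i); apply: ord2P; [left | right].
    by rewrite (Hk 1) ?Ei // addr0.
  by rewrite (Hk 0) ?Ei // add0r.
have E : x ** star x = fc Z (fun t => g t * sq t) (star x).
  by rewrite fc_mul // -munit_sum Hs -fc_amulr.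
rewrite -(ler_pM2r np) -expr2 -nrmM_star E -[X in _ <= _ * X]nrm_star.
apply: fc_bound => //; first exact: ucont_mul.
by move=> t t1; rewrite normcM normcR ger0_norm ?sqr_ge0 // gB.
Qed.

(** The product of the element with its adjoint is diagonal, with function [|g|^2 t^2]; the
    C*-identity reduces the claim to the diagonal case with bound [B^2]. *)
Lemma nrm_fc_munit g i j (B : R) : ucont g -> even g ->
  (forall t : R, `|t| <= 1 -> normc (g t) * t ^+ 2 <= B) ->
  nrm (fc Z g (munit i j)) <= B.
Proof.
move=> ug ge gB.
have B0 : 0 <= B by apply: le_trans (gB 0 _); rewrite ?normr0 ?expr0n ?mulr0.
have ug' : ucont (fun t => conjc (g t)) by exact: ucont_conj.
have ge' : even (fun t => conjc (g t)) by move=> t t1; rewrite ge.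
rewrite -(@ler_pXn2r _ 2) ?nnegrE ?nrm_ge0 // -nrmM_star.
rewrite fc_munit_star // fc_munitM // eqxx.
apply: nrm_fc_munit_diag.
- by apply: ucont_mul => //; exact: ucont_mul.
- by move=> t t1; rewrite /sq sqrrN ge.
move=> t t1; have := gB t t1; rewrite !normcM normc_conj normcR ger0_norm ?sqr_ge0 //.
move=> H; rewrite (_ : _ * _ = (normc (g t) * t ^+ 2) ^+ 2); last by ring.
by apply: lerXn2r H; rewrite nnegrE // mulr_ge0 ?normc_ge0 ?sqr_ge0.
Qed.

End MatrixUnits.

(** * The morphism attached to an element of square zero *)

Section Extension.
Context {R : realType} {C : cstarType R}.
Variables (X : C) (m : R).
Hypothesis XX0 : X ** X = 0.
Hypothesis Z_lt1 : nrm (X + star X) < 1.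
Hypothesis m0 : 0 < m.
Implicit Types (F G : cone (R := R)) (n : nat) (i j : 'I_2) (t : R).

Let Z := X + star X.
Let Z_star : star Z = Z.
Proof. by rewrite /Z starD starK addrC. Qed.

Let eps n : R := n.+1%:R^-1.
Let eps_gt0 n : 0 < eps n.
Proof. by rewrite invr_gt0 ltr0n. Qed.

Let ent F i j t : R[i] := val F (`|t| / m) i j.
Let kp n t : R[i] := (kap (eps n) t)%:C.

Definition cut F i j n t : R[i] := val F (`|t| / m) i j * (kap n.+1%:R^-1 t)%:C.

Let u_ent F i j : ucont (ent F i j). Proof. exact: cone_entry_ucont. Qed.
Let u_kp n : ucont (kp n). Proof. exact: ucont_kap. Qed.
Lemma ucont_cut F i j n : ucont (cut F i j n).
Proof. exact: ucont_mul (u_ent F i j) (u_kp n). Qed.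

Lemma cut_even F i j n : even (cut F i j n).
Proof. by move=> t _; rewrite /cut /kap normrN sqrrN. Qed.

Let u_cut := ucont_cut.
Let e_cut := cut_even.

(** The relative error of [kap] as a substitute for [t^-2]; it governs the estimates for [psi]. *)
Let theta n t : R := 1 - kap (eps n) t * t ^+ 2.

Let thetaE n t : theta n t = eps n ^+ 2 * kap (eps n) t.
Proof.
rewrite /theta -{1}(kapV t (eps_gt0 n)) mulrDr addrAC subrr add0r.
by rewrite mulrC.
Qed.

Let theta01 n t : 0 <= theta n t <= 1.
Proof. by rewrite thetaE kap_le1. Qed.

Let kap_sq_le1 n t : 0 <= kap (eps n) t * t ^+ 2 <= 1.
Proof.
have /andP[h0 h1] := theta01 n t.
by apply/andP; split; rewrite /theta in h0 h1; lra.
Qed.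

(* Elements of the cone vanish at [0], the only place where [t ^ 2 kap] is far
   from [1]. *)
Lemma entry_cut F i j (e : R) : 0 < e -> exists N, forall n, (N <= n)%N ->
  forall t, normc (val F (`|t| / m) i j) * (1 - kap n.+1%:R^-1 t * t ^+ 2) <= e.
Proof.
move=> e0; have [[M FM] Fu _ _] := coneP F; have [d d0 Fd] := Fu e e0.
have M0 : 0 <= M by apply: le_trans (FM 0 0 0); rewrite normc_ge0.
have md : 0 < m * d by rewrite mulr_gt0.
(* For [|t| > m d] one has [theta n t <= eps n / (m d)^2], and [eps n <= K] makes [M + 1] times this
   at most [e]. For smaller [|t|] the entry itself is at most [e]. *)
pose K := e * (m * d) ^+ 2 / (M + 1).
have K0 : 0 < K by rewrite divr_gt0 ?mulr_gt0 ?exprn_gt0 // ltr_wpDl.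
have [N HN] := inv_small K0; exists N => n Nn t.
have /andP[h0 h1] := theta01 n t; rewrite -/(theta n t).
have [td|td] := leP (`|t| / m) d.
  have := Fd (`|t| / m) 0; rewrite subr0 ger0_norm ?divr_ge0 ?(ltW m0) //.
  move=> /(_ td i j); rewrite cone_at0 [X in _ - X]mxE subr0 => H.
  apply: (@le_trans _ _ (e * 1)); last by rewrite mulr1.
  by apply: ler_pM => //; exact: normc_ge0.
have tmd : m * d < `|t| by rewrite mulrC -ltr_pdivlMr.
have t20 : 0 < t ^+ 2 by rewrite -real_normK ?num_real // exprn_gt0 // (lt_trans md).
have en1 : eps n <= 1 by rewrite invf_le1 ?ltr0n // ler1n.
have Hth : theta n t * (m * d) ^+ 2 <= eps n.
  apply: (@le_trans _ _ (theta n t * t ^+ 2)).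
    rewrite ler_wpM2l // -[t ^+ 2]real_normK ?num_real //.
    by apply: lerXn2r (ltW tmd); rewrite nnegrE ?normr_ge0 // ltW.
  rewrite thetaE -mulrA; apply: (@le_trans _ _ (eps n ^+ 2 * 1)).
    have /andP[_ k1] := kap_sq_le1 n t.
    by apply: ler_wpM2l => //; rewrite exprn_ge0 // ltW.
  by rewrite mulr1 expr2 ler_piMr // ltW.
have H1 : normc (val F (`|t| / m) i j) * theta n t <= (M + 1) * theta n t.
  by apply: ler_wpM2r => //; rewrite (le_trans (FM _ _ _)) // lerDl.
apply: (le_trans H1).
have md2 : 0 < (m * d) ^+ 2 by rewrite exprn_gt0.
rewrite -(ler_pM2r md2) -mulrA.
apply: (@le_trans _ _ ((M + 1) * K)).
  rewrite ler_wpM2l ?addr_ge0 // (le_trans Hth) //; exact: HN.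
by rewrite /K mulrC divfK // gt_eqF // ltr_wpDl.
Qed.

Let entry_cut_all F (e : R) : 0 < e -> exists N, forall n, (N <= n)%N ->
  forall i j t, normc (ent F i j t) * theta n t <= e.
Proof.
move=> e0; have [N00 H00] := entry_cut F 0 0 e0; have [N01 H01] := entry_cut F 0 1 e0.
have [N10 H10] := entry_cut F 1 0 e0; have [N11 H11] := entry_cut F 1 1 e0.
exists (maxn (maxn N00 N01) (maxn N10 N11)) => n.
rewrite !geq_max => /andP[/andP[n00 n01] /andP[n10 n11]].
by apply: ord2P; apply: ord2P => t;
  [exact: H00 | exact: H01 | exact: H10 | exact: H11].
Qed.

Definition psi_term F n i j : C :=
  fc (X + star X) (cut F i j n) (munit X i j).

(* Approximates [sum F_ij(t / m) e_ij], the unit [e_ij] being [munit i j / t ^ 2]. *)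
Definition psi_approx F n : C :=
  psi_term F n 0 0 + psi_term F n 0 1 + (psi_term F n 1 0 + psi_term F n 1 1).

Let sum4_le (a b c d : C) (e : R) : nrm a <= e -> nrm b <= e -> nrm c <= e ->
  nrm d <= e -> nrm (a + b + (c + d)) <= 4 * e.
Proof.
move=> ha hb hc hd; have := nrmD (a + b) (c + d); have := nrmD a b; have := nrmD c d.
lra.
Qed.

Let sum4B (a b c d a' b' c' d' : C) :
  a + b + (c + d) - (a' + b' + (c' + d')) = (a - a') + (b - b') + ((c - c') + (d - d')).
Proof. by rewrite opprD addrACA; congr (_ + _); rewrite opprD addrACA. Qed.

Lemma psi_cauchy F (e : R) : 0 < e -> exists N : nat, forall n k : nat,
  (N <= n)%N -> (N <= k)%N -> nrm (psi_approx F n - psi_approx F k) <= e.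
Proof.
move=> e0; have e80 : 0 < e / 8 by rewrite divr_gt0.
have [N HN] := entry_cut_all F e80; exists N => n k Nn Nk.
have term i j : nrm (psi_term F n i j - psi_term F k i j) <= e / 4.
  rewrite /psi_term -fc_sub //; apply: nrm_fc_munit => //.
  - exact: ucont_sub.
  - by move=> t t1; rewrite !e_cut.
  move=> t t1.
  (* Multiplied by [t^2], the difference becomes the entry of [F] times [theta k - theta n]. *)
  have -> : cut F i j n t - cut F i j k t =
      ent F i j t * (kap (eps n) t - kap (eps k) t)%:C.
    by rewrite /cut rmorphB mulrBr.
  rewrite normcM normcR -mulrA.
  rewrite -[X in _ * X]ger0_norm; last by rewrite mulr_ge0 ?sqr_ge0.
  rewrite normrM normr_id -normrM mulrBl.
  have -> : kap (eps n) t * t ^+ 2 - kap (eps k) t * t ^+ 2 = theta k t - theta n t.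
    by rewrite /theta; ring.
  apply: (@le_trans _ _ (normc (ent F i j t) * (theta k t + theta n t))).
    apply: ler_wpM2l; first exact: normc_ge0.
    have /andP[a0 _] := theta01 n t; have /andP[b0 _] := theta01 k t.
    by rewrite ler_norml; apply/andP; split; lra.
  by rewrite mulrDr; have := HN n Nn i j t; have := HN k Nk i j t; lra.
rewrite /psi_approx sum4B.
have := sum4_le (term 0 0) (term 0 1) (term 1 0) (term 1 1).
by move=> /le_trans; apply; lra.
Qed.

Definition psi F : C := xget 0 [set l | tends (psi_approx F) l].

Lemma psiP F : tends (psi_approx F) (psi F).
Proof.
have [l Hl] := cauchy_tends (psi_cauchy F).
exact: (xgetI 0 (P := [set l | tends (psi_approx F) l]) Hl).
Qed.

Lemma psi_linear : linear psi.
Proof.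
move=> a F G; apply: (tends_unique (psiP _)).
have -> : psi_approx (a *: F + G) = (fun n => a *: psi_approx F n + psi_approx G n).
  apply/funext => n; rewrite /psi_approx.
  have H i j : psi_term (a *: F + G) n i j = a *: psi_term F n i j + psi_term G n i j.
    rewrite /psi_term -fc_scale // -fc_add //; last first.
      by apply: ucont_mul => //; exact: ucont_cst.
    congr (fc _ _ _); apply/funext => t.
    by rewrite /cut cone_entryD cone_entryZ; ring.
  by rewrite !H !scalerDr [RHS]addrACA; congr (_ + _); exact: addrACA.
by apply: tends_add (psiP G); exact: tends_Z (psiP F).
Qed.

Lemma psi_star F : psi (star F) = star (psi F).
Proof.
apply: (tends_unique (psiP _)).
have -> : psi_approx (star F) = (fun n => star (psi_approx F n)).
  apply/funext => n; rewrite /psi_approx !starD.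
  have H i j : psi_term (star F) n i j = star (psi_term F n j i).
    rewrite /psi_term fc_munit_star //; congr (fc _ _ _); apply/funext => t.
    by rewrite /cut cone_entry_star conjcM conjc_real.
  by rewrite !H !addrA; congr (_ + _); rewrite -!addrA; congr (_ + _); rewrite addrC.
exact: tends_star (psiP F).
Qed.

Lemma tends_mul (u v : nat -> C) l l' : tends u l -> tends v l' ->
  tends (fun n => u n ** v n) (l ** l').
Proof.
move=> ul vl e e0; pose K := nrm l + nrm l' + 1.
have l0 := nrm_ge0 l; have l'0 := nrm_ge0 l'.
have K0 : 0 < K by rewrite /K; lra.
pose d := Num.min 1 (e / (2 * K)).
have d0 : 0 < d by rewrite lt_min ltr01 divr_gt0 // mulr_gt0.
have [N HN] := ul d d0; have [N' HN'] := vl d d0.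
exists (maxn N N') => n; rewrite geq_max => /andP[Nn Nn'].
have dK : d * (2 * K) <= e by rewrite -ler_pdivlMr ?mulr_gt0 // ge_min lexx orbT.
have d1 : d <= 1 by rewrite ge_min lexx.
have -> : u n ** v n - l ** l' = (u n - l) ** v n + l ** (v n - l').
  by rewrite amulBl amulBr addrA subrK.
have vK : nrm (v n) <= K.
  rewrite -[v n](subrK l'); apply: (le_trans (nrmD _ _)).
  by have := HN' n Nn'; rewrite /K; lra.
have H1 : nrm ((u n - l) ** v n) <= d * K.
  by apply: (le_trans (nrmM _ _)); apply: ler_pM; rewrite ?nrm_ge0 ?HN.
have H2 : nrm (l ** (v n - l')) <= K * d.
  apply: (le_trans (nrmM _ _)); apply: ler_pM; rewrite ?nrm_ge0 ?HN' //.
  by rewrite /K; lra.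
by apply: (le_trans (nrmD _ _)); lra.
Qed.

(** The product of the approximations has [kap^2 t^2] where that of [F ** G] has [kap]. The
    difference [kap theta], times the [t^2] of the matrix unit, is at most [theta], which is small
    against the entries of [F]. *)
Lemma psi_mul F G : psi (F ** G) = psi F ** psi G.
Proof.
apply: (tends_unique (u := fun n => psi_approx F n ** psi_approx G n)); last first.
  exact: tends_mul (psiP F) (psiP G).
move=> e e0; have e20 : 0 < e / 2 by rewrite divr_gt0.
have [N HN] := psiP (F ** G) e20.
pose M := cone_norm G; have M0 : 0 <= M by exact: cone_norm_ge0.
(* Two products in each of four entries, each at most [e M / (16 (M + 1))], add up to at most
   [e / 2]. *)
have M1 : 0 < 16 * (M + 1) by rewrite mulr_gt0 // ltr_wpDl.
have [N' HN'] := entry_cut_all F (divr_gt0 e0 M1).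
exists (maxn N N') => n; rewrite geq_max => /andP[Nn Nn'].
apply: (le_trans (nrm_tri (psi_approx (F ** G) n) _ _)).
rewrite (splitr e) lerD ?HN //.
have prod i j k l : psi_term F n i j ** psi_term G n k l =
    if j == k
    then fc Z (fun t => cut F i j n t * cut G k l n t * (t ^+ 2)%:C) (munit X i l)
    else 0 by exact: fc_munitM.
have -> : psi_approx F n ** psi_approx G n =
  (psi_term F n 0 0 ** psi_term G n 0 0 + psi_term F n 0 1 ** psi_term G n 1 0)
  + (psi_term F n 0 0 ** psi_term G n 0 1 + psi_term F n 0 1 ** psi_term G n 1 1)
  + ((psi_term F n 1 0 ** psi_term G n 0 0 + psi_term F n 1 1 ** psi_term G n 1 0)
  + (psi_term F n 1 0 ** psi_term G n 0 1 + psi_term F n 1 1 ** psi_term G n 1 1)).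
  rewrite /psi_approx !amulDl !amulDr !prod /= !addr0 !add0r.
  by congr (_ + _); exact: addrACA.
rewrite /psi_approx sum4B.
have term i l : nrm ((psi_term F n i 0 ** psi_term G n 0 l
      + psi_term F n i 1 ** psi_term G n 1 l) - psi_term (F ** G) n i l) <= e / 8.
  have usq : ucont (fun t => (t ^+ 2)%:C : R[i]).
    have -> : (fun t => (t ^+ 2)%:C) = (fun t : R => t%:C ^+ 2).
      by apply/funext => t; rewrite rmorphXn.
    exact/ucont_exp/ucont_id.
  have up j : ucont (fun t => cut F i j n t * cut G j l n t * (t ^+ 2)%:C).
    by apply: ucont_mul => //; exact: ucont_mul.
  rewrite !prod !eqxx /psi_term -fc_add // -fc_sub //; last exact: ucont_add.
  apply: nrm_fc_munit => //.
  - by apply: ucont_sub => //; exact: ucont_add.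
  - by move=> t t1; rewrite !e_cut // sqrrN.
  move=> t t1.
  have -> : cut F i 0 n t * cut G 0 l n t * (t ^+ 2)%:C
      + cut F i 1 n t * cut G 1 l n t * (t ^+ 2)%:C - cut (F ** G) i l n t =
    - ((ent F i 0 t * ent G 0 l t + ent F i 1 t * ent G 1 l t)
        * (kap (eps n) t * theta n t)%:C).
    have -> : (kap (eps n) t * theta n t)%:C = kp n t * (1 - kp n t * (t ^+ 2)%:C).
      by rewrite [LHS]rmorphM /theta; congr (_ * _); rewrite rmorphB rmorph1 rmorphM.
    by rewrite /cut /ent /kp cone_entryM; ring.
  rewrite normcN normcM normcR.
  have k0 := ltW (kap_gt0 t (eps_gt0 n)); have /andP[h0 h1] := theta01 n t.
  rewrite ger0_norm ?mulr_ge0 //.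
  have -> (x : R) : x * (kap (eps n) t * theta n t) * t ^+ 2 =
      x * theta n t * (kap (eps n) t * t ^+ 2) by ring.
  have /andP[q0 q1] := kap_sq_le1 n t.
  have Hj j : normc (ent F i j t * ent G j l t) * theta n t <= e / (16 * (M + 1)) * M.
    rewrite normcM mulrAC; apply: ler_pM; first by rewrite mulr_ge0 ?normc_ge0.
    - exact: normc_ge0.
    - exact: HN'.
    - exact: cone_entry_le.
  have HM : e / (16 * (M + 1)) * (16 * (M + 1)) = e by rewrite divfK // gt_eqF.
  have E0 : 0 <= e / (16 * (M + 1)) by rewrite ltW // divr_gt0.
  set S := normc _; have S0 : 0 <= S by exact: normc_ge0.
  have HS : S * theta n t <= 2 * (e / (16 * (M + 1)) * M).
    apply: (@le_trans _ _ ((normc (ent F i 0 t * ent G 0 l t)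
        + normc (ent F i 1 t * ent G 1 l t)) * theta n t)).
      by apply: ler_wpM2r => //; exact: normcD.
    by rewrite mulrDl; have := Hj 0; have := Hj 1; lra.
  apply: (@le_trans _ _ (S * theta n t)).
    by rewrite ler_piMr // mulr_ge0.
  apply: (le_trans HS); move: HM E0; set x := e / (16 * _) => HM E0; lra.
have := sum4_le (term 0 0) (term 0 1) (term 1 0) (term 1 1).
by move=> /le_trans; apply; lra.
Qed.

End Extension.

Lemma linear_exists (K : nzRingType) (U V : lmodType K) (f : U -> V) :
  linear f -> exists g : {linear U -> V}, g =1 f.
Proof.
move=> fl; pose L := GRing.isLinear.Build K U V *:%R f fl.
by exists (HB.pack_for {linear U -> V} f L).
Qed.

(** * Projectivity of the cone *)

Section ConeProjective.
Context {R : realType}.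
Local Notation P := (cone (R := R)).
Implicit Types (F x y z : P) (t : R) (i j k l : 'I_2).

Section Generator.
Variables (x : P) (m : R).
Hypothesis m01 : 0 < m <= 1.
Hypothesis xE : forall t, 0 <= t <= 1 -> forall i j,
  val x t i j = if (i == 1) && (j == 0) then (m * t)%:C else 0.

Lemma generator_sqr0 : x ** x = 0.
Proof.
apply: cone_ext => t t01; apply/matrixP => i j.
rewrite cone_entryM cone_entry0 !xE //=.
by move: i j; do 2! apply: ord2P; rewrite /= ?mul0r ?mulr0 ?addr0.
Qed.

Let z := x + star x.
Hypothesis z_lt1 : nrm z < 1.

Let z_star : star z = z.
Proof. by rewrite /z starD starK addrC. Qed.

Let conj_if (b : bool) (s : R) :
  conjc (if b then s%:C else 0) = if b then s%:C else 0.
Proof. by case: b; rewrite ?conjc_real ?conjc0. Qed.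

Let zE t i j : 0 <= t <= 1 -> val z t i j = if i == j then 0 else (m * t)%:C.
Proof.
move=> t01; rewrite cone_entryD cone_entry_star !xE // conj_if.
by move: i j ((m * t)%:C) => i j c; move: i j; do 2! apply: ord2P;
  rewrite /= ?addr0 ?add0r.
Qed.

Let zzE t i j y : 0 <= t <= 1 ->
  val (z ** (z ** y)) t i j = ((m * t) ^+ 2)%:C * val y t i j.
Proof.
move=> t01; rewrite cone_entryM !(cone_entryM z y) !zE // rmorphXn /=.
by move: i; apply: ord2P => /=; ring.
Qed.

Let mt1 t : 0 <= t <= 1 -> `|m * t| <= 1.
Proof.
move=> /andP[t0 t1]; have /andP[m0 m1] := m01.
rewrite ger0_norm ?mulr_ge0 ?(ltW m0) //.
by apply: le_trans m1; rewrite ler_piMr // ltW.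
Qed.

Lemma val_fc_generator f y t i j : ucont f -> even f -> 0 <= t <= 1 ->
  val (fc z f y) t i j = f (m * t) * val y t i j.
Proof.
move=> uf fe t01; apply: cone_fc_entry_even => //; first exact: mt1.
by move=> y'; exact: zzE.
Qed.

Lemma val_munit t i j k l : 0 <= t <= 1 ->
  val (munit x i j) t k l =
  if (k == i) && (l == j) then ((m * t) ^+ 2)%:C else 0.
Proof.
move=> t01; have /andP[t0 t1] := t01; have /andP[m0 m1] := m01.
have uabs : ucont (fun t : R => `|t|%:C : R[i]).
  by apply: (@ucont_lip _ _ 1) => a b _ _; rewrite mul1r ler_dist_dist.
have uw : ucont (weight (R := R) i j).
  by rewrite /weight; case: (i == j) => //; exact: ucont_cst.
have ew : even (weight (R := R) i j).
  by rewrite /weight; case: (i == j) => // a _; rewrite normrN.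
rewrite /munit val_fc_generator //.
have mt0 : `|m * t| = m * t by rewrite ger0_norm // mulr_ge0 // ltW.
have mt2 : ((m * t) ^+ 2)%:C = (m * t)%:C * (m * t)%:C :> R[i].
  by rewrite expr2 rmorphM.
rewrite mt2 /weight /preunit.
have sE k' l' : val (star x) t k' l' = if (k' == 0) && (l' == 1) then (m * t)%:C else 0.
  by rewrite cone_entry_star xE // conj_if andbC.
have sxE k' l' : val (star x ** x) t k' l' =
    if (k' == 0) && (l' == 0) then (m * t)%:C * (m * t)%:C else 0.
  rewrite cone_entryM !xE // !sE; move: ((m * t)%:C) => c.
  by move: k' l'; do 2! apply: ord2P; rewrite /= ?(mul0r, mulr0, addr0, add0r).
have xsE k' l' : val (x ** star x) t k' l' =
    if (k' == 1) && (l' == 1) then (m * t)%:C * (m * t)%:C else 0.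
  rewrite cone_entryM !xE // !sE; move: ((m * t)%:C) => c.
  by move: k' l'; do 2! apply: ord2P; rewrite /= ?(mul0r, mulr0, addr0, add0r).
have i10 : (1 == 0 :> 'I_2) = false by [].
have i01 : (0 == 1 :> 'I_2) = false by [].
have I2 (a : 'I_2) : a = 0 \/ a = 1 by move: a; apply: ord2P; [left | right].
have [->|->] := I2 i; have [->|->] := I2 j; rewrite !(eqxx, i10, i01) ?mt0.
- by rewrite sxE mul1r.
- by rewrite sE; case: (_ && _); rewrite ?mulr0.
- by rewrite xE //; case: (_ && _); rewrite ?mulr0.
- by rewrite xsE mul1r.
Qed.

Let val_sum4 (a b c d : P) t i j : val (a + b + (c + d)) t i j =
  val a t i j + val b t i j + (val c t i j + val d t i j).
Proof. by rewrite !cone_entryD. Qed.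

Lemma psi_approx_generator F n t i j : 0 <= t <= 1 ->
  val (psi_approx x m F n) t i j =
  val F t i j * (kap n.+1%:R^-1 (m * t) * (m * t) ^+ 2)%:C.
Proof.
move=> t01; have /andP[t0 t1] := t01; have /andP[m0 m1] := m01.
have mt : `|m * t| / m = t.
  by rewrite ger0_norm ?mulr_ge0 ?(ltW m0) // mulrAC divff ?mul1r // gt_eqF.
have term k l : val (psi_term x m F n k l) t i j =
  val F t k l * (kap n.+1%:R^-1 (m * t))%:C *
  (if (i == k) && (j == l) then ((m * t) ^+ 2)%:C else 0).
  have e0 : 0 < n.+1%:R^-1 :> R by rewrite invr_gt0 ltr0n.
  rewrite /psi_term val_fc_generator //.
  - rewrite val_munit //; congr (_ * _).
    by rewrite /cut; congr (val F _ k l * _); exact: mt.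
  - exact: ucont_cut.
  - exact: cut_even.
have -> : (kap n.+1%:R^-1 (m * t) * (m * t) ^+ 2)%:C =
    (kap n.+1%:R^-1 (m * t))%:C * ((m * t) ^+ 2)%:C :> R[i] by exact: rmorphM.
have [T [-> Tij]] : exists T : 'I_2 -> 'I_2 -> P,
    psi_approx x m F n = T 0 0 + T 0 1 + (T 1 0 + T 1 1) /\
    forall k l, val (T k l) t i j = val F t k l * (kap n.+1%:R^-1 (m * t))%:C *
      (if (i == k) && (j == l) then ((m * t) ^+ 2)%:C else 0).
  by exists (psi_term x m F n).
rewrite mulrA val_sum4 !Tij {term}; set c := (kap _ _)%:C; set d := ((m * t) ^+ 2)%:C.
move: (val F t) c d {Tij} => A c d.
by move: i j; do 2! apply: ord2P; rewrite /= !mulr0 ?addr0 ?add0r.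
Qed.

(** Formed from the generator inside the cone itself, the construction of [psi] returns [F]; this is
    the limit needed on the side of the domain when the closed graph is applied. *)
Lemma psi_approx_generator_tends F : tends (psi_approx x m F) F.
Proof.
have /andP[m0 m1] := m01; move=> e e0.
have e40 : 0 < e / 4 by rewrite divr_gt0.
have [N00 H00] := entry_cut m0 F 0 0 e40; have [N01 H01] := entry_cut m0 F 0 1 e40.
have [N10 H10] := entry_cut m0 F 1 0 e40; have [N11 H11] := entry_cut m0 F 1 1 e40.
exists (maxn (maxn N00 N01) (maxn N10 N11)) => n.
rewrite !geq_max => /andP[/andP[n00 n01] /andP[n10 n11]].
rewrite nrmBC nrm_cone; apply: (@le_trans _ _ (4 * (e / 4))); last by lra.
apply: cone_norm_le_entry => t t01 i j; have /andP[t0 t1] := t01.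
have mt : `|m * t| / m = t.
  by rewrite ger0_norm ?mulr_ge0 ?(ltW m0) // mulrAC divff ?mul1r // gt_eqF.
rewrite cone_valB psi_approx_generator //.
set r := kap _ _ * _; have -> : val F t i j - val F t i j * r%:C =
  val F t i j * (1 - r)%:C by rewrite rmorphB rmorph1 mulrBr mulr1.
have r1 : 0 <= 1 - r.
  have e1 : 0 < n.+1%:R^-1 :> R by rewrite invr_gt0 ltr0n.
  rewrite /r -{1}(kapV (m * t) e1) mulrDr addrAC subrr add0r.
  by rewrite mulr_ge0 ?sqr_ge0 // ltW // kap_gt0.
rewrite normcM normcR ger0_norm //.
have Hm k l := esym (congr1 (fun s => normc (val F s k l)) mt).
rewrite Hm /r; move: i j; do 2! apply: ord2P;
  [exact: H00 | exact: H01 | exact: H10 | exact: H11].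
Qed.

End Generator.

Section Lifting.
Context {C : cstarType R} (J : ideal C).
Variable sigma : {linear P -> quotient J}.
Hypothesis sigma_hom : star_hom sigma.

(* Lift [diag (t^(1/2), - t^(1/2))] to a self-adjoint [D] and [t^(1/2) e_10] to
   [Y]; the supports of [D_-] and [D_+] being orthogonal, [sqrt D_- Y sqrt D_+]
   has square 0. *)
Lemma nilpotent_lift : exists (x : P) (X : C) (m : R),
  [/\ 0 < m, X ** X = 0, lifts sigma x X &
   forall t, 0 <= t <= 1 -> forall i j,
     val x t i j = if (i == 1) && (j == 0) then (m * t)%:C else 0].
Proof.
(* The square root is Hoelder continuous of exponent 1/2, which explains the modulus [e ^+ 2]
   below. *)
have rt_lip (s t : R) : 0 <= t -> t <= s -> Num.sqrt s - Num.sqrt t <= Num.sqrt (s - t).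
  move=> t0 ts; have s0 : 0 <= s by exact: le_trans ts.
  rewrite lerBlDr -(@ler_pXn2r _ 2) ?nnegrE ?addr_ge0 ?sqrtr_ge0 //.
  rewrite sqrrD !sqr_sqrtr ?subr_ge0 // addrAC subrK lerDl mulrn_wge0 //.
  by rewrite mulr_ge0 ?sqrtr_ge0.
have u_sqrt : ucont (fun t : R => (Num.sqrt (Num.max 0 t))%:C : R[i]).
  split.
    exists 1 => t t1; rewrite normcR ger0_norm ?sqrtr_ge0 // -[X in _ <= X]sqrtr1.
    rewrite ler_sqrt ?ltr01 // ge_max ler01 /=.
    exact: le_trans (ler_norm t) t1.
  move=> e e0; exists (e ^+ 2); first by rewrite exprn_gt0.
  move=> s t _ _ st.
  have -> : (Num.sqrt (Num.max 0 s))%:C - (Num.sqrt (Num.max 0 t))%:C =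
    (Num.sqrt (Num.max 0 s) - Num.sqrt (Num.max 0 t))%:C by rewrite rmorphB.
  rewrite normcR.
  have mx : `|Num.max 0 s - Num.max 0 t| <= e ^+ 2.
    apply: le_trans st; have Hx := ler_norm (s - t); have Hy := ler_norm (t - s).
    rewrite distrC in Hy; rewrite ler_norml.
    by case: (leP 0 s) => ?; case: (leP 0 t) => ?; apply/andP; split; lra.
  have s0 : 0 <= Num.max 0 s by rewrite le_max lexx.
  have t0 : 0 <= Num.max 0 t by rewrite le_max lexx.
  move: (Num.max 0 s) (Num.max 0 t) s0 t0 mx => a b a0 b0 ab.
  have [ba|/ltW ba] := leP b a.
    rewrite ger0_norm ?subr_ge0 ?ler_wsqrtr //; apply: (le_trans (rt_lip _ _ b0 ba)).
    rewrite -(ger0_norm (ltW e0)) -sqrtr_sqr ler_wsqrtr //.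
    exact: le_trans (ler_norm _) ab.
  rewrite distrC ger0_norm ?subr_ge0 ?ler_wsqrtr //; apply: (le_trans (rt_lip _ _ a0 ba)).
  rewrite -(ger0_norm (ltW e0)) -sqrtr_sqr ler_wsqrtr //.
  by rewrite (le_trans (ler_norm _)) // distrC.
pose rt (t : R) : R[i] := (Num.sqrt (Num.max 0 t))%:C.
have rt0 : rt 0 = 0 by rewrite /rt max_l // sqrtr0.
have rtE t : 0 <= t -> rt t = (Num.sqrt t)%:C by move=> t0; rewrite /rt max_r.
(* Square roots of the positive and of the negative part of [t]. *)
pose fp := rt; pose fm t := rt (- t).
have ufp : ucont fp by [].
have ufm : ucont fm.
  apply: (@ucont_comp_lip _ rt (fun t => - t) 1) => // [t|s t _ _]; first by rewrite normrN.
  by rewrite mul1r -opprD normrN.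
have fpm t : fp t * fm t = 0.
  rewrite /fp /fm /rt; have [t0|/ltW t0] := leP 0 t.
    by rewrite [Num.max 0 (- t)]max_l ?oppr_le0 // sqrtr0 mulr0.
  by rewrite sqrtr0 mul0r.
pose gd i j : R -> R[i] :=
  if i == j then (if i == 0 then rt else (fun t => - 1 * rt t)) else fun=> 0.
have [d1 d1E] : exists d1 : P, forall t, 0 <= t <= 1 -> forall i j, val d1 t i j = gd i j t.
  apply: cone_mk => i j; rewrite /gd; case: ifP => _; try exact: ucont_cst.
    case: ifP => _ //; apply: ucont_mul => //; exact: ucont_cst.
  by case: ifP => _; rewrite rt0 ?mulr0.
  by [].
have [y yE] : exists y : P, forall t, 0 <= t <= 1 -> forall i j,
    val y t i j = if (i == 1) && (j == 0) then rt t else 0.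
  have [|i j|y yE] := @cone_mk R (fun i j => if (i == 1) && (j == 0) then rt else fun=> 0).
  - by move=> i j; case: ifP => _ //; exact: ucont_cst.
  - by case: ifP => _.
  - by exists y => t t01 i j; rewrite yE //; case: ifP.
have d1_star : star d1 = d1.
  apply: cone_ext => t t01; apply/matrixP => i j; rewrite cone_entry_star !d1E //.
  rewrite /gd [j == i]eq_sym; have [<-|ij] := eqVneq i j; last by rewrite conjc0.
  by case: ifP => _; rewrite ?mulN1r ?conjcN /rt ?conjc_real.
have [D1 d1D] := lifts_exists sigma d1; have [Y yY] := lifts_exists sigma y.
pose D2 := (2%:R^-1 : R[i]) *: (D1 + star D1).
have d1D2 : lifts sigma d1 D2.
  have -> : d1 = (2%:R^-1 : R[i]) *: (d1 + star d1).
    rewrite d1_star -mulr2n -[d1 *+ 2]scaler_nat scalerA mulVf ?scale1r //.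
    by rewrite pnatr_eq0.
  by apply: lifts_Z; apply: lifts_D => //; exact: lifts_star.
have D2_star : star D2 = D2.
  by rewrite /D2 starZ conjc_inv conjc_nat starD starK addrC.
(* One scale brings both [d1] and its lift below norm 1, so that [lifts_fc] applies. *)
pose k := (nrm D2 + nrm d1 + 1)^-1.
have nD := nrm_ge0 D2; have nd := nrm_ge0 d1.
have K0 : 0 < nrm D2 + nrm d1 + 1 by lra.
have k0 : 0 < k by rewrite invr_gt0.
have k1 : k <= 1 by rewrite invf_le1 //; lra.
pose D := k%:C *: D2; pose d := k%:C *: d1.
have D_star : star D = D by rewrite starZ conjc_real D2_star.
have d_star : star d = d by rewrite starZ conjc_real d1_star.
have D1' : nrm D < 1.
  by rewrite nrmZ normcR gtr0_norm // mulrC ltr_pdivrMr // mul1r; lra.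
have d1' : nrm d < 1.
  by rewrite nrmZ normcR gtr0_norm // mulrC ltr_pdivrMr // mul1r; lra.
have dD : lifts sigma d D by exact: lifts_Z.
(* The calculus multiplies on the left only: [Y] is starred, multiplied by [sqrt D_+], starred back,
   then multiplied by [sqrt D_-]. *)
pose X := fc D fm (star (fc D fp (star Y))).
pose x := fc d fm (star (fc d fp (star y))).
have xX : lifts sigma x X.
  apply: lifts_fc => //; apply: lifts_star => //; apply: lifts_fc => //.
  exact: lifts_star.
have XX : X ** X = 0.
  rewrite {1}/X -fc_amulr // fc_adj // starK.
  have -> : fc D (fun t => conjc (fp t)) X =
      fc D (fun t => fp t * fm t) (star (fc D fp (star Y))).
    rewrite fc_mul //; congr (fc _ _ _); apply/funext => t.
    by rewrite /fp /rt conjc_real.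
  have -> : (fun t => fp t * fm t) = fun=> 0 by apply/funext.
  by rewrite fc_cst // scale0r amul0r fc_0.
have dE t i j (z : P) : 0 <= t <= 1 ->
    val (d ** z) t i j = ((if i == 0 then 1 else -1) * (k * Num.sqrt t))%:C * val z t i j.
  move=> t01; have /andP[t0 t1] := t01.
  rewrite cone_entryM !cone_entryZ !d1E //.
  have gE i' : gd i' i' t = (if i' == 0 then 1 else -1)%:C * (Num.sqrt t)%:C.
    by rewrite /gd eqxx; case: ifP => _; rewrite rtE // ?rmorph1 ?rmorphN ?rmorph1 ?mul1r.
  have g0 i' j' : i' != j' -> gd i' j' t = 0 by move=> ij; rewrite /gd (negPf ij).
  have -> : ((if i == 0 then 1 else -1) * (k * Num.sqrt t))%:C =
      k%:C * ((if i == 0 then 1 else -1)%:C * (Num.sqrt t)%:C) :> R[i].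
    by rewrite -!rmorphM; congr (_%:C); exact: mulrCA.
  rewrite -gE; move: i; apply: ord2P; last first.
    by rewrite (g0 1 0) // mulr0 mul0r add0r.
  by rewrite (g0 0 1) // mulr0 mul0r addr0.
have kt1 t : 0 <= t <= 1 -> 0 <= k * Num.sqrt t <= 1.
  move=> /andP[t0 t1]; rewrite mulr_ge0 ?sqrtr_ge0 ?(ltW k0) //=.
  rewrite -[X in _ <= X]mulr1; apply: ler_pM => //; rewrite ?sqrtr_ge0 ?(ltW k0) //.
  by rewrite -[X in _ <= X]sqrtr1 ler_wsqrtr.
have fcE f t i j (z : P) : ucont f -> 0 <= t <= 1 ->
    val (fc d f z) t i j = f ((if i == 0 then 1 else -1) * (k * Num.sqrt t)) * val z t i j.
  move=> uf t01; have /andP[h0 h1] := kt1 t t01.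
  apply: cone_fc_entry => //; last by move=> z'; exact: dE.
  by case: ifP => _; rewrite ?mul1r ?mulN1r ?normrN ger0_norm.
(* The entry is [sqrt (k sqrt t) * sqrt t * sqrt (k sqrt t) = k t]; the exponents in [d1] and [y]
   are chosen to make it linear in [t]. *)
exists x, X, k; split => // t t01 i j.
have /andP[h0 h1] := kt1 t t01; have /andP[t0 t1] := t01.
rewrite /x fcE // cone_entry_star fcE // cone_entry_star yE //.
case: (boolP ((i == 1) && (j == 0))) => [/andP[/eqP-> /eqP->]|_]; last first.
  by rewrite !conjc0 mulr0 conjc0 mulr0.
have A2 : Num.sqrt (k * Num.sqrt t) * Num.sqrt (k * Num.sqrt t) = k * Num.sqrt t.
  by rewrite -expr2 sqr_sqrtr.
have T2 : Num.sqrt t * Num.sqrt t = t by rewrite -expr2 sqr_sqrtr.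
have -> : fm ((if (1 : 'I_2) == 0 then 1 else -1) * (k * Num.sqrt t))
    = (Num.sqrt (k * Num.sqrt t))%:C by rewrite /fm /= mulN1r opprK rtE.
have -> : fp ((if (0 : 'I_2) == 0 then 1 else -1) * (k * Num.sqrt t))
    = (Num.sqrt (k * Num.sqrt t))%:C by rewrite /fp /= mul1r rtE.
rewrite conjcM conjcK conjc_real (rtE t t0) mulrA.
have MC (a b : R) : a%:C * b%:C = (a * b)%:C :> R[i] by rewrite rmorphM.
by rewrite !MC A2 -mulrA T2.
Qed.

(** [psi_approx] tends to [F] when formed from [x], and to [psi F] when formed from the lift [X];
    corresponding terms lift one another, and the closed graph concludes. *)
Lemma lifting : exists2 psi : {linear P -> C},
  star_hom psi & forall F, \pi_(quotient J) (psi F) = sigma F.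
Proof.
have [x1 [X1 [k [k0 XX1 xX1 x1E]]]] := nilpotent_lift.
pose z1 := x1 + star x1; pose Z1 := X1 + star X1.
have [c [c0 cz cZ]] : exists c : R, [/\ 0 < c, c * nrm z1 < 1 & c * nrm Z1 < 1].
  move: (nrm z1) (nrm Z1) (nrm_ge0 z1) (nrm_ge0 Z1) => a b a0 b0.
  have c0' : 0 < a + b + 1 by lra.
  by exists (a + b + 1)^-1; split; rewrite ?invr_gt0 // mulrC ltr_pdivrMr // mul1r; lra.
pose x := c%:C *: x1; pose X := c%:C *: X1; pose m := c * k.
have xE t : 0 <= t <= 1 -> forall i j,
    val x t i j = if (i == 1) && (j == 0) then (m * t)%:C else 0.
  move=> t01 i j; rewrite cone_entryZ x1E //; case: ifP => _; last by rewrite mulr0.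
  by rewrite /m -mulrA [RHS]rmorphM.
have XX : X ** X = 0 by rewrite amulZl amulZr XX1 !scaler0.
have xX : lifts sigma x X by exact: lifts_Z.
have zE : x + star x = c%:C *: z1 by rewrite starZ conjc_real -scalerDr.
have ZE : X + star X = c%:C *: Z1 by rewrite starZ conjc_real -scalerDr.
have z_lt1 : nrm (x + star x) < 1.
  by rewrite zE nrmZ normcR gtr0_norm.
have Z_lt1 : nrm (X + star X) < 1.
  by rewrite ZE nrmZ normcR gtr0_norm.
have m0 : 0 < m by rewrite mulr_gt0.
(* [m] is an entry of [x + star x] at 1, hence below its norm. *)
have m1 : m <= 1.
  apply: ltW; apply: le_lt_trans z_lt1.
  have <- : normc (val (x + star x) 1 1 0) = m.
    have x10 : val x 1 1 0 = m%:C by rewrite xE ?ler01 ?lexx // mulr1.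
    have x01 : val x 1 0 1 = 0 by rewrite xE ?ler01 ?lexx.
    by rewrite cone_entryD cone_entry_star x10 x01 conjc0 addr0 normcR gtr0_norm.
  exact: cone_entry_le.
have m01 : 0 < m <= 1 by rewrite m0 m1.
have xx := generator_sqr0 xE.
have [psi' psiE] : exists psi' : {linear P -> C}, psi' =1 psi X m.
  exact: linear_exists (psi_linear XX Z_lt1 m0).
exists psi'; first split.
- by move=> F G; rewrite !psiE psi_mul.
- by move=> F; rewrite !psiE psi_star.
move=> F; rewrite psiE -/(lifts sigma F (psi X m F)).
apply: (lifts_limit sigma_hom (b := psi_approx x m F) (c := psi_approx X m F)); last 2 first.
- exact: psi_approx_generator_tends.
- exact: psiP.
have s_star (D : cstarType R) (d : D) : star (d + star d) = d + star d.
  by rewrite starD starK addrC.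
have zZ : lifts sigma (x + star x) (X + star X).
  by apply: lifts_D => //; exact: lifts_star.
have pW i j : lifts sigma (preunit x i j) (preunit X i j).
  by rewrite /preunit; case: ifP => _; case: ifP => _ //; try apply: lifts_M => //;
    exact: lifts_star.
have uw i j : ucont (weight (R := R) i j).
  rewrite /weight; case: ifP => _; first exact: ucont_cst.
  by apply: (@ucont_lip _ _ 1) => a b _ _; rewrite mul1r ler_dist_dist.
have mU i j : lifts sigma (munit x i j) (munit X i j) by apply: lifts_fc.
have tU n i j : lifts sigma (psi_term x m F n i j) (psi_term X m F n i j).
  by apply: lifts_fc => //; exact: ucont_cut.
by move=> n; apply: lifts_D; apply: lifts_D.
Qed.

End Lifting.
Theorem cone_projective : projective P.
Proof. by move=> C J sigma sh; exact: lifting. Qed.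

End ConeProjective.

(** * The corner subalgebra *)

Section ClosedSets.
Context {R : realType} {C : cstarType R}.

Lemma approx_closed (A : set C) :
  (forall l, (forall e : R, 0 < e -> exists2 x, A x & nrm (x - l) <= e) -> A l) ->
  closed A.
Proof.
move=> H l cl; apply: H => e e0.
have e0' : 0 < e%:C :> R[i] by rewrite ltr0c.
have [x [Ax]] := cl _ (nbhsx_ballx l _ e0').
rewrite -ball_normE /= nrmE ltcR => lx.
by exists x => //; rewrite nrmBC ltW.
Qed.

End ClosedSets.

Section Corner.
Context {R : realType}.
Local Notation P := (cone (R := R)).
Implicit Types (t : R) (i j k l : 'I_2).

Lemma cone_units (f : R -> R[i]) : ucont f -> f 0 = 0 ->
  exists u : 'I_2 -> 'I_2 -> P, forall i j t, 0 <= t <= 1 -> forall k l,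
    val (u i j) t k l = if (k == i) && (l == j) then f t else 0.
Proof.
move=> uf f0.
have H i j : exists x : P, forall t, 0 <= t <= 1 -> forall k l,
    val x t k l = (if (k == i) && (l == j) then f else fun=> 0) t.
  by apply: cone_mk => k l; case: (_ && _) => //; exact: ucont_cst.
exists (fun i j => sval (cid (H i j))) => i j t t01 k l.
by rewrite (svalP (cid (H i j))) //; case: (_ && _).
Qed.

Lemma entry_limit0 (t : R) i j (x : P) (A : set P) :
  (forall y, A y -> val y t i j = 0) ->
  (forall e : R, 0 < e -> exists2 y, A y & nrm (y - x) <= e) -> val x t i j = 0.
Proof.
move=> A0 H; apply: eqc_normc => e /H[y Ay yx].
rewrite -(A0 y Ay) -cone_valB; apply: le_trans yx.
by rewrite nrmBC; exact: cone_entry_le.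
Qed.

Definition corner_set : set P :=
  [set x : P | [/\ val x 1 0 1 = 0, val x 1 1 0 = 0 & val x 1 1 1 = 0]].

Lemma corner_subcstar : is_subcstar corner_set.
Proof.
split.
- apply: approx_closed => x H; split; apply: (entry_limit0 _ H) => y [] //.
- by split; rewrite cone_entry0.
- move=> a x y [x01 x10 x11] [y01 y10 y11].
  by split; rewrite cone_entryD cone_entryZ ?(x01, x10, x11) ?(y01, y10, y11) mulr0 addr0.
- move=> x y [x01 x10 x11] [y01 y10 y11].
  by split; rewrite cone_entryM ?(x01, x10, x11) ?(y01, y10, y11) ?(mulr0, mul0r) addr0.
- by move=> x [x01 x10 x11]; split; rewrite cone_entry_star ?(x01, x10, x11) conjc0.
Qed.

Definition corner : subcstar P := SubCstar corner_subcstar.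

(** With [a] and [b - a] written as [star x ** x] and [star y ** y], the entry [b(1)_11 = 0] is the
    sum of the squared moduli in the second columns of [x(1)] and [y(1)]. So [x(1)] has zero second
    column, which confines [a(1)] to [e_00]. *)
Lemma corner_hereditary : hereditary corner.
Proof.
move=> a b [x]; rewrite subr0 => ax [y yE] [_ _ b11].
have bE : b = star x ** x + star y ** y by rewrite -ax -yE addrC subrK.
have sq (c : R[i]) : conjc c * c = (normc c ^+ 2)%:C by exact: conjc_mul_normc.
have : (normc (val x 1 0 1) ^+ 2 + normc (val x 1 1 1) ^+ 2 +
    (normc (val y 1 0 1) ^+ 2 + normc (val y 1 1 1) ^+ 2))%:C = 0 :> R[i].
  rewrite -b11 bE cone_entryD !cone_entryM !cone_entry_star !sq.
  by rewrite -!rmorphD.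
case; have := sqr_ge0 (normc (val x 1 0 1)); have := sqr_ge0 (normc (val x 1 1 1)).
have := sqr_ge0 (normc (val y 1 0 1)); have := sqr_ge0 (normc (val y 1 1 1)).
move=> h1 h2 h3 h4 h.
have /eqP : normc (val x 1 0 1) ^+ 2 = 0 by lra.
rewrite sqrf_eq0 => /eqP/eq0_normc x01.
have /eqP : normc (val x 1 1 1) ^+ 2 = 0 by lra.
rewrite sqrf_eq0 => /eqP/eq0_normc x11.
split; rewrite ax cone_entryM !cone_entry_star x01 x11;
  by rewrite ?conjc0 ?(mulr0, mul0r) addr0.
Qed.

(* [v^3 e_11 = (v e_10) (v e_00) (v e_01)] lies in the ideal generated by the corner. *)
Lemma corner_full : full corner.
Proof.
apply/seteqP; split => // p _ J /= [idJ QJ].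
have [Jcl _ _ _] := idJ; apply: (closed_approx Jcl) => e e0.
have [_ pu _ _] := coneP p; have e40 : 0 < e / 4 by rewrite divr_gt0.
have [d d0 pd] := pu _ e40.
(* [f] is 1 from [d] on, and below [d] the entries of [p] are at most [e / 4]; so [f^3] acts on [p]
   as an approximate unit. *)
pose f t : R[i] := (ramp 0 d t)%:C.
have uf : ucont f.
  by apply: (@ucont_lip _ _ (d - 0)^-1) => s t _ _; exact: ramp_lip.
have f0 : f 0 = 0 by rewrite /f ramp_lo.
have [u uE] := cone_units uf f0.
have J00 : J (u 0 0).
  by apply: QJ; split; rewrite uE // ler01 lexx.
(* [u 1 0] and [u 0 1] lie outside the corner, as [f 1] is nonzero; they enter as multipliers from
   [P]. *)
pose V := u 0 0 ** (u 0 0 ** u 0 0) + u 1 0 ** (u 0 0 ** u 0 1).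
have JV : J V.
  apply: (cideal_D idJ); first by apply: (cideal_Ml idJ); exact: (cideal_Ml idJ).
  by apply: (cideal_Ml idJ); exact: (cideal_Mr idJ).
have VE t k l : 0 <= t <= 1 -> val V t k l = if k == l then f t ^+ 3 else 0.
  move=> t01; rewrite cone_entryD !cone_entryM !uE // !exprS expr0 mulr1.
  by move: (f t) k l => c; apply: ord2P; apply: ord2P;
    rewrite /= ?(mulr0, mul0r, addr0, add0r).
exists (p ** V); first exact: (cideal_Ml idJ).
rewrite nrmBC nrm_cone; apply: (@le_trans _ _ (4 * (e / 4))); last by lra.
apply: cone_norm_le_entry => t t01 i j; have /andP[t0 t1] := t01.
have -> : val (p - p ** V) t i j = val p t i j * (1 - f t ^+ 3).
  rewrite cone_valB cone_entryM !VE //; move: (val p t) (f t ^+ 3) => A c.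
  by move: j; apply: ord2P; rewrite /= ?(mulr0, addr0, add0r) mulrBr mulr1.
rewrite normcM.
have [td|dt] := leP t d; last first.
  rewrite /f ramp_hi // ?(ltW dt) // expr1n subrr normc0 mulr0.
  exact: ltW.
have pt : normc (val p t i j) <= e / 4.
  have := pd t 0; rewrite subr0 ger0_norm // => /(_ td i j).
  by rewrite cone_at0 [X in _ - X]mxE subr0.
have /andP[r0 r1] := ramp01 0 d t.
have r3 : ramp 0 d t ^+ 3 <= 1 by rewrite exprn_ile1.
have r3' : 0 <= ramp 0 d t ^+ 3 by rewrite exprn_ge0.
have -> : 1 - f t ^+ 3 = (1 - ramp 0 d t ^+ 3)%:C :> R[i].
  by rewrite rmorphB rmorph1 rmorphXn.
rewrite normcR ger0_norm ?subr_ge0 //.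
apply: (@le_trans _ _ (normc (val p t i j))) => //.
by rewrite ler_piMr ?normc_ge0 // gerBl.
Qed.

(* The commutative test algebra [C_0((0, 1])], as the scalar part of the cone. *)
Definition scalar_set : set P :=
  [set x : P | forall t, [/\ val x t 0 1 = 0, val x t 1 0 = 0 & val x t 0 0 = val x t 1 1]].

Lemma scalar_subcstar : is_subcstar scalar_set.
Proof.
split.
- apply: approx_closed => x H t; split.
  + by apply: (entry_limit0 _ H) => y /(_ t)[].
  + by apply: (entry_limit0 _ H) => y /(_ t)[].
  + apply: eqc_normc => e e0; have e20 : 0 < e / 2 by rewrite divr_gt0.
    have [y /(_ t)[_ _ y01] yx] := H _ e20.
    have -> : val x t 0 0 - val x t 1 1 = val (y - x) t 1 1 - val (y - x) t 0 0.
      by rewrite !cone_valB y01; ring.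
    have h0 := le_trans (cone_entry_le (y - x) t 0 0) yx.
    have h1 := le_trans (cone_entry_le (y - x) t 1 1) yx.
    by rewrite (splitr e) (le_trans (normcD _ _)) // normcN lerD.
- by move=> t; split; rewrite !cone_entry0.
- move=> a x y Hx Hy t; have [x01 x10 xx] := Hx t; have [y01 y10 yy] := Hy t.
  by split; rewrite !cone_entryD !cone_entryZ ?(x01, x10, xx) ?(y01, y10, yy) ?mulr0 ?addr0.
- move=> x y Hx Hy t; have [x01 x10 xx] := Hx t; have [y01 y10 yy] := Hy t.
  split; rewrite !cone_entryM ?(x01, x10, xx) ?(y01, y10, yy) ?(mulr0, mul0r) ?(addr0, add0r) //.
- move=> x Hx t; have [x01 x10 xx] := Hx t.
  by split; rewrite !cone_entry_star ?(x01, x10, xx) ?conjc0.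
Qed.

Definition scalars : subcstar P := SubCstar scalar_subcstar.

Local Notation S := (subcstar_type scalars).

Definition ent (x : S) t : R[i] := val (val x) t 0 0.

Lemma scalarP (x : S) t : [/\ val (val x) t 0 1 = 0, val (val x) t 1 0 = 0
  & val (val x) t 0 0 = val (val x) t 1 1].
Proof. exact: (set_mem (valP x) t). Qed.

Lemma entM (x y : S) t : ent (x ** y) t = ent x t * ent y t.
Proof.
have [x01 _ _] := scalarP x t.
by rewrite /ent val_amul cone_entryM x01 mul0r addr0.
Qed.

Lemma entD (x y : S) t : ent (x + y) t = ent x t + ent y t.
Proof. by rewrite /ent raddfD cone_entryD. Qed.

Lemma ent0 t : ent 0 t = 0.
Proof. by rewrite /ent raddf0 cone_entry0. Qed.

Lemma entZ a (x : S) t : ent (a *: x) t = a * ent x t.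
Proof. by rewrite /ent linearZ cone_entryZ. Qed.

Lemma entB (x y : S) t : ent (x - y) t = ent x t - ent y t.
Proof. by rewrite /ent raddfB cone_valB. Qed.

Lemma ent_star (x : S) t : ent (star x) t = conjc (ent x t).
Proof. by rewrite /ent val_star cone_entry_star. Qed.

Definition vanish_set : set S := [set x : S | ent x 1 = 0].

Lemma vanish_ideal : is_ideal vanish_set.
Proof.
split.
- apply: approx_closed => x H; apply: eqc_normc => e /H[y y0 yx].
  have nE : cone_norm (val (x - y)) = nrm (x - y) by [].
  have := cone_entry_le (val (x - y)) 1 0 0; rewrite nE nrmBC raddfB cone_valB.
  by rewrite -/(ent x 1) -/(ent y 1) y0 => /le_trans; apply.
- exact: ent0.
- by move=> a x y x0 y0; rewrite /vanish_set /= entD entZ x0 y0 mulr0 addr0.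
- by move=> x y x0; split; rewrite /vanish_set /= entM x0 ?mul0r ?mulr0.
Qed.

Definition vanish : ideal S := Ideal vanish_ideal.

Local Notation Q := (subcstar_type corner).

(* A lift of the character [x |-> x(1)_00] to [C_0((0, 1])] would send [t e_00] to
   a continuous function [kappa] with values in {0, 1}, because
   [(t (1 - t) e_01) (t (1 - t) e_10) = (t e_00)^2 (1 - t e_00)^2] and [e_01]-terms
   have square zero; but [kappa 0 = 0] and [kappa 1 = 1]. *)
Lemma corner_not_projective : ~ projective Q.
Proof.
move=> projQ.
pose id' (t : R) : R[i] := t%:C.
have uid : ucont id' by exact: ucont_id.
have [u uE] := cone_units uid erefl.
(* Vanishing at 1 as well as at 0 puts all [hat e_ij] into the corner, the off-diagonal ones
   included. *)
pose hat (t : R) : R[i] := t%:C * (1 - t%:C).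
have uhat : ucont hat.
  by apply: ucont_mul => //; apply: ucont_sub => //; exact: ucont_cst.
have hat0 : hat 0 = 0 by rewrite /hat mul0r.
have hat1 : hat 1 = 0 by rewrite /hat subrr mulr0.
have [w wE] := cone_units uhat hat0.
have Q_h : subcstar_pred corner (u 0 0).
  by apply/mem_set; split; rewrite uE // ler01 lexx.
have Q_w k l : subcstar_pred corner (w k l).
  by apply/mem_set; split; rewrite wE ?ler01 ?lexx // hat1; case: ifP.
have S_tau : subcstar_pred scalars (u 0 0 + u 1 1).
  apply/mem_set => t; have [_ _ c0 c1] := coneP (u 0 0 + u 1 1).
  have main s : 0 <= s <= 1 -> [/\ val (u 0 0 + u 1 1) s 0 1 = 0,
      val (u 0 0 + u 1 1) s 1 0 = 0 & val (u 0 0 + u 1 1) s 0 0 = val (u 0 0 + u 1 1) s 1 1].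
    move=> s01; rewrite !cone_entryD !uE // /id'; move: (s%:C) => c.
    by split; rewrite /= ?addr0 ?add0r.
  have [t0|t0] := leP t 0; first by rewrite c0 //; split; rewrite !mxE.
  have [t1|t1] := leP t 1; first by apply: main; rewrite (ltW t0).
  by rewrite (c1 t (ltW t1)); apply: main; rewrite ler01 lexx.
pose h : Q := Sub (u 0 0) Q_h; pose g k l : Q := Sub (w k l) (Q_w k l).
(* The scalar function [t]; having value 1 at 1, it represents the unit of the quotient by
   [vanish]. *)
pose tau : S := Sub (u 0 0 + u 1 1) S_tau.
have tau1 : ent tau 1 = 1.
  by rewrite /ent SubK cone_entryD !uE ?ler01 ?lexx //= addr0.
pose chi (x : Q) : R[i] := val (val x) 1 0 0.
have cornerP (x : Q) : corner_set (val x) by exact: (set_mem (valP x)).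
have chiM (x y : Q) : chi (x ** y) = chi x * chi y.
  have [x01 _ _] := cornerP x.
  by rewrite /chi val_amul cone_entryM x01 mul0r addr0.
have chi_star (x : Q) : chi (star x) = conjc (chi x).
  by rewrite /chi val_star cone_entry_star.
have chi_lin a (x y : Q) : chi (a *: x + y) = a * chi x + chi y.
  by rewrite /chi raddfD linearZ cone_entryD cone_entryZ.
have [sigma sigmaE] : exists sigma : {linear Q -> quotient vanish},
    forall x, sigma x = \pi_(quotient vanish) (chi x *: tau).
  apply: linear_exists => a x y.
  by rewrite chi_lin scalerDl -scalerA raddfD /= -pi_scale.
have sigma_hom : star_hom sigma.
  split=> [x y|x].
    rewrite !sigmaE -Defs.pi_mul; apply/pi_eqP; rewrite /= /vanish_set /=.
    by rewrite entB entZ entM !entZ tau1 chiM; ring.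
  rewrite !sigmaE pi_star; apply/pi_eqP; rewrite /= /vanish_set /=.
  by rewrite entB ent_star !entZ tau1 chi_star conjcM conjc_1; ring.
have [psi [psiM psiS] psiE] := projQ _ vanish sigma sigma_hom.
pose kappa t := ent (psi h) t.
have kappa1 : kappa 1 = 1.
  have /pi_eqP := etrans (psiE h) (sigmaE h); rewrite /= /vanish_set /=.
  have -> : chi h = 1 by rewrite /chi SubK uE ?ler01 ?lexx.
  by rewrite entB entZ tau1 mulr1 -/(kappa 1) => /subr0_eq.
(* The right-hand side is [h^2 (1 - h)^2], expanded to avoid a unit. *)
have rel : g 0 1 ** g 1 0 = h ** h + (-2) *: (h ** (h ** h)) + h ** (h ** (h ** h)).
  have valD (a b : Q) : val (a + b) = val a + val b by exact: raddfD.
  have valZ c (a : Q) : val (c *: a) = c *: val a by exact: linearZ.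
  apply/val_inj; rewrite !valD valZ !val_amul !SubK.
  apply: cone_ext => t t01; apply/matrixP => k l.
  rewrite !cone_entryD cone_entryZ !cone_entryM !wE // !uE //.
  rewrite /hat /id'; move: (t%:C) => c.
  by move: k l; do 2! apply: ord2P; rewrite /= ?(mulr0, mul0r, addr0, add0r) //; ring.
have nil : g 0 1 ** g 0 1 = 0.
  apply/val_inj; rewrite raddf0 val_amul SubK.
  apply: cone_ext => t t01; apply/matrixP => k l.
  rewrite cone_entry0 cone_entryM !wE //; move: (hat t) => c.
  by move: k l; do 2! apply: ord2P; rewrite /= ?(mulr0, mul0r, addr0, add0r).
(* At each [t] the nilpotent [g 0 1] has image 0 among the complex numbers, and [rel] becomes
   [(kappa (1 - kappa))^2 = 0]. *)
have kappa01 t : kappa t = 0 \/ kappa t = 1.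
  have /eqP : ent (psi (g 0 1)) t * ent (psi (g 0 1)) t = 0.
    by rewrite -entM -psiM nil raddf0 ent0.
  rewrite -expr2 sqrf_eq0 => /eqP g0.
  have : ent (psi (g 0 1 ** g 1 0)) t = 0 by rewrite psiM entM g0 mul0r.
  have psiD a b : psi (a + b) = psi a + psi b by exact: raddfD.
  have psiZ c a : psi (c *: a) = c *: psi a by exact: linearZ.
  rewrite rel !psiD psiZ !psiM !entD entZ !entM -/(kappa t).
  move: (kappa t) => c H.
  have /eqP : (c * (1 - c)) ^+ 2 = 0 by rewrite -H; ring.
  rewrite sqrf_eq0 mulf_eq0 => /orP[/eqP-> | ]; first by left.
  by rewrite subr_eq0 => /eqP <-; right.
have kappa0 : kappa 0 = 0 by rewrite /kappa /ent cone_at0 mxE.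
have [_ ku _ _] := coneP (val (psi h)).
have h2 : 0 < 2^-1 :> R by rewrite invr_gt0.
have [d d0 kd] := ku _ h2.
have [N HN] := inv_small d0.
(* A discrete path from 0 to 1 with steps [1 / (N + 1) <= d]: consecutive values differ by at most
   1/2, too little to pass from 0 to 1. *)
have kn n : kappa (n%:R / N.+1%:R) = 0.
  elim: n => [|n IH]; first by rewrite mul0r.
  have := kd (n.+1%:R / N.+1%:R) (n%:R / N.+1%:R).
  rewrite -mulrBl -natrB // subSnn mul1r ger0_norm ?invr_ge0 //.
  move=> /(_ (HN N (leqnn N)) 0 0); rewrite -/(ent _ _) -/(ent _ _).
  rewrite -/(kappa (n.+1%:R / N.+1%:R)) -/(kappa (n%:R / N.+1%:R)) IH subr0.
  have [->//|->] := kappa01 (n.+1%:R / N.+1%:R).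
  by rewrite normc1 leNgt invf_lt1 // ltr1n.
have := kn N.+1; rewrite divff ?pnatr_eq0 // kappa1 => /eqP.
by rewrite oner_eq0.
Qed.

End Corner.

Theorem proposition4p11 (R : realType) :
  exists (P : cstarType R) (Q : subcstar P),
    [/\ projective P, hereditary Q, full Q & ~ projective (subcstar_type Q)].
Proof.
exists (cone (R := R)), corner; split.
- exact: cone_projective.
- exact: corner_hereditary.
- exact: corner_full.
- exact: corner_not_projective.
Qed.
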